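(* Heat content determines planar triangles. That is, let $D_1$ and $D_2$ be triangular domains in $\mathbb{R}^2$ with heat contents $H_{D_1}$ and $H_{D_2}$. If $H_{D_1}(t)=H_{D_2}(t)$ for all $t\in(0,\infty)$, then $D_1$ and $D_2$ are isometric. Equivalently, the map $D\mapsto H_D$ from the space $T$ of isometry classes of triangular domains in the plane to $C^\infty(0,\infty)$ is injective.
   Context: A triangular domain is the (bounded, open) interior of a nondegenerate triangle in $\mathbb{R}^2$. Two triangular domains are isometric if one is the image of the other under an isometry of the Euclidean plane. For a bounded open set $D\subset\mathbb{R}^2$, let $u(x,t)$ be the solution of the heat equation with uniform initial temperature $1$ and zero boundary temperature: $\frac{\partial u}{\partial t}=\Delta u$ on $D\times(0,\infty)$, where $\Delta=\partial_{x_1}^2+\partial_{x_2}^2$; $\lim_{x\to x_0}u(x,t)=0$ for all $x_0\in\partial D$ and $t\in(0,\infty)$; and $u(x,0)=1$ on $D$ (initial condition, attained as $t\to0^+$ for each $x \in D$). The heat content of $D$ is the function $H_D(t)=\int_D u(x,t)\,dx$, $t>0$. *)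

(* Defs.v *)
From mathcomp Require Import all_boot all_order all_algebra.
From mathcomp Require Import all_classical all_reals all_analysis.

Set Implicit Arguments.
Unset Strict Implicit.
Unset Printing Implicit Defensive.

Import Order.TTheory GRing.Theory Num.Theory.
Import numFieldNormedType.Exports.

Local Open Scope classical_set_scope.
Local Open Scope ring_scope.

(* The norm the library puts on R * R is the sup norm. It induces the usual
   topology, but isometries of the plane refer to the Euclidean distance. *)
Definition euclidean_dist (R : realType) (p q : R * R) : R :=
  Num.sqrt ((p.1 - q.1) ^+ 2 + (p.2 - q.2) ^+ 2).

Definition isometric_domains (R : realType) (D1 D2 : set (R * R)) : Prop :=
  exists f : R * R -> R * R,
    (forall p q, euclidean_dist (f p) (f q) = euclidean_dist p q) /\
    f @` D1 = D2.

Definition closed_triangle (R : realType) (a b c : R * R) : set (R * R) :=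
  [set p | exists r s t : R,
     [/\ 0 <= r, 0 <= s, 0 <= t, r + s + t = 1
       & p = r *: a + s *: b + t *: c]].

Definition collinear (R : realType) (a b c : R * R) : Prop :=
  (b.1 - a.1) * (c.2 - a.2) = (b.2 - a.2) * (c.1 - a.1).

Definition triangular_domain (R : realType) (D : set (R * R)) : Prop :=
  exists a b c : R * R, ~ collinear a b c /\ D = interior (closed_triangle a b c).

Definition boundary (R : realType) (D : set (R * R)) : set (R * R) :=
  closure D `\` interior D.

Definition basis_vector (R : realType) (i : 'I_2) : R * R :=
  if i == ord0 then (1, 0) else (0, 1).

Definition partial (R : realType) (i : 'I_2) (f : R * R -> R) : R * R -> R :=
  fun x => 'D_(basis_vector R i) f x.

Definition laplacian (R : realType) (f : R * R -> R) (x : R * R) : R :=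
  \sum_(i < 2) partial i (partial i f) x.

Definition jointly_continuous (R : realType) (D : set (R * R))
    (v : R * R -> R -> R) : Prop :=
  forall (x : R * R) (t : R), D x -> 0 < t -> {for (x, t), continuous (fun z => v z.1 z.2)}.

(* C^2 in space and C^1 in time on D x (0, +oo). Derivatives are total functions
   in the library, so their existence is required separately. *)
Definition C21 (R : realType) (D : set (R * R)) (u : R * R -> R -> R) : Prop :=
  [/\ forall (x : R * R) (t : R), D x -> 0 < t ->
        [/\ derivable (u x) t 1,
            forall i, derivable (u ^~ t) x (basis_vector R i)
          & forall i j,
              derivable (partial j (u ^~ t)) x (basis_vector R i)],
      jointly_continuous D u,
      jointly_continuous D (fun x t => derive1 (u x) t),
      forall i, jointly_continuous D (fun x t => partial i (u ^~ t) x)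
    & forall i j,
        jointly_continuous D (fun x t => partial i (partial j (u ^~ t)) x)].

(* The solution of the heat problem is the bounded one: both the boundary and
   the initial conditions are pointwise, and unbounded functions such as
   derivatives of the heat kernel with pole on the boundary could otherwise be
   added to it. Values of u outside D x (0, +oo) are irrelevant. *)
Definition heat_solution (R : realType) (D : set (R * R))
    (u : R * R -> R -> R) : Prop :=
  [/\ C21 D u,
      exists M : R, forall (x : R * R) (t : R), D x -> 0 < t -> `|u x t| <= M,
      forall (x : R * R) (t : R), D x -> 0 < t -> derive1 (u x) t = laplacian (u ^~ t) x,
      forall (x0 : R * R) (t : R), boundary D x0 -> 0 < t ->
        u x t @[x --> within D (nbhs x0)] --> (0 : R)
    & forall x, D x -> u x t @[t --> 0^'+] --> (1 : R)].

(* H is the heat content of D; only its values on (0, +oo) matter. *)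
Definition is_heat_content (R : realType) (D : set (R * R)) (H : R -> R) : Prop :=
  exists u : R * R -> R -> R, heat_solution D u /\
    forall t : R, 0 < t ->
      H t = (\int[(@lebesgue_measure R \x @lebesgue_measure R)%E]_(x in D) u x t)%R.

(* Main.v *)
Require Import Defs.
From HB Require Import structures.
From mathcomp Require Import all_boot all_order all_algebra.
From mathcomp Require Import all_classical all_reals all_analysis.
From mathcomp Require Import measurable_realfun.
From mathcomp Require Import ring lra.

(* Let w_k = 1 - k^2 int_0^oo e^(-k^2 t) u(., t) dt, which solves Delta w = k^2 w in D with w = 1
   on the boundary. With h_i the heights and l_i the barycentric coordinates, the functions
   e^(-k h_i l_i) are half-plane solutions, and Z_k = sum_i e^(-k h_i l_i) - w_k is, by the
   maximum principle, nonnegative and concentrated near the vertices. If s_i is the homothety of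
   ratio 1/2 centred at the vertex i, then Z_2k o s_i also solves the equation of parameter k, and
   comparing boundary values gives 0 <= sum_i Z_2k o s_i - Z_k <= C e^(-k h), where h is the least
   height. Hence zeta(k) = k^2 int_D Z_k, whose limit is the contribution of the angles, satisfies
   0 <= zeta(2k) - zeta(k) <= C k^2 e^(-k h). Writing A and P for the area and the perimeter, and
   F(k) = int_D w_k, which the heat content determines up to the constant A, the quantity
   k^2 F(k) - 4 k^2 F(2k) + k P is therefore positive, of exponential order e^(-k h).
   Comparing two triangles with the same heat content for large k yields that they have the same
   A, then the same P, then the same h; and A, P and h determine the side lengths by Heron's
   formula. The kernels of wedges are never needed. *)

Set Implicit Arguments.
Unset Strict Implicit.
Unset Printing Implicit Defensive.

Import Order.TTheory GRing.Theory Num.Theory.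
Import numFieldNormedType.Exports.

Local Open Scope classical_set_scope.
Local Open Scope ring_scope.

(** * Integration in the plane *)

(** The combination [k ^+ 2 * F k - 4 * k ^+ 2 * F (2 * k) + k * P] is suggested by the expansion of
    [k ^+ 2 * F k] as [k * P - c] plus a small error, where c gathers the contribution of the
    angles: doubling k doubles [k * P] and leaves c alone, so c cancels without being computed. The
    obstacle is regularity. The initial condition is only pointwise, so the Laplacian cannot simply
    be taken under a time integral that reaches t = 0. The equation is therefore tested through
    finite differences, and an error that is small only in L^1 is averaged away. The analysis of the
    triangle then uses three facts about w_k: continuity in the plane, the weak equation in D, and
    the value 1 off D. For two triangles with one heat content, the transform of H cancels in the
    difference of the two gaps and leaves a polynomial [a * k ^+ 2 + b * k], where a is a multiple
    of the difference of the areas and b is that of the perimeters. Both gaps tend to 0, so a = b =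
    0. The corner term of the gap is nonnegative, hence the edge layer of least height alone bounds
    the gap from below; this makes the exponents comparable. *)

Section LebesgueLine.
Context {R : realType}.
Local Notation leb := (@lebesgue_measure R).
Local Open Scope ereal_scope.

Lemma measurable_affine (c d : R) :
  measurable_fun setT (fun x : R => c * x + d : measurableTypeR R)%R.
Proof.
apply: measurable_funD => //; exact: measurable_funM.
Qed.

(** By uniqueness of Lebesgue measure: [|c|] times the pushforward gives every interval []a, b]] its
    length. A negative c turns the preimage into an interval closed on the left, which has the same
    length. *)
Lemma lebesgue_measure_affine (c d : R) (A : set R) : c != 0%R -> measurable A ->
  pushforward leb (fun x : R => c * x + d : measurableTypeR R)%R A
    = (`|c|^-1)%:E * leb A.
Proof.
move=> c0 mA.
pose f := (fun x : R => c * x + d : measurableTypeR R)%R.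
have mf : measurable_fun setT f by exact: measurable_affine.
have cn0 : (0 <= `|c|)%R by [].
pose mu := mscale (NngNum cn0) (measure_function_pushforward__canonical__measure_function_Measure leb mf).
suff -> : leb A = mu A.
  by rewrite /mu /mscale /= /mscale/= muleA -EFinM mulVf ?normr_eq0// mul1e.
apply: lebesgue_measure_unique => // _ [[a b] _ <-].
rewrite /mu /= /mscale /= /pushforward /= lebesgue_measure_itv /= lte_fin.
have [c_gt0|c_le0] := ltP 0%R c.
  have -> : f @^-1` `]a, b] = `]((a - d) / c)%R, ((b - d) / c)%R]%classic.
    apply/seteqP; split => x; rewrite /f /= !in_itv /= ltr_pdivrMr// ler_pdivlMr//;
    by rewrite ltrBlDr lerBrDr [(x * c)%R]mulrC.
  rewrite lebesgue_measure_itv /= lte_fin ltr_pM2r ?invr_gt0// ltrD2r.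
  case: ifPn => _; last by rewrite mule0.
  rewrite -EFinD -EFinM gtr0_norm//; congr (_%:E); field.
  by rewrite gt_eqF.
have c_lt0 : (c < 0)%R by rewrite lt_neqAle c0.
have -> : f @^-1` `]a, b] = `[((b - d) / c)%R, ((a - d) / c)%R[%classic.
  apply/seteqP; split => x; rewrite /f /= !in_itv /= ltr_ndivlMr// ler_ndivrMr//;
  by rewrite andbC ltrBlDr lerBrDr [(x * c)%R]mulrC.
rewrite lebesgue_measure_itv /= lte_fin ltr_nM2r ?invr_lt0// ltrD2r.
case: ifPn => _; last by rewrite mule0.
rewrite -EFinD -EFinM ltr0_norm//; congr (_%:E); field.
by rewrite c0.
Qed.

Lemma ge0_integral_affine (c d : R) (f : R -> \bar R) : c != 0%R ->
  measurable_fun [set: R] f -> (forall x, 0 <= f x) ->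
  \int[leb]_x f (c * x + d)%R = (`|c|^-1)%:E * \int[leb]_x f x.
Proof.
move=> c0 mf f0.
have mg := measurable_affine c d.
have cn0 : (0 <= `|c|^-1)%R by rewrite invr_ge0.
have := @ge0_integral_pushforward _ _ (measurableTypeR R) (measurableTypeR R) R _ mg leb setT f measurableT mf (fun x _ => f0 x).
rewrite preimage_setT => <-; rewrite //.
rewrite -(@ge0_integral_mscale _ (measurableTypeR R) R leb setT measurableT (NngNum cn0))//.
apply: eq_measure_integral => A mA _.
exact: lebesgue_measure_affine.
Qed.

End LebesgueLine.

Notation leb2 R := (@lebesgue_measure R \x @lebesgue_measure R)%E.
Notation plane R := (measurableTypeR R * measurableTypeR R)%type.

Section LebesguePlane.
Context {R : realType}.
Local Notation leb := (@lebesgue_measure R).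
Local Open Scope ereal_scope.
Implicit Types f : plane R -> \bar R.

Lemma ge0_integral_swap f : measurable_fun [set: plane R] f -> (forall z, 0 <= f z) ->
  \int[leb2 R]_z f (z.2, z.1) = \int[leb2 R]_z f z.
Proof.
move=> mf f0; rewrite (fubini_tonelli2 f mf f0).
rewrite (fubini_tonelli1 (fun z : plane R => f (z.2, z.1)))//.
apply: (measurableT_comp mf); exact: measurable_swap.
Qed.

Lemma measurable_affine2 (a b p c d q : R) : measurable_fun [set: plane R]
  (fun z : plane R => (a * z.1 + b * z.2 + p, c * z.1 + d * z.2 + q)%R : plane R).
Proof.
apply: measurable_fun_pair; apply: (@measurable_funD _ _ R) => //;
  apply: (@measurable_funD _ _ R) => //; apply: (@measurable_funM _ _ R) => //.
Qed.

(** Tonelli and two substitutions in one variable: x at fixed y, which scales by a, then y at fixed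
    x, which scales by the pivot [e] left by Gaussian elimination. The product of the two factors is
    the determinant. *)
Lemma ge0_integral_affine2_aux f (a b p c d q : R) : a != 0%R ->
  (a * d - b * c != 0)%R ->
  measurable_fun [set: plane R] f -> (forall z, 0 <= f z) ->
  \int[leb2 R]_z f (a * z.1 + b * z.2 + p, c * z.1 + d * z.2 + q)%R
  = (`|a * d - b * c|^-1)%:E * \int[leb2 R]_z f z.
Proof.
move=> a0 det0 mf f0.
pose e := ((a * d - b * c) / a)%R.
have e0 : e != 0%R by rewrite mulf_neq0// invr_neq0.
pose g (x y : R) := f (x, e * y + (c / a * x + (q - c / a * p)))%R.
have mT : measurable_fun [set: plane R] (fun z : plane R => (1 * z.1 + 0 * z.2 + 0, c / a * z.1 + e * z.2 + (q - c / a * p))%R : plane R).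
  exact: measurable_affine2.
have mfT := measurableT_comp mf mT.
have mG : measurable_fun [set: plane R] (fun z : plane R => g z.1 z.2).
  rewrite (_ : (fun _ => _) = f \o (fun z : plane R => (1 * z.1 + 0 * z.2 + 0, c / a * z.1 + e * z.2 + (q - c / a * p))%R : plane R))//.
  apply/funext => z /=; rewrite /g mul1r mul0r !addr0; congr (f (_, _)).
  by rewrite addrA [(e * _ + _)%R]addrC.
rewrite (fubini_tonelli2 (fun z : plane R => f (a * z.1 + b * z.2 + p, c * z.1 + d * z.2 + q)%R))//; last first.
  exact: (measurableT_comp mf (measurable_affine2 _ _ _ _ _ _)).
transitivity (\int[leb]_y ((`|a|^-1)%:E * \int[leb]_x g x y)).
  apply: eq_integral => y _; rewrite /fubini_G /=.
  rewrite -(@ge0_integral_affine R a (b * y + p)%R (fun x => g x y))//; last first.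
    by move=> x; exact: f0.
    exact: (measurableT_comp mG (measurable_fun_pair _ _)).
  apply: eq_integral => x _; rewrite /g; congr (f (_, _)); first by rewrite addrA.
  rewrite /e; field.
  by [].
rewrite ge0_integralZl//; last 2 first.
- apply: (measurable_fun_fubini_tonelli_G (m1 := leb) (fun z : plane R => g z.1 z.2)) => // z; exact: f0.
- by move=> y _; apply: integral_ge0 => x _; exact: f0.
rewrite -(fubini_tonelli (fun z : plane R => g z.1 z.2))//; last by move=> z; exact: f0.
transitivity ((`|a|^-1)%:E * \int[leb]_x ((`|e|^-1)%:E * \int[leb]_y f (x, y))).
  congr (_ * _); apply: eq_integral => x _ /=.
  rewrite -(@ge0_integral_affine R e (c / a * x + (q - c / a * p))%R (fun y => f (x, y)))//.
  exact: (measurableT_comp mf (measurable_fun_pair _ _)).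
rewrite ge0_integralZl//; last 2 first.
- exact: (measurable_fun_fubini_tonelli_F (m2 := leb) f).
- by move=> y _; apply: integral_ge0 => x _; exact: f0.
rewrite muleA -EFinM -invfM -normrM -(fubini_tonelli1 f)//.
congr ((`|_|^-1)%:E * _); rewrite /e; field.
by [].
Qed.

(** When a = 0, b is nonzero, and exchanging the coordinates brings it to the pivot position; the
    determinant only changes sign. *)
Lemma ge0_integral_affine2 f (a b p c d q : R) : (a * d - b * c != 0)%R ->
  measurable_fun [set: plane R] f -> (forall z, 0 <= f z) ->
  \int[leb2 R]_z f (a * z.1 + b * z.2 + p, c * z.1 + d * z.2 + q)%R
  = (`|a * d - b * c|^-1)%:E * \int[leb2 R]_z f z.
Proof.
move=> det0 mf f0; have [a0|] := eqVneq a 0%R; last by move=> a0; exact: ge0_integral_affine2_aux.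
have b0 : b != 0%R by apply: contra_neq det0 => ->; rewrite a0 !mul0r subrr.
rewrite -(ge0_integral_swap (f := fun z : plane R => f (a * z.1 + b * z.2 + p, c * z.1 + d * z.2 + q)%R))//; last first.
  exact: (measurableT_comp mf (measurable_affine2 _ _ _ _ _ _)).
under eq_integral => z _ do rewrite /= [(a * _ + _)%R]addrC [(c * _ + _)%R]addrC.
rewrite ge0_integral_affine2_aux//; last by rewrite -opprB oppr_eq0.
by rewrite -opprB normrN.
Qed.

End LebesguePlane.

(** * Open sets of the plane and of space-time are measurable *)

Section CountableBase.

(** With [M] the measurable sets of a product sigma-algebra, such a base makes every open set
    measurable. Leaving [M] arbitrary allows the product step to be iterated, from the line to the
    plane and then to space-time. *)
Definition countable_base_in (T : topologicalType) (M : set (set T)) :=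
  exists B : nat -> set T, (forall n, M (B n)) /\
    forall x U, nbhs x U -> exists n, B n x /\ B n `<=` U.

Lemma open_countable_base (T : topologicalType) (M : set (set T)) (U : set T) :
  M set0 -> (forall F : nat -> set T, (forall n, M (F n)) -> M (\bigcup_n F n)) ->
  countable_base_in M -> open U -> M U.
Proof.
move=> M0 Mcup [B [MB Bnbhs]] oU.
have -> : U = \bigcup_n (if `[< B n `<=` U >] then B n else set0).
  apply/seteqP; split => x.
    move=> Ux; have [n [Bnx BnU]] := Bnbhs x U (open_nbhs_nbhs (conj oU Ux)).
    by exists n => //; rewrite asboolT.
  by move=> [n _]; case: asboolP => // BU Bx; exact: BU.
by apply: Mcup => n; case: asboolP.
Qed.

Lemma countable_base_prod (T1 T2 : topologicalType) (M1 : set (set T1))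
    (M2 : set (set T2)) (M : set (set (T1 * T2))) :
  (forall A B, M1 A -> M2 B -> M (A `*` B)) ->
  countable_base_in M1 -> countable_base_in M2 -> countable_base_in M.
Proof.
move=> MX [B1 [MB1 nB1]] [B2 [MB2 nB2]].
(* Integers that encode no pair are sent to the pair (0, 0), whose rectangle is also in [M]. *)
exists (fun n => let: (i, j) := odflt (0, 0)%N (unpickle n) in B1 i `*` B2 j); split.
  by move=> n; case: (odflt _ _) => i j; exact: MX.
move=> [x y] U [[U1 U2] /= [U1x U2y] U12].
have [i [B1x B1U]] := nB1 _ _ U1x; have [j [B2y B2U]] := nB2 _ _ U2y.
exists (pickle (i, j)); rewrite pickleK /=; split => // -[a b] [/= /B1U ? /B2U ?].
exact: U12.
Qed.

Lemma countable_base_real (R : realType) :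
  countable_base_in (T := R) (@measurable _ (measurableTypeR R)).
Proof.
exists (fun n => let: (p, q) := odflt (0, 0)%Q (unpickle n) in
  [set x : R | ratr p < x < ratr q]); split.
  move=> n; case: (odflt _ _) => p q.
  rewrite [X in measurable X](_ : _ = `]ratr p, ratr q[%classic); first exact: measurable_itv.
  by apply/seteqP; split => x; rewrite /= in_itv.
move=> x U /nbhs_ballP[e /= e0 xeU].
have /rat_in_itvoo[p] : x - e < x by rewrite gtrBl.
have /rat_in_itvoo[q] : x < x + e by rewrite ltrDl.
rewrite !in_itv /= => /andP[xq qe] /andP[ep px].
exists (pickle (p, q)); rewrite pickleK /= px xq; split => // y /andP[py yq].
apply: xeU; rewrite /ball /= ltr_distlC (lt_trans ep py) //=; exact: lt_trans yq qe.
Qed.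

End CountableBase.

Section OpenMeasurable.
Context {R : realType}.

Lemma open_measurable_plane (U : set (R * R)) : open U -> measurable (U : set (plane R)).
Proof.
apply: open_countable_base => //.
  move=> F mF; exact: (@bigcup_measurable _ (plane R)).
apply: (@countable_base_prod R R _ _ _ _ (countable_base_real R) (countable_base_real R)).
by move=> A B mA mB; exact: measurableX.
Qed.

Lemma open_measurable_spacetime (U : set ((R * R) * R)) : open U ->
  measurable (U : set (plane R * measurableTypeR R)).
Proof.
apply: open_countable_base => //.
  move=> F mF; exact: (@bigcup_measurable _ (plane R * measurableTypeR R)%type).
have cbP : countable_base_in (T := (R * R)%type) (@measurable _ (plane R)).
  apply: (@countable_base_prod R R _ _ _ _ (countable_base_real R) (countable_base_real R)).
  by move=> A B mA mB; exact: measurableX.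
apply: (@countable_base_prod (R * R)%type R _ _ _ _ cbP (countable_base_real R)).
by move=> A B mA mB; exact: measurableX.
Qed.

(** [phi] identifies the measurable type with the topological one; it is the identity in both uses.
    Continuity at the points of the open set [D] makes [D] intersected with the preimage of an open
    ray open in the whole space. *)
Lemma continuous_open_measurable (T : topologicalType) d (S : measurableType d)
   (phi : S -> T) (D : set T) (f : T -> R) :
   (forall U : set T, open U -> measurable (phi @^-1` U)) -> open D ->
   (forall x, D x -> {for x, continuous f}) -> measurable_fun (phi @^-1` D) (f \o phi).
Proof.
move=> oM oD cf; apply: (measurability _ (RGenOInfty.measurableE R)).
move=> _ [_ [a ->] <-].
rewrite -[X in measurable X]/(phi @^-1` (D `&` f @^-1` `]a, +oo[)).
apply: oM; rewrite openE => x [Dx fx].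
apply: filterI; first exact: open_nbhs_nbhs.
by apply: (cf x Dx); apply: open_nbhs_nbhs; split => //; exact: interval_open.
Qed.

Lemma continuous_measurable_plane (D : set (R * R)) (f : R * R -> R) : open D ->
  (forall x, D x -> {for x, continuous f}) -> measurable_fun (D : set (plane R)) f.
Proof.
by apply: (@continuous_open_measurable _ _ (plane R) id) => U; exact: open_measurable_plane.
Qed.

Lemma continuous_measurable_spacetime (D : set (R * R * R)) (f : R * R * R -> R) : open D ->
  (forall x, D x -> {for x, continuous f}) ->
  measurable_fun (D : set (plane R * measurableTypeR R)) f.
Proof.
by apply: (@continuous_open_measurable _ _ (plane R * measurableTypeR R)%type id) => U; exact: open_measurable_spacetime.
Qed.

End OpenMeasurable.

(** * A maximum principle for weak solutions *)

Section Comparison.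
Context {R : realType}.
Implicit Types (x : R * R) (s k : R) (D K T : set (R * R)) (Y y : R * R -> R).

Definition five_point s Y x : R :=
  (Y (x.1 + s, x.2) + Y (x.1 - s, x.2) + Y (x.1, x.2 + s) + Y (x.1, x.2 - s)
   - 4 * Y x) / s ^+ 2.

(* A weak form of [Delta y = k^2 y]: the transforms of u below are not known to be C^2
   beforehand. Y need not be smooth, nor even continuous: only its discrete Laplacians at all
   small scales are controlled, and only up to eta. *)
Definition approx_solution k D y := forall K (eta : R), compact K -> K `<=` D -> 0 < eta ->
  exists Y, (forall x, K x -> `|Y x - y x| <= eta) /\
  exists2 s0 : R, 0 < s0 & forall s x, 0 < s -> s < s0 -> K x ->
    `|five_point s Y x - k ^+ 2 * Y x| <= eta.

Lemma five_pointD s Y1 Y2 x :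
  five_point s (fun z => Y1 z + Y2 z) x = five_point s Y1 x + five_point s Y2 x.
Proof. by rewrite /five_point -mulrDl; congr (_ / _); ring. Qed.

Lemma five_pointZ s c Y x : five_point s (fun z => c * Y z) x = c * five_point s Y x.
Proof. by rewrite /five_point [RHS]mulrA; congr (_ / _); ring. Qed.

Lemma approx_solutionD k D y1 y2 : approx_solution k D y1 -> approx_solution k D y2 ->
  approx_solution k D (fun x => y1 x + y2 x).
Proof.
move=> h1 h2 K eta cK KD e0; have e20 : 0 < eta / 2 by rewrite divr_gt0.
have [Y1 [Y1y [s1 s10 H1]]] := h1 K _ cK KD e20.
have [Y2 [Y2y [s2 s20 H2]]] := h2 K _ cK KD e20.
exists (fun x => Y1 x + Y2 x); split => [x Kx|].
  rewrite opprD addrACA (le_trans (ler_normD _ _))// [leRHS](splitr eta).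
  by rewrite lerD ?Y1y ?Y2y.
exists (Num.min s1 s2); first by rewrite lt_min s10.
move=> s x s0; rewrite lt_min => /andP[ss1 ss2] Kx.
rewrite five_pointD mulrDr opprD addrACA (le_trans (ler_normD _ _))// [leRHS](splitr eta).
by rewrite lerD ?H1 ?H2.
Qed.

Lemma approx_solutionZ k D c y : approx_solution k D y ->
  approx_solution k D (fun x => c * y x).
Proof.
move=> h K eta cK KD e0; have c0 : 0 < `|c| + 1 by rewrite ltr_wpDl.
have [Y [Yy [s0 s00 H]]] := h K (eta / (`|c| + 1)) cK KD (divr_gt0 e0 c0).
have lec (a : R) : `|a| <= eta / (`|c| + 1) -> `|c * a| <= eta.
  rewrite ler_pdivlMr// => ha; rewrite normrM mulrC; apply: le_trans ha.
  by rewrite ler_wpM2l// lerDl.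
exists (fun x => c * Y x); split => [x Kx|]; first by rewrite -mulrBr lec// Yy.
exists s0 => // s x sp ss0 Kx; rewrite five_pointZ [k ^+ 2 * _]mulrCA -mulrBr lec//; exact: H.
Qed.

Lemma approx_solution_sum k D n (y : 'I_n -> R * R -> R) :
  (forall i, approx_solution k D (y i)) ->
  approx_solution k D (fun x => \sum_(i < n) y i x).
Proof.
elim: n y => [|n IH] y hy.
  move=> K eta cK KD e0; exists (fun=> 0); split => [x Kx|].
    by rewrite big_ord0 subrr normr0 ltW.
  exists 1 => // s x _ _ _.
  by rewrite /five_point !(mulr0, addr0, subrr, mul0r) normr0 ltW.
have := approx_solutionD (IH (fun i => y (widen_ord (leqnSn n) i)) (fun i => hy _)) (hy ord_max).
by congr approx_solution; apply/funext => x; rewrite big_ord_recr.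
Qed.

Definition midpoint (p x : R * R) : R * R := ((p.1 + x.1) / 2, (p.2 + x.2) / 2).

Lemma continuous_midpoint p : continuous (midpoint p).
Proof.
move=> x; apply: (@cvg_pair _ _ _ _ (nbhs ((p.1 + x.1) / 2)) (nbhs ((p.2 + x.2) / 2))).
  by apply: cvgM; [apply: cvgD; [exact: cvg_cst|exact: cvg_fst]|exact: cvg_cst].
by apply: cvgM; [apply: cvgD; [exact: cvg_cst|exact: cvg_snd]|exact: cvg_cst].
Qed.

(** The homothety of ratio 1/2 carries a stencil of step s to one of step s / 2, so discrete
    Laplacians are divided by 4 and [(2 * k) ^+ 2] becomes [k ^+ 2]. *)
Lemma approx_solution_midpoint k D (p : R * R) y :
  (forall x, D x -> D (midpoint p x)) -> approx_solution (2 * k) D y ->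
  approx_solution k D (fun x => y (midpoint p x)).
Proof.
move=> Dp h K eta cK KD e0.
have cfK : compact (midpoint p @` K).
  by apply: continuous_compact => //; apply: continuous_subspaceT; exact: continuous_midpoint.
have fKD : midpoint p @` K `<=` D by move=> _ [x /KD Dx <-]; exact: Dp.
have [Y [Yy [s0 s00 H]]] := h _ _ cfK fKD e0.
exists (fun x => Y (midpoint p x)); split => [x Kx|]; first by apply: Yy; exists x.
exists s0 => // s x sp ss0 Kx.
have s2 : 0 < s / 2 by rewrite divr_gt0.
have s2s : s / 2 < s0 by apply: le_lt_trans ss0; lra.
have /(H (s / 2) (midpoint p x) s2 s2s) : (midpoint p @` K) (midpoint p x) by exists x.
have -> : five_point s (fun x => Y (midpoint p x)) x
    = 4^-1 * five_point (s / 2) Y (midpoint p x).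
  rewrite /five_point /midpoint /=.
  have E1 (a b c : R) : (a + (b + c)) / 2 = (a + b) / 2 + c / 2 by field.
  have E2 (a b c : R) : (a + (b - c)) / 2 = (a + b) / 2 - c / 2 by field.
  rewrite !E2 !E1; field.
  by rewrite gt_eqF.
rewrite exprMn => Hx.
have -> : k ^+ 2 * Y (midpoint p x) = 4^-1 * (2 ^+ 2 * k ^+ 2 * Y (midpoint p x)) by field.
rewrite -mulrBr normrM ger0_norm ?invr_ge0//; apply: le_trans Hx.
by rewrite ler_piMl// invf_le1// ler1n.
Qed.

Lemma nbhs_box x (U : set (R * R)) : nbhs x U ->
  exists2 e : R, 0 < e & forall y : R * R, `|y.1 - x.1| < e -> `|y.2 - x.2| < e -> U y.
Proof.
move=> /nbhs_ballP[e /= e0 xeU]; exists e => // y y1 y2; apply: xeU.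
by split; rewrite /ball /= distrC.
Qed.

Lemma box_nbhs x (e : R) : 0 < e ->
  \forall z \near x, `|z.1 - x.1| < e /\ `|z.2 - x.2| < e.
Proof.
move=> e0; apply/nbhs_ballP; exists e => //= y [y1 y2].
by move: y1 y2; rewrite /ball /= distrC => ?; rewrite distrC.
Qed.

(** A uniform margin, extracted from the near-covering form of compactness with the filter of small
    positive radii as parameter. *)
Lemma compact_box K (U : set (R * R)) : compact K -> open U -> K `<=` U ->
  exists2 e : R, 0 < e & forall x (y : R * R), K x -> `|y.1 - x.1| < e -> `|y.2 - x.2| < e -> U y.
Proof.
move=> cK oU KU.
have /compact_near_coveringP := cK.
move=> /(_ R (0^'+) (fun e x => forall y : R * R, `|y.1 - x.1| < e -> `|y.2 - x.2| < e -> U y)).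
case.
- move=> x /KU Ux; have [e e0 eU] := nbhs_box (open_nbhs_nbhs (conj oU Ux)).
  have e20 : 0 < e / 2 by rewrite divr_gt0.
  near=> x' d => /= y y1 y2.
  have [x1 x2] : `|x'.1 - x.1| < e / 2 /\ `|x'.2 - x.2| < e / 2.
    by near: x'; exact: box_nbhs.
  have de : d < e / 2 by near: d; exact: nbhs_right_lt.
  apply: eU.
    rewrite -(subrKA x'.1) (le_lt_trans (ler_normD _ _))// [ltRHS]splitr.
    by rewrite ltrD// (lt_trans y1).
  rewrite -(subrKA x'.2) (le_lt_trans (ler_normD _ _))// [ltRHS]splitr.
  by rewrite ltrD// (lt_trans y2).
- move=> e /= e0 H; exists (e / 2); first by rewrite divr_gt0.
  move=> x y Kx; apply: (H (e / 2)) => //=; last by rewrite divr_gt0.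
  by rewrite sub0r normrN gtr0_norm ?divr_gt0// gtr_pMr// invf_lt1// ltr1n.
Unshelve. all: end_near. Qed.

Lemma max_principle k D T y (B : R) : 0 < k -> 0 <= B -> open D -> compact T -> D `<=` T ->
  continuous y -> approx_solution k D y -> (forall x, T x -> ~ D x -> y x <= B) ->
  forall x, T x -> y x <= B.
Proof.
move=> k0 B0 oD cT DT cy sy yB x0 Tx0; rewrite leNgt; apply/negP => Bx0.
(* Three levels above B: [Y] is controlled on [K] (level B + e), its near-maximum falls in [K2]
   (level B + 2 e), and x0 sits at B + 3 e. The gap between the first two leaves room for the
   stencil. *)
pose e := (y x0 - B) / 3.
have e0 : 0 < e by rewrite divr_gt0// subr_gt0.
have yx0 : y x0 = B + 3 * e by rewrite /e; field.
clearbody e.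
have clo b : closed [set x | b <= y x].
  rewrite (_ : [set x | b <= y x] = y @^-1` [set z | b <= z])//.
  by apply: preimage_closed; [move=> x _; exact: cy|exact: closed_ge].
have cpt b : compact (T `&` [set x | b <= y x]) by exact: compact_closedI.
pose K := T `&` [set x | B + e <= y x].
pose K2 := T `&` [set x | B + 2 * e <= y x].
have KD : K `<=` D.
  move=> x [Tx Bx]; apply: contrapT => /(yB _ Tx); apply/negP; rewrite -ltNge.
  by apply: lt_le_trans Bx; rewrite ltrDl.
have K2K x : K2 x -> K x.
  by move=> [Tx] /= Bx; split => //=; lra.
pose U := D `&` [set x | B + e < y x].
have oU : open U.
  apply: openI => //.
  rewrite (_ : [set x | B + e < y x] = y @^-1` [set z | B + e < z])//.
  by apply: open_comp; [move=> x _; exact: cy|exact: open_gt].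
have [|s1 s10 HU] := compact_box (cpt (B + 2 * e)) oU.
  move=> x K2x; split; first exact/KD/K2K.
  by case: K2x => _ /= ?; lra.
have UK x : U x -> K x by move=> [/DT Tx /ltW].
(* The bound e / 4 keeps the near-maximum in [K2] after three errors of size eta. The bound
   [k ^+ 2 * e / 10] contradicts the inequality [k ^+ 2 * Y x1 <= 5 * eta] reached at the end, where
   [Y x1 > e]. *)
pose eta := Num.min (e / 4) (k ^+ 2 * e / 10).
have eta0 : 0 < eta by rewrite lt_min !divr_gt0// ?mulr_gt0 ?exprn_gt0.
have etae : eta <= e / 4 by rewrite ge_min lexx.
have etak : eta <= k ^+ 2 * e / 10 by rewrite ge_min lexx orbT.
have [Y [Yy [s2 s20 HY]]] := sy K eta (cpt _) KD eta0.
have Kx0 : K x0 by split => //=; lra.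
(* Y need not attain its maximum on K: a near-maximum, up to a multiple of s^2, will do, at a
   scale s so small that the five-point stencil stays in K. *)
pose s := Num.min (Num.min (s1 / 2) (s2 / 2)) 1.
have s0 : 0 < s by rewrite !lt_min !divr_gt0 ?ltr01.
have ss1 : s < s1 by rewrite !gt_min; apply/orP; left; apply/orP; left; lra.
have ss2 : s < s2 by rewrite !gt_min; apply/orP; left; apply/orP; right; lra.
have s1' : s <= 1 by rewrite ge_min lexx orbT.
have [M yM] : exists M, forall x, K x -> y x <= M.
  have K0 : K !=set0 by exists x0.
  have cyK : {within K, continuous y} by exact: continuous_subspaceT.
  have [c _ yc] := compact_EVT_max K0 (cpt _) cyK.
  by exists (y c) => x Kx; apply: yc; rewrite inE.
have supY : has_sup (Y @` K).
  split; first by exists (Y x0), x0.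
  exists (M + eta) => _ [x Kx <-]; have := Yy _ Kx; have := yM _ Kx.
  by rewrite ler_norml => ? /andP[? ?]; lra.
have [_ [x1 Kx1 <-] Yx1] := sup_adherent (mulr_gt0 eta0 (exprn_gt0 2 s0)) supY.
set S := sup _ in Yx1.
have YS x : K x -> Y x <= S by move=> Kx; apply: ub_le_sup; [exact: supY.2|exists x].
have s2le : eta * s ^+ 2 <= eta by rewrite ler_piMr ?(ltW eta0)// exprn_ile1 ?(ltW s0).
have Yx0 := YS _ Kx0.
move: (Yy _ Kx0) (Yy _ Kx1); rewrite !ler_norml => /andP[Y0l Y0u] /andP[Y1l Y1u].
have K2x1 : K2 x1 by split; [exact: Kx1.1|rewrite /=; lra].
have shift z : `|z.1 - x1.1| < s1 -> `|z.2 - x1.2| < s1 -> Y z <= Y x1 + eta * s ^+ 2.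
  move=> z1 z2; have /UK/YS := HU _ _ K2x1 z1 z2; lra.
have := HY s x1 s0 ss2 Kx1.
suff lap : five_point s Y x1 <= 4 * eta.
  rewrite ler_norml => /andP[lo _].
  have : k ^+ 2 * Y x1 <= 5 * eta by lra.
  apply/negP; rewrite -ltNge.
  have : k ^+ 2 * e < k ^+ 2 * Y x1 by rewrite ltr_pM2l ?exprn_gt0//; lra.
  lra.
rewrite /five_point ler_pdivrMr ?exprn_gt0//.
have ns : `|s| < s1 by rewrite gtr0_norm.
have aux (a : R) : a + s - a = s by ring.
have aux' (a : R) : a - s - a = - s by ring.
have h1 : Y (x1.1 + s, x1.2) <= Y x1 + eta * s ^+ 2 by apply: shift; rewrite /= ?aux ?subrr ?normr0.
have h2 : Y (x1.1 - s, x1.2) <= Y x1 + eta * s ^+ 2 by apply: shift; rewrite /= ?aux' ?normrN ?subrr ?normr0.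
have h3 : Y (x1.1, x1.2 + s) <= Y x1 + eta * s ^+ 2 by apply: shift; rewrite /= ?aux ?subrr ?normr0.
have h4 : Y (x1.1, x1.2 - s) <= Y x1 + eta * s ^+ 2 by apply: shift; rewrite /= ?aux' ?normrN ?subrr ?normr0.
lra.
Qed.

End Comparison.

(** * Stencils of smooth functions and of exponentials *)

Section SecondDifference.
Context {R : realType}.

(** [L] is chosen so that [psi] vanishes at 0 and at s. Rolle gives a point c with
    [f1 c - f1 (- c) = L * (2 * c)], and the mean value theorem for [f1] on [[- c, c]] identifies
    [L] with a value of [f2]. *)
Lemma second_difference (f f1 f2 : R -> R) (s : R) : 0 < s ->
  (forall r : R, `|r| <= s -> is_derive r (1 : R) f (f1 r)) ->
  (forall r : R, `|r| <= s -> is_derive r (1 : R) f1 (f2 r)) ->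
  exists2 r, `|r| < s & f s + f (- s) - 2 * f 0 = s ^+ 2 * f2 r.
Proof.
move=> s0 df df1.
pose L := (f s + f (- s) - 2 * f 0) / s ^+ 2.
pose psi r := f r + f (- r) - 2 * f 0 - L * r ^+ 2.
have dpsi r : `|r| <= s -> is_derive r (1 : R) psi (f1 r - f1 (- r) - L * (2 * r)).
  move=> rs; have d1 := df r rs.
  have d2 : is_derive (- r) (1 : R) f (f1 (- r)) by apply: df; rewrite normrN.
  rewrite /psi; apply: is_derive_eq.
  by rewrite /GRing.scale /= ; ring.
have cont (h h1 : R -> R) a b : - s <= a -> b <= s ->
    (forall r : R, `|r| <= s -> is_derive r (1 : R) h (h1 r)) -> {within `[a, b], continuous h}.
  move=> sa bs dh; apply: derivable_within_continuous => x; rewrite in_itv /= => /andP[ax xb].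
  by have := dh x; rewrite ler_norml (le_trans sa ax) (le_trans xb bs) => /(_ isT) [].
have inner r a b : - s <= a -> b <= s -> r \in `]a, b[ -> `|r| < s.
  rewrite in_itv /= => sa bs /andP[ar rb].
  by rewrite ltr_norml (le_lt_trans sa ar) (lt_le_trans rb bs).
have Ns0 : - s <= 0 by rewrite oppr_le0 ltW.
have L_E : L * s ^+ 2 = f s + f (- s) - 2 * f 0 by rewrite /L mulfVK// expf_neq0// gt_eqF.
have [r r0s|||c c0s dc] := @Rolle R psi 0 s s0.
- by have [] := dpsi r (ltW (inner _ _ _ Ns0 (lexx s) r0s)).
- exact: (cont _ _ _ _ Ns0 (lexx s) dpsi).
- by rewrite /psi L_E oppr0; ring.
have cs := inner _ _ _ Ns0 (lexx s) c0s.
have dcE : f1 c - f1 (- c) - L * (2 * c) = 0.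
  have [_ <-] := dpsi c (ltW cs); by have [_ ->] := dc.
have c0 : 0 < c by move: c0s; rewrite in_itv /= => /andP[].
have Nsc : - s <= - c by rewrite lerN2 ltW// (le_lt_trans (ler_norm _) cs).
have csl : c <= s by rewrite ltW// (le_lt_trans (ler_norm _) cs).
have [|||d dc' E] := @MVT R f1 f2 (- c) c.
- by lra.
- move=> x xc; apply: df1; exact: ltW (inner _ _ _ Nsc csl xc).
- exact: (cont _ _ _ _ Nsc csl df1).
exists d; first exact: inner Nsc csl dc'.
rewrite -L_E mulrC; congr (_ * _).
apply: (@mulIf _ (2 * c)); first by rewrite mulf_neq0// gt_eqF.
have -> : 2 * c = c - - c by ring.
rewrite -E; clearbody L; lra.
Qed.

End SecondDifference.

Section FivePointLaplacian.
Context {R : realType}.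
Implicit Types (x v : R * R) (f : R * R -> R) (K D : set (R * R)).

Lemma line_shift x v (r h : R) : (r + h) *: v + x = h *: v + (r *: v + x).
Proof. by rewrite scalerDl [_ *: v + _]addrC addrA. Qed.

Lemma is_derive_line f x v (r : R) : derivable f (r *: v + x) v ->
  is_derive r (1 : R) (fun s : R => f (s *: v + x)) ('D_v f (r *: v + x)).
Proof.
move=> df.
have E : (fun h : R => h^-1 *: (((fun s : R => f (s *: v + x)) \o shift r) (h *: (1 : R)) - f (r *: v + x)))
   = (fun h : R => h^-1 *: ((f \o shift (r *: v + x)) (h *: v) - f (r *: v + x))).
  apply/funext => h; congr (_ *: (f _ - _)) => /=.
  have -> : h%:A = h :> R by rewrite /GRing.scale /= mulr1.
  by rewrite (addrC h r) line_shift.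
by split; rewrite /derivable /derive E.
Qed.

Lemma sum_ord2 (F : 'I_2 -> R) : \sum_(i < 2) F i = F ord0 + F (lift ord0 ord0).
Proof. by rewrite 2!big_ord_recl big_ord0 addr0. Qed.

Lemma ler_dist_half (a b c d e : R) : `|a - b| <= e / 2 -> `|c - d| <= e / 2 ->
  `|a + c - (b + d)| <= e.
Proof.
move=> h1 h2; rewrite opprD addrACA (le_trans (ler_normD _ _))//.
by rewrite [leRHS](splitr e) lerD.
Qed.

Lemma basis_shift0 (p : R) x : p *: basis_vector R ord0 + x = (x.1 + p, x.2).
Proof.
apply: injective_projections; rewrite /basis_vector /= /GRing.scale /=.
  by rewrite mulr1 addrC.
by rewrite mulr0 add0r.
Qed.

Lemma basis_shift1 (p : R) x : p *: basis_vector R (lift ord0 ord0) + x = (x.1, x.2 + p).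
Proof.
apply: injective_projections; rewrite /basis_vector /= /GRing.scale /=.
  by rewrite mulr0 add0r.
by rewrite mulr1 addrC.
Qed.

Lemma five_point_basis (s c1 c2 : R) f x : s != 0 ->
  (let i := ord0 in f (s *: basis_vector R i + x) + f (- s *: basis_vector R i + x)
    - 2 * f x = s ^+ 2 * c1) ->
  (let i := lift ord0 ord0 in f (s *: basis_vector R i + x) + f (- s *: basis_vector R i + x)
    - 2 * f x = s ^+ 2 * c2) ->
  five_point s f x = c1 + c2.
Proof.
move=> s0 /= E1 E2; apply: (@mulfI _ (s ^+ 2)); first by rewrite expf_neq0.
rewrite mulrDr -E1 -E2 /five_point mulrC mulfVK ?expf_neq0//.
by rewrite !basis_shift0 !basis_shift1; ring.
Qed.

(** The point y may lie outside [K]: continuity is assumed in full neighbourhoods of the points of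
    [K] times [J]. This is what stencils that leave [K] require. *)
Lemma compact_equicontinuous K (J : set R) (g : R * R -> R -> R) (eta : R) :
  compact K -> compact J -> 0 < eta ->
  (forall x t, K x -> J t -> {for (x, t), continuous (fun z => g z.1 z.2)}) ->
  exists2 e : R, 0 < e & forall x t (y : R * R), K x -> J t ->
    `|y.1 - x.1| < e -> `|y.2 - x.2| < e -> `|g y t - g x t| <= eta.
Proof.
move=> cK cJ eta0 cg.
have /compact_near_coveringP := compact_setX cK cJ.
move=> /(_ R (0^'+) (fun e z => forall y : R * R, `|y.1 - z.1.1| < e -> `|y.2 - z.1.2| < e ->
  `|g y z.2 - g z.1 z.2| <= eta)).
case.
- move=> [x t] [/= Kx Jt].
  have eta20 : 0 < eta / 2 by rewrite divr_gt0.
  have /cvgrPdist_lt/(_ _ eta20) := cg x t Kx Jt.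
  move=> [[U V]] /= [/nbhs_box[e e0 eU] /nbhs_ballP[d /= d0 dV]] UV.
  have e20 : 0 < e / 2 by rewrite divr_gt0.
  near=> z c => y y1 y2.
  have [x1 x2] : `|z.1.1 - x.1| < e / 2 /\ `|z.1.2 - x.2| < e / 2.
    by near: z; apply: (cvg_fst (box_nbhs x e20)).
  have zt : V z.2 by near: z; apply: cvg_snd; apply/nbhs_ballP; exists d.
  have ce : c < e / 2 by near: c; exact: nbhs_right_lt.
  have Uz : U z.1 by apply: eU; lra.
  have Uy : U y.
    apply: eU.
      rewrite -(subrKA z.1.1) (le_lt_trans (ler_normD _ _))// [ltRHS]splitr.
      by rewrite ltrD// (lt_trans y1).
    rewrite -(subrKA z.1.2) (le_lt_trans (ler_normD _ _))// [ltRHS]splitr.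
    by rewrite ltrD// (lt_trans y2).
  have := UV (z.1, z.2) (conj Uz zt); have := UV (y, z.2) (conj Uy zt) => /=.
  rewrite !ltr_norml ler_norml => /andP[? ?] /andP[? ?]; lra.
- move=> e /= e0 H; exists (e / 2); first by rewrite divr_gt0.
  move=> x t y Kx Jt y1 y2; apply: (H (e / 2) _ _ (x, t)) => //=; last by rewrite divr_gt0.
  by rewrite sub0r normrN gtr0_norm ?divr_gt0// gtr_pMr// invf_lt1// ltr1n.
Unshelve. all: end_near. Qed.

(** Each half of the stencil is a second partial derivative at an intermediate point that depends on
    x and t; equicontinuity of these derivatives over the compact time interval makes the error
    uniform. *)
Lemma five_point_laplacian D (u : R * R -> R -> R) K (a b eta : R) : open D -> C21 D u ->
  compact K -> K `<=` D -> 0 < a -> 0 < eta ->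
  exists2 s0 : R, 0 < s0 & forall s x t, 0 < s -> s < s0 -> K x -> t \in `[a, b] ->
    `|five_point s (u ^~ t) x - laplacian (u ^~ t) x| <= eta.
Proof.
move=> oD [du _ _ _ cu2] cK KD a0 eta0.
pose g i x t := partial i (partial i (u ^~ t)) x.
have [s1 s10 HD] := compact_box cK oD KD.
have eta20 : 0 < eta / 2 by rewrite divr_gt0.
have equi i : exists2 e : R, 0 < e & forall x t (y : R * R), K x -> [set` `[a, b]] t ->
    `|y.1 - x.1| < e -> `|y.2 - x.2| < e -> `|g i y t - g i x t| <= eta / 2.
  apply: compact_equicontinuous => //; first exact: segment_compact.
  move=> x t Kx; rewrite /= in_itv /= => /andP[at' _].
  by apply: cu2; [exact: KD|exact: lt_le_trans at'].
have [e1 e10 H1] := equi ord0; have [e2 e20 H2] := equi (lift ord0 ord0).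
exists (Num.min s1 (Num.min e1 e2)); first by rewrite !lt_min s10 e10.
move=> s x t s0; rewrite !lt_min => /andP[ss1 /andP[se1 se2]] Kx tab.
have t0 : 0 < t by move: tab; rewrite in_itv /= => /andP[at' _]; exact: lt_le_trans at'.
have boxe i (r e : R) : `|r| < e -> `|(r *: basis_vector R i + x).1 - x.1| < e /\
    `|(r *: basis_vector R i + x).2 - x.2| < e.
  move=> re; have e0 : 0 < e by exact: le_lt_trans re.
  rewrite /= !addrK /basis_vector /GRing.scale /=.
  by case: ifP => _ /=; rewrite mulr1 mulr0 normr0.
have sec i : exists2 r : R, `|r| < s & u (s *: basis_vector R i + x) t + u (- s *: basis_vector R i + x) t - 2 * u x t = s ^+ 2 * g i (r *: basis_vector R i + x) t.
  have Dr (r : R) : `|r| <= s -> D (r *: basis_vector R i + x).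
    move=> rs; have [] := boxe i r s1 (le_lt_trans rs ss1).
    exact: HD.
  have [||r rs E] := @second_difference R (fun r => u (r *: basis_vector R i + x) t)
     (fun r => partial i (u ^~ t) (r *: basis_vector R i + x))
     (fun r => g i (r *: basis_vector R i + x) t) s s0.
  - move=> r rs; apply: (@is_derive_line (u ^~ t)).
    by have [_ + _] := du _ _ (Dr r rs) t0; apply.
  - move=> r rs; apply: (@is_derive_line (partial i (u ^~ t))).
    by have [_ _] := du _ _ (Dr r rs) t0; apply.
  by exists r => //; rewrite -E scale0r add0r.
have [r1 r1s E1] := sec ord0; have [r2 r2s E2] := sec (lift ord0 ord0).
have [b11 b12] := boxe ord0 r1 e1 (lt_trans r1s se1).
have [b21 b22] := boxe (lift ord0 ord0) r2 e2 (lt_trans r2s se2).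
have := H1 _ _ _ Kx tab b11 b12; have := H2 _ _ _ Kx tab b21 b22.
have -> : laplacian (u ^~ t) x = g ord0 x t + g (lift ord0 ord0) x t.
  exact: sum_ord2.
have -> : five_point s (u ^~ t) x = g ord0 (r1 *: basis_vector R ord0 + x) t +
    g (lift ord0 ord0) (r2 *: basis_vector R (lift ord0 ord0) + x) t.
  by apply: (@five_point_basis _ _ _ (u ^~ t)); [rewrite gt_eqF|exact: E1|exact: E2].
by move=> h2 h1; exact: ler_dist_half.
Qed.

End FivePointLaplacian.

Section ExponentialSolution.
Context {R : realType}.

Lemma expR_second_difference (a s : R) : 0 < s ->
  exists2 r, `|r| < s & expR (a * s) + expR (- (a * s)) - 2 = s ^+ 2 * (a ^+ 2 * expR (a * r)).
Proof.
move=> s0.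
have [||r rs E] := @second_difference R (fun r => expR (a * r)) (fun r => a * expR (a * r))
   (fun r => a ^+ 2 * expR (a * r)) s s0.
- by move=> r _; apply: is_derive_eq; rewrite /GRing.scale /=; ring.
- by move=> r _; apply: is_derive_eq; rewrite /GRing.scale /=; ring.
by exists r => //; rewrite -E mulr0 expR0 mulr1 mulrN.
Qed.

Lemma near_expR1 (a eta : R) : 0 < eta ->
  exists2 s0 : R, 0 < s0 & forall r, `|r| < s0 -> `|expR (a * r) - 1| <= eta.
Proof.
move=> eta0.
have : expR (a * r) @[r --> (0 : R)] --> expR (a * 0).
  apply: (continuous_cvg _ (@continuous_expR R _)).
  by apply: cvgM; [exact: cvg_cst|exact: cvg_id].
rewrite mulr0 expR0 => /cvgrPdist_le/(_ _ eta0) /nbhs_ballP[e /= e0 H].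
exists e => // r re; rewrite distrC; apply: (H r).
by rewrite /ball /= sub0r normrN.
Qed.

(** The exponential is its own approximant: its stencil equals [y x] times [a ^+ 2 * expR (a * r1) +
    b ^+ 2 * expR (b * r2)] with r1 and r2 smaller than the step, and [y] is bounded on [K]. *)
Lemma approx_solution_exp (k a b c : R) (D : set (R * R)) : a ^+ 2 + b ^+ 2 = k ^+ 2 ->
  approx_solution k D (fun x => expR (a * x.1 + b * x.2 + c)).
Proof.
move=> abk K eta cK KD eta0.
pose y (x : R * R) := expR (a * x.1 + b * x.2 + c).
have cy : continuous y.
  move=> x; apply: (continuous_cvg _ (@continuous_expR R _)).
  apply: cvgD; [|exact: cvg_cst].
  apply: cvgD; (apply: cvgM; [exact: cvg_cst|]); [exact: cvg_fst|exact: cvg_snd].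
have [M M0 yM] : exists2 M : R, 0 < M & forall x, K x -> y x <= M.
  have [[x0 Kx0]|K0] := pselect (K !=set0); last first.
    by exists 1 => // x Kx; case: K0; exists x.
  have K0 : K !=set0 by exists x0.
  have cyK : {within K, continuous y} by exact: continuous_subspaceT.
  have [z _ yz] := compact_EVT_max K0 cK cyK.
  exists (y z); first exact: expR_gt0.
  by move=> x Kx; apply: yz; rewrite inE.
(* The summand 1 only keeps [q] positive when a = b = 0. *)
pose q : R := M * (a ^+ 2 + b ^+ 2 + 1).
have q0 : 0 < q by rewrite mulr_gt0// ltr_wpDl// addr_ge0// sqr_ge0.
have e0 : 0 < eta / q by rewrite divr_gt0.
have [s1 s10 H1] := near_expR1 a e0; have [s2 s20 H2] := near_expR1 b e0.
exists y; split; first by move=> x Kx; rewrite subrr normr0 ltW.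
exists (Num.min s1 s2); first by rewrite lt_min s10.
move=> s x s0; rewrite lt_min => /andP[ss1 ss2] Kx.
have [r1 r1s E1] := expR_second_difference a s0.
have [r2 r2s E2] := expR_second_difference b s0.
have -> : five_point s y x = y x * (a ^+ 2 * expR (a * r1) + b ^+ 2 * expR (b * r2)).
  apply: (@mulfI _ (s ^+ 2)); first by rewrite expf_neq0// gt_eqF.
  rewrite [RHS]mulrCA mulrDr -E1 -E2 /five_point mulrC mulfVK ?expf_neq0 ?gt_eqF//.
  rewrite /y /=.
  have -> : a * (x.1 + s) + b * x.2 + c = (a * x.1 + b * x.2 + c) + a * s by ring.
  have -> : a * (x.1 - s) + b * x.2 + c = (a * x.1 + b * x.2 + c) + - (a * s) by ring.
  have -> : a * x.1 + b * (x.2 + s) + c = (a * x.1 + b * x.2 + c) + b * s by ring.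
  have -> : a * x.1 + b * (x.2 - s) + c = (a * x.1 + b * x.2 + c) + - (b * s) by ring.
  set w := a * x.1 + b * x.2 + c; rewrite 4!(expRD w); ring.
rewrite -abk.
have -> : y x * (a ^+ 2 * expR (a * r1) + b ^+ 2 * expR (b * r2)) - (a ^+ 2 + b ^+ 2) * y x
  = y x * (a ^+ 2 * (expR (a * r1) - 1) + b ^+ 2 * (expR (b * r2) - 1)) by ring.
have h1 := H1 _ (lt_trans r1s ss1); have h2 := H2 _ (lt_trans r2s ss2).
have y0 : 0 <= y x by exact: expR_ge0.
rewrite normrM ger0_norm//.
have h : `|a ^+ 2 * (expR (a * r1) - 1) + b ^+ 2 * (expR (b * r2) - 1)| <= (a ^+ 2 + b ^+ 2 + 1) * (eta / q).
  rewrite (le_trans (ler_normD _ _))// (normrM (a ^+ 2)) (normrM (b ^+ 2)) (ger0_norm (sqr_ge0 a)) (ger0_norm (sqr_ge0 b)) mulrDl mulrDl mul1r.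
  by rewrite -[leLHS]addr0 lerD ?(ltW e0)// lerD// ler_wpM2l// sqr_ge0.
apply: (le_trans (ler_pM y0 (normr_ge0 _) (yM _ Kx) h)).
rewrite [leLHS](_ : _ = q * (eta / q)); last by rewrite /q !mulrA.
by rewrite mulrC divfK ?gt_eqF.
Qed.

End ExponentialSolution.

(** * The Laplace transform of the heat flow *)

Section DominatedConvergence.
Context d (T : measurableType d) (R : realType) (mu : {measure set T -> \bar R}).

Lemma Rintegral_dominated_cvg (D : set T) (f_ : nat -> T -> R) (f g : T -> R) :
  measurable D -> (forall n, measurable_fun D (f_ n)) -> measurable_fun D f ->
  (forall x, D x -> f_ ^~ x @ \oo --> f x) -> mu.-integrable D (EFin \o g) ->
  (forall n x, D x -> `|f_ n x| <= g x) ->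
  (\int[mu]_(x in D) f_ n x) @[n --> \oo] --> \int[mu]_(x in D) f x.
Proof.
move=> mD mf_ mf f_f ig fg.
have intf : mu.-integrable D (EFin \o f).
  apply: (le_integrable mD _ _ ig); first exact/measurable_EFinP.
  move=> x Dx /=; rewrite lee_fin (le_trans _ (ler_norm _))//.
  have cv : `|f_ n x| @[n --> \oo] --> `|f x| by apply: cvg_norm; exact: f_f.
  rewrite -(cvg_lim (@Rhausdorff R) cv); apply: limr_le.
    by apply/cvg_ex; eexists; exact: cv.
  by apply: nearW => n; exact: fg.
apply: fine_cvg; rewrite fineK; last exact: integrable_fin_num.
apply: (@dominated_cvg _ _ _ mu D mD (fun n x => (f_ n x)%:E) (EFin \o f) (EFin \o g)) => //.
- by move=> n; exact/measurable_EFinP.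
- by move=> x Dx; apply: cvg_EFin; [exact: nearW|exact: f_f].
Qed.

End DominatedConvergence.

Section TimeIntegral.
Context {R : realType} (lambda : R).
Hypothesis lambda_gt0 : 0 < lambda.
Local Notation leb := (@lebesgue_measure R).

Lemma integrable_expR : leb.-integrable `]0, +oo[ (fun t : R => (expR (- lambda * t))%:E).
Proof.
have h : leb.-integrable `]0, +oo[ (EFin \o exponential_pdf lambda).
  apply: (@integrableS _ _ _ leb setT) => //.
  exact: integrable_exponential_pdf.
have := integrableZl (measurable_itv _ : measurable (_ : set (measurableTypeR R))) lambda^-1 h.
apply: eq_integrable => // t; rewrite inE /= in_itv /= andbT => t0.
rewrite /= exponential_pdfE ?(ltW t0)// -EFinM.
by rewrite mulrA mulVf ?mul1r// gt_eqF.
Qed.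

Lemma measurable_weight (I : set (measurableTypeR R)) :
  measurable_fun I (fun t : measurableTypeR R => expR (- lambda * t)).
Proof.
by apply: measurableT_comp; [exact: measurable_expR|exact: measurable_funM].
Qed.

Lemma integrable_weight (I : set (measurableTypeR R)) (g : measurableTypeR R -> R) (M : R) : measurable I -> I `<=` `]0, +oo[ ->
  measurable_fun I g -> (forall t, I t -> `|g t| <= M) ->
  leb.-integrable I (fun t : R => (expR (- lambda * t) * g t)%:E).
Proof.
move=> mI I0 mg gM.
have h := integrableS (measurable_itv _ : measurable (_ : set (measurableTypeR R))) mI I0 integrable_expR.
have [M0 N0] : 0 <= `|M| /\ 0 <= `|M| by [].
apply: (le_integrable mI _ _ (integrableZl mI `|M| h)).
  apply/measurable_EFinP; apply: measurable_funM => //.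
  exact: measurable_weight.
move=> t It /=; rewrite lee_fin !normrM normr_id mulrC ler_wpM2r//.
by rewrite (le_trans (gM t It))// ler_norm.
Qed.

(** Dominated convergence is a statement about sequences, so continuity of an integral in its
    parameter is checked along sequences. *)
Lemma sequential_continuous (f : R * R -> R) :
  (forall (a : nat -> R * R) (x : R * R), a @ \oo --> x -> f (a n) @[n --> \oo] --> f x) ->
  continuous f.
Proof.
move=> H x; apply/cvgrPdist_lt => e e0; apply: contrapT => nH.
have : forall n : nat, exists y : R * R, ball x (n.+1%:R^-1) y /\ e <= `|f x - f y|.
  move=> n; apply: contrapT => nex; apply: nH.
  suff: nbhs (x : R * R) [set t | `|f x - f t| < e] by [].
  apply/nbhs_ballP; exists n.+1%:R^-1; first by rewrite /= invr_gt0.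
  by move=> y xy /=; rewrite ltNge; apply/negP => le; apply: nex; exists y.
move=> /choice[a Ha].
have ax : a @ \oo --> x.
  apply/cvg_ballP => d d0.
  have [N _ HN] := near_infty_natSinv_lt (PosNum d0).
  exists N => // n /= Nn; apply: (le_ball _ (proj1 (Ha n))).
  exact/ltW/HN.
have /cvgrPdist_lt/(_ _ e0)[N _ HN] := H a x ax.
by have := HN N (leqnn N); rewrite ltNge (proj2 (Ha N)).
Qed.

Lemma continuous_time_integral (I : set (measurableTypeR R)) (g : R * R -> measurableTypeR R -> R) (M : R) :
  measurable I -> I `<=` `]0, +oo[ -> (forall x, measurable_fun I (g x)) ->
  (forall x t, I t -> `|g x t| <= M) -> (forall t, I t -> continuous (g ^~ t)) ->
  continuous (fun x => \int[leb]_(t in I) (expR (- lambda * t) * g x t)).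
Proof.
move=> mI I0 mg gM cg; apply: sequential_continuous => a x ax.
have mE := @measurable_weight I.
apply: (@Rintegral_dominated_cvg _ _ _ leb I (fun n t => expR (- lambda * t) * g (a n) t)
   (fun t => expR (- lambda * t) * g x t) (fun t => expR (- lambda * t) * M)) => //.
- by move=> n; exact: measurable_funM.
- exact: measurable_funM.
- move=> t It; apply: cvgM; first exact: cvg_cst.
  exact: (cvg_comp a (g ^~ t) ax (cg t It x)).
- by apply: (@integrable_weight I (fun=> M) `|M|) => //.
- by move=> n t It; rewrite normrM ger0_norm ?expR_ge0// ler_wpM2l ?expR_ge0// gM.
Qed.

End TimeIntegral.

Section ZeroExtension.
Context {R : realType} (D : set (R * R)) (u : R * R -> R -> R).
Hypotheses (oD : open D) (hu : heat_solution D u).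

(** By the boundary condition the extension by 0 is continuous in the whole plane at each positive
    time. Transforms of u are thus defined and continuous everywhere, as the maximum principle on
    the closed triangle demands. *)
Definition extend0 (x : R * R) (t : R) : R := if `[< D x >] then u x t else 0.

Lemma extend0E x t : D x -> extend0 x t = u x t.
Proof. by move=> Dx; rewrite /extend0 asboolT. Qed.

Lemma extend0_out x t : ~ D x -> extend0 x t = 0.
Proof. by move=> Dx; rewrite /extend0 asboolF. Qed.

Lemma extend0_bounded : exists2 M : R, 0 <= M & forall x t, 0 < t -> `|extend0 x t| <= M.
Proof.
have [_ [M uM] _ _ _] := hu; exists `|M| => // x t t0; rewrite /extend0.
case: asboolP => [Dx|_]; last by rewrite normr0.
by rewrite (le_trans (uM x t Dx t0))// ler_norm.
Qed.

Lemma jointly_continuous_heat : jointly_continuous D u.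
Proof. by have [[]] := hu. Qed.

Lemma continuous_extend0 (t : R) : 0 < t -> continuous (extend0 ^~ t).
Proof.
move=> t0; rewrite /continuous_at => x; have [Dx|nDx] := pselect (D x).
  have nD : nbhs (x : R * R) D by exact: open_nbhs_nbhs (conj oD Dx).
  rewrite /continuous_at /= (extend0E _ Dx).
  apply: (@cvg_trans _ (u y t @[y --> x])).
    apply: near_eq_cvg; near=> y; rewrite extend0E//.
    by near: y; exact: nD.
  have := jointly_continuous_heat Dx t0.
  apply: (@continuous_comp _ _ _ (fun y => (y, t)) (fun z : (R * R) * R => u z.1 z.2)).
  by apply: (@cvg_pair _ _ _ _ (nbhs x) (nbhs t)); [exact: cvg_id|exact: cvg_cst].
rewrite /= /continuous_at extend0_out//.
have [clx|nclx] := pselect (closure D x).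
  have [_ _ _ bd _] := hu.
  have bdx : boundary D x by split => // /interior_subset.
  have /cvgrPdist_lt H := bd x t bdx t0; apply/cvgrPdist_lt => e e0.
  have {}H : nbhs (x : R * R) [set y | D y -> `|0 - u y t| < e] := H e e0.
  suff : nbhs (x : R * R) [set y | `|0 - extend0 y t| < e] by [].
  apply: filterS H => y /=; rewrite /extend0.
  by case: asboolP => // Dy; [apply|rewrite subrr normr0].
have ncl : nbhs (x : R * R) (~` closure D).
  by apply: open_nbhs_nbhs; split => //; exact/closed_openC/closed_closure.
apply: cvg_near_cst; near=> y; rewrite extend0_out// => Dy.
suff : (~` closure D) y by apply; exact: subset_closure.
by near: y; exact: ncl.
Unshelve. all: end_near. Qed.

Lemma measurable_extend0 x : measurable_fun (`]0, +oo[ : set (measurableTypeR R)) (extend0 x : measurableTypeR R -> R).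
Proof.
have [Dx|nDx] := pselect (D x); last first.
  by rewrite (_ : extend0 x = cst 0)//; apply/funext => t; rewrite extend0_out.
apply: open_continuous_measurable_fun; first exact: interval_open.
move=> t; rewrite inE /= in_itv /= andbT => t0.
have -> : extend0 x = u x by apply/funext => s; rewrite extend0E.
have := jointly_continuous_heat Dx t0.
apply: (@continuous_comp _ _ _ (fun s => (x, s)) (fun z : (R * R) * R => u z.1 z.2)).
by apply: (@cvg_pair _ _ _ _ (nbhs x) (nbhs t)); [exact: cvg_cst|exact: cvg_id].
Qed.

Lemma measurable_heat : measurable_fun (D `*` `]0, +oo[ : set (plane R * measurableTypeR R))
  (fun z => u z.1 z.2).
Proof.
apply: continuous_measurable_spacetime.
  rewrite openE => -[x t] [/= Dx t0]; exists (D, `]0, +oo[%classic) => //=.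
  by split; apply: open_nbhs_nbhs; split => //; exact: interval_open.
move=> [x t] [/= Dx]; rewrite in_itv /= andbT; exact: jointly_continuous_heat.
Qed.

End ZeroExtension.

Section FivePointIntegral.
Context d (T : measurableType d) (R : realType) (mu : {measure set T -> \bar R}).

Lemma five_point_integrable (I : set T) (h : R * R -> T -> R) (s : R) x : measurable I ->
  (forall y, mu.-integrable I (EFin \o h y)) ->
  mu.-integrable I (EFin \o (fun t => five_point s (h ^~ t) x)) /\
  five_point s (fun y => \int[mu]_(t in I) h y t) x
  = \int[mu]_(t in I) five_point s (h ^~ t) x.
Proof.
move=> mI hI; rewrite /five_point.
have ihD f g : mu.-integrable I (EFin \o f) -> mu.-integrable I (EFin \o g) ->
    mu.-integrable I (EFin \o (fun t => f t + g t)).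
  by move=> fI gI; have := integrableD mI fI gI; apply: eq_integrable.
have ihB f g : mu.-integrable I (EFin \o f) -> mu.-integrable I (EFin \o g) ->
    mu.-integrable I (EFin \o (fun t => f t - g t)).
  by move=> fI gI; have := integrableB mI fI gI; apply: eq_integrable.
have ihZ (c : R) f : mu.-integrable I (EFin \o f) -> mu.-integrable I (EFin \o (fun t => c * f t)).
  by move=> fI; have := integrableZl mI c fI; apply: eq_integrable.
have h1 := ihD _ _ (hI (x.1 + s, x.2)) (hI (x.1 - s, x.2)).
have h2 := ihD _ _ h1 (hI (x.1, x.2 + s)).
have h3 := ihD _ _ h2 (hI (x.1, x.2 - s)).
have h4 := ihZ 4 _ (hI x).
have h5 := ihB _ _ h3 h4.
split.
  by have := ihZ (s ^- 2) _ h5; apply: eq_integrable => // t _ /=; rewrite mulrC.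
rewrite RintegralZr//.
by rewrite RintegralB// RintegralZl// !RintegralD.
Qed.

Lemma five_point_Rintegral (I : set T) (h : R * R -> T -> R) (s : R) x : measurable I ->
  (forall y, mu.-integrable I (EFin \o h y)) ->
  five_point s (fun y => \int[mu]_(t in I) h y t) x
  = \int[mu]_(t in I) five_point s (h ^~ t) x.
Proof. by move=> mI hI; have [] := five_point_integrable s x mI hI. Qed.

End FivePointIntegral.

(** * Averages over small boxes *)

Section Average.
Context {R : realType}.
Implicit Types (K D : set (R * R)) (y F G : R * R -> R).
Local Notation leb := (@lebesgue_measure R).

Definition box (delta : R) : set (plane R) := `[0, delta] `*` `[0, delta].

Lemma measurable_box delta : measurable (box delta).
Proof. by apply: measurableX; exact: measurable_itv. Qed.

Lemma measure_box (delta : R) : 0 < delta -> leb2 R (box delta) = (delta ^+ 2)%:E.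
Proof.
move=> d0; rewrite product_measure1E//=.
by rewrite lebesgue_measure_itv /= lte_fin d0 oppr0 adde0 -EFinM.
Qed.

Lemma compact_box_set delta : compact (box delta : set (R * R)).
Proof. by apply: compact_setX; exact: segment_compact. Qed.

Lemma continuousT_measurable_plane F : continuous F -> measurable_fun [set: plane R] F.
Proof.
move=> cF; apply: (@continuous_measurable_plane R setT); first exact: openT.
by move=> x _; exact: cF.
Qed.

Lemma continuous_box_integrable (delta : R) F : 0 < delta -> continuous F ->
  (leb2 R).-integrable (box delta) (EFin \o F).
Proof.
move=> d0 cF; apply: measurable_bounded_integrable => //.
- exact: measurable_box.
- by rewrite [X in (X < _)%E](measure_box d0) ltry.
- exact: measurable_funTS (continuousT_measurable_plane cF).
- have cFb : {within (box delta : set (R * R)), continuous F} by exact: continuous_subspaceT.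
  have := compact_bounded (continuous_compact cFb (@compact_box_set delta)).
  move=> [M [Mr HM]]; exists M; split => // N MN z Bz; apply: HM => //.
Qed.

Lemma shiftE (x q : R * R) : x + q = (1 * q.1 + 0 * q.2 + x.1, 0 * q.1 + 1 * q.2 + x.2).
Proof. by apply: injective_projections => /=; ring. Qed.

Lemma continuous_shift F (x : R * R) : continuous F -> continuous (fun q : R * R => F (x + q)).
Proof.
move=> cF q; apply: (continuous_comp _ (cF (x + q))).
by apply: cvgD; [exact: cvg_cst|exact: cvg_id].
Qed.

Lemma ge0_integral_shift (G : plane R -> \bar R) (x : R * R) :
  measurable_fun setT G -> (forall z, 0 <= G z)%E ->
  (\int[leb2 R]_q G ((x + q)%R : plane R) = \int[leb2 R]_z G z)%E.
Proof.
move=> mG G0; under eq_integral do rewrite shiftE.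
have det1 : 1 * 1 - 0 * 0 = 1 :> R by rewrite mulr1 mulr0 subr0.
by rewrite ge0_integral_affine2 ?det1 ?oner_neq0// normr1 invr1 mul1e.
Qed.

(** By translation invariance the box [x + box delta] collects at most the total integral of [G],
    whatever x is: an L^1 bound becomes a uniform one. *)
Lemma shifted_box_bound (delta : R) (x : R * R) D G (c eta : R) F : 0 < delta -> 0 <= eta ->
  (forall q : R * R, box delta q -> D (x + q)) ->
  measurable_fun [set: plane R] G -> (forall z, 0 <= G z) ->
  (\int[leb2 R]_z (G z)%:E <= c%:E)%E -> continuous F ->
  (forall z, D z -> `|F z| <= eta + G z) ->
  `|\int[leb2 R]_(q in box delta) F (x + q)| <= eta * delta ^+ 2 + c.
Proof.
move=> d0 eta0 xD mG G0 Gc cF FG.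
have iF := continuous_box_integrable d0 (@continuous_shift F x cF).
have mB := measurable_box delta.
have mGE : measurable_fun setT (EFin \o G : plane R -> \bar R) by exact/measurable_EFinP.
have mGx : measurable_fun [set: plane R] (fun q : plane R => (G (x + q)%R)%:E).
  rewrite (_ : (fun _ => _) = (EFin \o G) \o (fun q : plane R => (1 * q.1 + 0 * q.2 + x.1, 0 * q.1 + 1 * q.2 + x.2) : plane R)).
    exact: (measurableT_comp mGE (measurable_affine2 _ _ _ _ _ _)).
  by apply/funext => q /=; rewrite shiftE.
rewrite -lee_fin EFin_normr_Rintegral//.
apply: (le_trans (le_abse_integral _ mB _)); first exact: measurable_int iF.
have le1 : (\int[leb2 R]_(q in box delta) `|(F (x + q)%R)%:E| <=
    \int[leb2 R]_(q in box delta) (eta%:E + (G (x + q)%R)%:E))%E.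
  apply: ge0_le_integral => //.
  - apply: measurableT_comp => //; exact: measurable_int iF.
  - by apply: emeasurable_funD => //; exact: measurable_funTS mGx.
  - by move=> q Bq; rewrite -EFinD abse_EFin lee_fin FG//; exact: xD.
apply: (le_trans le1).
rewrite ge0_integralD//; [|by move=> q _; rewrite lee_fin|exact: measurable_funTS mGx].
rewrite integral_cst// [X in (_ * X)%E](measure_box d0) EFinD leeD//.
apply: le_trans Gc; rewrite -(ge0_integral_shift x mGE)//.
by apply: ge0_subset_integral => // q _; rewrite lee_fin.
Qed.

(** The approximant is the mean of [F] over [x + box delta]. Stencils commute with this mean, and
    the error [G], small only in L^1, contributes at most its integral divided by [delta ^+ 2]. *)
Lemma approx_solution_average k D y : open D -> continuous y ->
  (forall K (eta : R), compact K -> K `<=` D -> 0 < eta ->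
    exists F G, [/\ continuous F, forall x, K x -> `|F x - y x| <= eta,
      measurable_fun [set: plane R] G /\ (forall z, 0 <= G z),
      (\int[leb2 R]_z (G z)%:E <= eta%:E)%E &
      exists2 s0 : R, 0 < s0 & forall s x, 0 < s -> s < s0 -> K x ->
        `|five_point s F x - k ^+ 2 * F x| <= eta + G x]) ->
  approx_solution k D y.
Proof.
move=> oD cy H K eta cK KD eta0.
have eta20 : 0 < eta / 2 by rewrite divr_gt0.
have [e1 e10 He1] := compact_box cK oD KD.
have [|e2 e20 He2] := @compact_equicontinuous R K [set 0] (fun x _ => y x) (eta / 2) cK (@compact_set1 R 0) eta20.
  move=> x t _ _; apply: (continuous_comp _ (cy x)); exact: cvg_fst.
pose delta := Num.min (e1 / 2) (e2 / 2).
have d0 : 0 < delta by rewrite lt_min !divr_gt0.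
have de1 : delta < e1 by rewrite gt_min; apply/orP; left; lra.
have de2 : delta < e2 by rewrite gt_min; apply/orP; right; lra.
have boxlt (q : R * R) : box delta q -> `|q.1| <= delta /\ `|q.2| <= delta.
  case: q => q1 q2 [/=]; rewrite !in_itv /= => /andP[? ?] /andP[? ?].
  by rewrite !ger0_norm.
have add1 (x q : R * R) : (x + q).1 - x.1 = q.1 by rewrite /=; ring.
have add2 (x q : R * R) : (x + q).2 - x.2 = q.2 by rewrite /=; ring.
(* The hypothesis is invoked on the sum of [K] and the box, because the mean at a point of [K] sees
   all of it. *)
pose K1 := (fun z : (R * R) * (R * R) => z.1 + z.2) @` (K `*` box delta).
have cK1 : compact K1.
  apply: continuous_compact; last exact: compact_setX cK (@compact_box_set delta).
  apply: continuous_subspaceT => z; exact: cvgD (cvg_fst) (cvg_snd).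
have K1D : K1 `<=` D.
  move=> _ [[x q] /= [Kx Bq] <-]; have [q1 q2] := boxlt q Bq.
  by apply: (He1 x); rewrite ?add1 ?add2 ?(le_lt_trans q1) ?(le_lt_trans q2).
have KK1 (x q : R * R) : K x -> box delta q -> K1 (x + q) by move=> Kx Bq; exists (x, q).
have dd0 : 0 < delta ^+ 2 by rewrite exprn_gt0.
(* [delta] depends only on y, [K] and eta, so [eta'] can be chosen after it and absorb the division
   by [delta ^+ 2]. *)
pose eta' := Num.min (eta / 2) (eta / 2 * delta ^+ 2).
have eta'0 : 0 < eta' by rewrite lt_min eta20 mulr_gt0.
have eta'1 : eta' <= eta / 2 by rewrite ge_min lexx.
have eta'2 : eta' <= eta / 2 * delta ^+ 2 by rewrite ge_min lexx orbT.
have [F [G [cF Fy [mG G0] Geta [s0 s00 HF]]]] := H K1 eta' cK1 K1D eta'0.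
exists (fun x => (delta ^+ 2)^-1 * \int[leb2 R]_(q in box delta) F (x + q)).
have dN0 : delta ^+ 2 != 0 by rewrite gt_eqF.
have dinv : 0 < (delta ^+ 2)^-1 by rewrite invr_gt0.
have mB := measurable_box delta.
have intF (f : R * R -> R) (x : R * R) : continuous f -> (leb2 R).-integrable (box delta) (EFin \o (fun q : R * R => f (x + q))).
  by move=> cf; exact: continuous_box_integrable d0 (@continuous_shift f x cf).
split => [x Kx|].
  have -> : y x = (delta ^+ 2)^-1 * \int[leb2 R]_(q in box delta) y x.
    by rewrite Rintegral_cst// [X in fine X](measure_box d0) /= mulrCA mulVf ?mulr1.
  rewrite -mulrBr -RintegralB//; last 2 first.
  - exact: intF.
  - exact: continuous_box_integrable (@cst_continuous _ _ (y x)).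
  have Kxq q : box delta q -> `|F (x + q) - y x| <= eta.
    move=> Bq; have [q1 q2] := boxlt q Bq.
    rewrite -(subrKA (y (x + q))) (le_trans (ler_normD _ _))// [leRHS]splitr lerD//.
      by apply: le_trans eta'1; apply: Fy; exact: KK1.
    by apply: (He2 x 0) => //; rewrite ?add1 ?add2 ?(le_lt_trans q1) ?(le_lt_trans q2).
  pose F1 z := F z - y x.
  have cF1 : continuous F1 by move=> z; apply: cvgB; [exact: cF|exact: cvg_cst].
  have H1 : `|\int[leb2 R]_(q in box delta) F1 (x + q)| <= eta * delta ^+ 2 + 0.
    apply: (@shifted_box_bound delta x [set z | `|F1 z| <= eta] (fun=> 0)) => //; first exact: ltW.
    - by rewrite integral0.
    - by move=> z /=; rewrite addr0.
  by rewrite normrM (gtr0_norm dinv) mulrC ler_pdivrMr// (le_trans H1)// addr0.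
exists s0 => // s x sp ss0 Kx.
rewrite five_pointZ five_point_Rintegral//; last by move=> z; exact: intF.
rewrite mulrCA -mulrBr.
pose F2 z := five_point s F z - k ^+ 2 * F z.
have cfive : continuous (five_point s F).
  have cs (a b : R) : continuous (fun z : R * R => F (z.1 + a, z.2 + b)).
    move=> z; apply: (continuous_comp _ (cF _)).
    by apply: (@cvg_pair _ _ _ _ (nbhs (z.1 + a)) (nbhs (z.2 + b))); apply: cvgD;
      [exact: cvg_fst|exact: cvg_cst|exact: cvg_snd|exact: cvg_cst].
  rewrite (_ : five_point s F = fun z : R * R => (F (z.1 + s, z.2 + 0) + F (z.1 - s, z.2 + 0)
     + F (z.1 + 0, z.2 + s) + F (z.1 + 0, z.2 - s) - 4 * F z) / s ^+ 2); last first.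
    by apply/funext => z; rewrite /five_point !addr0.
  move=> z; apply: cvgM; last exact: cvg_cst.
  apply: cvgB; last by apply: cvgM; [exact: cvg_cst|exact: cF].
  by apply: cvgD; [apply: cvgD; [apply: cvgD|]|]; exact: cs.
have cF2 : continuous F2.
  by move=> z; apply: cvgB; [exact: cfive|apply: cvgM; [exact: cvg_cst|exact: cF]].
have fiveE q : five_point s (fun z : R * R => F (z + q)) x = five_point s F (x + q).
  rewrite /five_point; have E (a b : R) : (x.1 + a, x.2 + b) + q = ((x + q).1 + a, (x + q).2 + b).
    by apply: injective_projections => /=; ring.
  by have := E s 0; have := E (- s) 0; have := E 0 s; have := E 0 (- s); rewrite !addr0 => -> -> -> ->.
have -> : \int[leb2 R]_(q in box delta) five_point s (fun z : R * R => F (z + q)) x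
    - k ^+ 2 * \int[leb2 R]_(q in box delta) F (x + q)
    = \int[leb2 R]_(q in box delta) F2 (x + q).
  rewrite -RintegralZl//; last exact: intF.
  rewrite -RintegralB//; last 2 first.
  - by under eq_fun do rewrite fiveE; exact: intF.
  - have cz : continuous (fun z => k ^+ 2 * F z).
      by move=> z; apply: cvgM; [exact: cvg_cst|exact: cF].
    exact: intF cz.
  by apply: eq_Rintegral => q _; rewrite fiveE.
have H2 : `|\int[leb2 R]_(q in box delta) F2 (x + q)| <= eta' * delta ^+ 2 + eta'.
  apply: (@shifted_box_bound delta x K1 G) => //; first exact: ltW.
  - by move=> q; exact: KK1.
  - by move=> z K1z; exact: HF.
rewrite normrM (gtr0_norm dinv) mulrC ler_pdivrMr//.
apply: (le_trans H2); rewrite [leRHS](_ : _ = eta / 2 * delta ^+ 2 + eta / 2 * delta ^+ 2); last by field.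
by rewrite lerD// ler_wpM2r// ltW.
Qed.

End Average.

Section LaplaceTransform.
Context {R : realType} (D : set (R * R)) (u : R * R -> R -> R) (k : R).
Hypotheses (oD : open D) (D_fin : (leb2 R D < +oo)%E) (hu : heat_solution D u) (k0 : 0 < k).
Local Notation leb := (@lebesgue_measure R).
Local Notation lambda := (k ^+ 2).
Local Notation ubar := (extend0 D u).
Local Notation J := (`]0, +oo[%classic : set (measurableTypeR R)).

Let lambda0 : 0 < lambda. Proof. by rewrite exprn_gt0. Qed.

Definition laplace (I : set (measurableTypeR R)) (x : R * R) : R :=
  \int[leb]_(t in I) (expR (- lambda * t) * ubar x t).

Lemma continuous_laplace I : measurable I -> I `<=` J -> continuous (laplace I).
Proof.
move=> mI IJ; have [M M0 uM] := extend0_bounded hu.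
have t0 t : I t -> 0 < t by move=> /IJ /=; rewrite in_itv /= andbT.
apply: (continuous_time_integral lambda0 (M := M)) => //.
- by move=> x; apply: measurable_funS (measurable_extend0 hu x).
- by move=> x t /t0; exact: uM.
- by move=> t /t0; exact: continuous_extend0.
Qed.

Lemma integrable_laplace I x : measurable I -> I `<=` J ->
  leb.-integrable I (fun t : R => (expR (- lambda * t) * ubar x t)%:E).
Proof.
move=> mI IJ; have [M M0 uM] := extend0_bounded hu.
apply: (integrable_weight lambda0 (M := M)) => //.
- by apply: measurable_funS (measurable_extend0 hu x).
- by move=> t /IJ /=; rewrite in_itv /= andbT; exact: uM.
Qed.

Lemma laplace_derivative_integrable z a b : D z -> 0 < a -> a < b ->
  leb.-integrable `[a, b] (EFin \o (fun t : R => expR (- lambda * t) * derive1 (u z) t)).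
Proof.
move=> Dz a0 ab; have [[du _ jdu _ _] _ _ _ _] := hu.
apply: continuous_compact_integrable; first exact: segment_compact.
apply: continuous_in_subspaceT => t; rewrite inE /= in_itv /= => /andP[/(lt_le_trans a0) t0 _].
have pair_cvg : (fun s : R => (z, s)) @ t --> (z, t).
  by apply: (@cvg_pair _ _ _ _ (nbhs z) (nbhs t)); [exact: cvg_cst|exact: cvg_id].
apply: cvgM; last exact: (continuous_comp pair_cvg (jdu z t Dz t0)).
apply: (continuous_cvg _ (@continuous_expR R _)).
by apply: cvgM; [exact: cvg_cst|exact: cvg_id].
Qed.

Lemma laplace_time_derivative z a b : D z -> 0 < a -> a < b ->
  \int[leb]_(t in `[a, b]) (expR (- lambda * t) * derive1 (u z) t)
  = expR (- lambda * b) * u z b - expR (- lambda * a) * u z a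
    + lambda * \int[leb]_(t in `[a, b]) (expR (- lambda * t) * u z t).
Proof.
move=> Dz a0 ab.
have [[du ju jdu _ _] _ _ _ _] := hu.
have pair_cvg (t : R) : (fun s : R => (z, s)) @ t --> (z, t).
  by apply: (@cvg_pair _ _ _ _ (nbhs z) (nbhs t)); [exact: cvg_cst|exact: cvg_id].
have dut (t : R) : 0 < t -> derivable (u z) t 1 by move=> t0; have [] := du z t Dz t0.
have cu (t : R) : 0 < t -> {for t, continuous (u z)}.
  by move=> t0; apply/differentiable_continuous/derivable1_diffP/dut.
have cdu (t : R) : 0 < t -> {for t, continuous (derive1 (u z))}.
  move=> t0; apply: (continuous_comp (pair_cvg t) (jdu z t Dz t0)).
have dE (t : R) : is_derive t (1 : R) (fun t : R => expR (- lambda * t)) (- lambda * expR (- lambda * t)).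
  by apply: is_derive_eq; rewrite /GRing.scale /=; ring.
have pos (t : R) : t \in `[a, b] -> 0 < t by rewrite in_itv /= => /andP[/(lt_le_trans a0)].
have b0 := lt_trans a0 ab.
have cE : continuous (fun t : R => expR (- lambda * t)).
  by move=> t; apply/differentiable_continuous/derivable1_diffP; have [] := dE t.
rewrite (@Rintegration_by_parts R (fun t => expR (- lambda * t)) (u z)
   (fun t => - lambda * expR (- lambda * t)) (derive1 (u z)) a b ab); last 6 first.
- by apply: continuous_subspaceT => t; apply: cvgM; [exact: cvg_cst|exact: cE].
- split; first by move=> t _; have [] := dE t.
  + by apply: cvg_at_right_filter; exact: cE.
  + by apply: cvg_at_left_filter; exact: cE.
- by move=> t _; rewrite derive1E; have [_ ->] := dE t.
- by apply: continuous_in_subspaceT => t; rewrite inE => /pos; exact: cdu.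
- split; first by move=> t /subset_itv_oo_cc /pos; exact: dut.
  + by apply: cvg_at_right_filter; exact: cu.
  + by apply: cvg_at_left_filter; exact: cu.
- by [].
have iE : leb.-integrable `[a, b] (EFin \o (fun t : R => expR (- lambda * t) * u z t)).
  apply: continuous_compact_integrable; first exact: segment_compact.
  apply: continuous_in_subspaceT => t; rewrite inE => /pos t0.
  by apply: cvgM; [exact: cE|exact: cu].
rewrite (_ : \int[leb]_(t in `[a, b]) (- lambda * expR (- lambda * t) * u z t) = - lambda * \int[leb]_(t in `[a, b]) (expR (- lambda * t) * u z t)).
  by congr (_ + _); rewrite -mulNr opprK.
by rewrite -RintegralZl//; apply: eq_Rintegral => t _; rewrite mulrA.
Qed.

(** Derivatives are uniformly controlled only on compact intervals of positive times. The right end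
    [n.+2] keeps the window nondegenerate at n = 0. *)
Definition time_window (n : nat) : set (measurableTypeR R) := `[n.+1%:R^-1, n.+2%:R].

Lemma measurable_window n : measurable (time_window n).
Proof. exact: measurable_itv. Qed.

Lemma window_lt n : n.+1%:R^-1 < n.+2%:R :> R.
Proof. by rewrite (@le_lt_trans _ _ 1) ?invf_le1 ?ler1n ?ltr1n. Qed.

Lemma window_pos n t : time_window n t -> 0 < t.
Proof. by rewrite /time_window /= in_itv /= => /andP[+ _]; apply: lt_le_trans; rewrite invr_gt0. Qed.

Lemma windowJ n : time_window n `<=` J.
Proof. by move=> t /window_pos; rewrite /= in_itv /= andbT. Qed.

Lemma near_window t : 0 < t -> \forall n \near \oo, time_window n t.
Proof.
move=> t0.
near=> n; rewrite /time_window /= in_itv /=; apply/andP; split.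
  apply: ltW; near: n; exact: near_infty_natSinv_lt (PosNum t0).
rewrite (@le_trans _ _ n%:R)// ?ler_nat ?leqW ?leqnSn//.
by near: n; exact: nbhs_infty_ger.
Unshelve. all: end_near. Qed.

Let weight_tail (n : nat) : R :=
  \int[leb]_(t in J) (expR (- lambda * t) * \1_(~` time_window n) t).

Lemma weight_tail_cvg : weight_tail @ \oo --> 0.
Proof.
rewrite -[X in _ --> X](_ : \int[leb]_(t in J) (fun=> 0) t = 0); last first.
  by rewrite /Rintegral integral0.
apply: (@Rintegral_dominated_cvg _ _ _ leb J _ _ (fun t => expR (- lambda * t))) => //.
- move=> n; apply: measurable_funM; first exact: measurable_weight.
  apply: measurable_indic; apply: measurableC; exact: measurable_window.
- move=> t; rewrite /= in_itv /= andbT => t0.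
  apply: cvg_near_cst; have := near_window t0; apply: filterS => n tn.
  by rewrite indicE memNset ?mulr0 //= => /(_ tn).
- exact: integrable_expR.
- move=> n t _; rewrite normrM ger0_norm ?expR_ge0// ler_piMr ?expR_ge0//.
  by rewrite indicE; case: (_ \in _); rewrite ?normr1 ?normr0.
Qed.

Lemma laplace_tail (M : R) n x : (forall x t, 0 < t -> `|ubar x t| <= M) ->
  `|laplace J x - laplace (time_window n) x| <= M * weight_tail n.
Proof.
move=> uM.
have mI := measurable_window n.
have mJ : measurable J by exact: measurable_itv.
have mJI : measurable (J `\` time_window n) by exact: measurableD.
have JI : J `\` time_window n `<=` J by exact: subDsetl.
have -> : laplace J x - laplace (time_window n) x = laplace (J `\` time_window n) x.
  rewrite /laplace -{1}(setDUK (@windowJ n)) Rintegral_setU//.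
  - by rewrite addrAC subrr add0r.
  - rewrite setDUK; [exact: integrable_laplace|exact: windowJ].
  - by rewrite disj_set2E; apply/eqP; rewrite setDIK.
rewrite /laplace (le_trans (le_normr_Rintegral mJI (integrable_laplace x mJI JI)))//.
rewrite /weight_tail -RintegralZl//; last first.
  have := @integrable_weight _ _ lambda0 J (\1_(~` time_window n)) 1 mJ.
  apply => //.
  - apply: measurable_indic; exact: measurableC.
  - by move=> t _; rewrite indicE; case: (_ \in _); rewrite ?normr1 ?normr0.
have -> : \int[leb]_(t in J) (M * (expR (- lambda * t) * \1_(~` time_window n) t))
   = \int[leb]_(t in J `\` time_window n) (M * expR (- lambda * t)).
  rewrite setDE Rintegral_mkcondr; apply: eq_Rintegral => t _.
  by rewrite patchE indicE; case: (_ \in _); rewrite ?mulr1 ?mulr0.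
apply: le_Rintegral => //.
- have := integrable_laplace x mJI JI => /integrable_norm; apply: eq_integrable => //.
- have := integrableZl mJI M (integrableS mJ mJI JI (integrable_expR lambda0)).
  by apply: eq_integrable => // t _ /=; rewrite EFinM.
- move=> t [/= + _]; rewrite in_itv /= andbT => t0.
  by rewrite normrM ger0_norm ?expR_ge0// mulrC ler_wpM2r ?expR_ge0// uM.
Qed.

(* The initial condition holds only pointwise, so the truncated transforms solve the equation up
   to an error that tends to 0 in L^1 but perhaps not uniformly; averaging over small boxes
   makes it uniform. *)
Definition initial_defect (n : nat) (z : R * R) : R :=
  lambda * `|\1_D z - expR (- lambda * n.+1%:R^-1) * ubar z n.+1%:R^-1|.

Lemma initial_defect_ge0 n z : 0 <= initial_defect n z.
Proof. by rewrite /initial_defect mulr_ge0// ltW. Qed.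

Lemma measurable_initial_defect n : measurable_fun [set: plane R] (initial_defect n).
Proof.
apply: measurable_funM => //; apply: measurableT_comp => //.
apply: measurable_funB.
  by apply: measurable_indic; exact: open_measurable_plane.
apply: measurable_funM => //; apply: continuousT_measurable_plane.
by apply: continuous_extend0 => //; rewrite invr_gt0.
Qed.

(** Dominated convergence along the times [n.+1%:R^-1]: the defect is bounded on [D], which has
    finite measure, vanishes identically off [D], and tends to 0 on [D] by the initial condition. *)
Lemma near_initial_defect (eta : R) : 0 < eta ->
  \forall n \near \oo, (\int[leb2 R]_z (initial_defect n z)%:E <= eta%:E)%E.
Proof.
move=> eta0; have [M M0 uM] := extend0_bounded hu.
have mD : measurable (D : set (plane R)) by exact: open_measurable_plane.
have dom n z : `|initial_defect n z| <= lambda * (1 + M) * \1_D z.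
  rewrite ger0_norm ?initial_defect_ge0// /initial_defect -mulrA ler_wpM2l ?(ltW lambda0)//.
  have [Dz|nDz] := pselect (D z); last first.
    by rewrite indicE memNset// extend0_out// mulr0 subrr normr0 mulr0.
  rewrite indicE mem_set// mulr1 (le_trans (ler_normB _ _))// normr1 lerD2l.
  rewrite normrM ger0_norm ?expR_ge0// (le_trans _ (uM z n.+1%:R^-1 _))//.
  rewrite ler_piMl// -expR0 ler_expR mulNr oppr_le0 mulr_ge0// ltW//.
have iD : (leb2 R).-integrable setT (EFin \o (fun z => lambda * (1 + M) * \1_D z)).
  have h : (leb2 R).-integrable setT (fun z => (\1_D z)%:E).
    apply/integrableP; split; first exact/measurable_EFinP/measurable_indic.
    under eq_integral do rewrite gee0_abs ?lee_fin//.
    by rewrite integral_indic// setIT.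
  have := integrableZl measurableT (lambda * (1 + M)) h.
  by apply: eq_integrable => // z _ /=; rewrite EFinM.
have iG n : (leb2 R).-integrable setT (EFin \o initial_defect n).
  apply: (le_integrable measurableT _ _ iD).
    by apply/measurable_EFinP; exact: measurable_initial_defect.
  by move=> z _ /=; rewrite lee_fin (le_trans (dom n z)) ?ler_norm.
have : (\int[leb2 R]_z initial_defect n z) @[n --> \oo] --> \int[leb2 R]_(z in setT) (fun=> 0) z.
  apply: (@Rintegral_dominated_cvg _ (plane R) R (leb2 R) setT initial_defect (fun=> 0) _ _ _ _ _ iD) => //.
  - exact: measurable_initial_defect.
  - move=> z _; rewrite /initial_defect.
    have [Dz|nDz] := pselect (D z); last first.
      under eq_fun do rewrite indicE memNset// extend0_out// mulr0 subrr normr0 mulr0.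
      exact: cvg_cst.
    have [_ _ _ _ init] := hu.
    have inv0 : (n.+1%:R^-1 : R) @[n --> \oo] --> (0 : R)^'+.
      move=> A HA; have {}HA : nbhs (0 : R) [set t | 0 < t -> A t] := HA.
      have [N _ HN] := @cvg_harmonic R _ HA.
      by exists N => // n Nn; apply: (HN n Nn); rewrite /harmonic invr_gt0.
    rewrite -(mulr0 lambda); apply: cvgM; first exact: cvg_cst.
    rewrite -(normr0 R); apply: cvg_norm.
    rewrite indicE mem_set// -(subrr (1 : R)); apply: cvgB; first exact: cvg_cst.
    rewrite -[X in _ --> X]mulr1; apply: cvgM.
      suff : expR (- lambda * n.+1%:R^-1) @[n --> \oo] --> expR (- lambda * 0).
        by rewrite mulr0 expR0.
      apply: (continuous_cvg _ (@continuous_expR R _)).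
      by apply: cvgM; [exact: cvg_cst|exact: cvg_harmonic].
    under eq_fun do rewrite extend0E//.
    exact: (cvg_comp _ _ inv0 (init z Dz)).
rewrite /Rintegral integral0 /= => /cvgrPdist_le/(_ _ eta0).
apply: filterS => n; rewrite sub0r normrN => h.
rewrite -(fineK (integrable_fin_num measurableT (iG n))) lee_fin.
exact: le_trans (ler_norm _) h.
Qed.

(** If u is the probability that a diffusion with generator the Laplacian has not left [D] at time
    t, this is the expectation of [exp (- k^2 tau)], with tau the exit time. *)
Definition exit_transform (x : R * R) : R := 1 - lambda * laplace J x.

Lemma exit_transform_out x : ~ D x -> exit_transform x = 1.
Proof.
move=> nDx; rewrite /exit_transform /laplace.
under eq_Rintegral do rewrite extend0_out// mulr0.
by rewrite /Rintegral integral0 mulr0 subr0.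
Qed.

Lemma continuous_affine_laplace I : measurable I -> I `<=` J ->
  continuous (fun x => 1 - lambda * laplace I x).
Proof.
move=> mI IJ x; apply: cvgB; first exact: cvg_cst.
by apply: cvgM; [exact: cvg_cst|exact: continuous_laplace].
Qed.

Lemma continuous_exit_transform : continuous exit_transform.
Proof. by apply: continuous_affine_laplace => //; exact: measurable_itv. Qed.

(** On a window, the stencil passes under the integral and is uniformly close to the time derivative
    of u; integration by parts then turns that derivative into [lambda] times the transform plus the
    two end terms. *)
Lemma five_point_laplace K n (eta : R) : compact K -> K `<=` D -> 0 < eta ->
  exists2 s0 : R, 0 < s0 & forall s x, 0 < s -> s < s0 -> K x ->
  `|five_point s (laplace (time_window n)) x - lambda * laplace (time_window n) x -
    (expR (- lambda * n.+2%:R) * u x n.+2%:R - expR (- lambda * n.+1%:R^-1) * u x n.+1%:R^-1)| <= eta.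
Proof.
move=> cK KD eta0.
pose C := \int[leb]_(t in time_window n) expR (- lambda * t).
have C0 : 0 <= C by apply: Rintegral_ge0 => t _; exact: expR_ge0.
have e0 : 0 < eta / (C + 1) by rewrite divr_gt0// ltr_wpDl.
have inv0 : 0 < n.+1%:R^-1 :> R by rewrite invr_gt0.
have [C21u _ heat _ _] := hu.
have [s1 s10 H1] := @five_point_laplacian R D u K (n.+1%:R^-1) (n.+2%:R) _ oD C21u cK KD inv0 e0.
have [s2 s20 H2] := compact_box cK oD KD.
exists (Num.min s1 s2); first by rewrite lt_min s10.
move=> s x s0; rewrite lt_min => /andP[ss1 ss2] Kx.
have Dx := KD _ Kx.
have mI := measurable_window n.
have lapE : laplace (time_window n) x = \int[leb]_(t in time_window n) (expR (- lambda * t) * u x t).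
  by apply: eq_Rintegral => t _; rewrite extend0E.
have := laplace_time_derivative Dx inv0 (window_lt n).
rewrite -lapE => dE.
have -> : forall p q r l : R, p - l - (q - r) = p - (q - r + l) by move=> *; ring.
rewrite -dE.
rewrite five_point_Rintegral//; last by move=> y; apply: integrable_laplace => //; exact: windowJ.
have fE t : five_point s (fun y => expR (- lambda * t) * ubar y t) x
   = expR (- lambda * t) * five_point s (u ^~ t) x.
  rewrite five_pointZ; congr (_ * _); rewrite /five_point.
  have ns : `|s| < s2 by rewrite gtr0_norm.
  have aux (a : R) : a + s - a = s by ring.
  have aux' (a : R) : a - s - a = - s by ring.
  rewrite !extend0E//; apply: (H2 x) => //=; rewrite ?aux ?aux' ?normrN ?subrr ?normr0//.
have mE : measurable (time_window n) by [].
have iE := integrableS (measurable_itv _ : measurable (J : set (measurableTypeR R))) mI (@windowJ n) (integrable_expR lambda0).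
have [i5 _] := five_point_integrable s x mI (fun y => integrable_laplace y mI (@windowJ n)).
have id := laplace_derivative_integrable Dx inv0 (window_lt n).
rewrite -RintegralB//.
have iB := integrableB mI i5 id.
rewrite (le_trans (le_normr_Rintegral mI _))//.
apply: (@le_trans _ _ (\int[leb]_(t in time_window n) (expR (- lambda * t) * (eta / (C + 1))))).
  apply: le_Rintegral => //.
  - by have := integrable_norm iB; apply: eq_integrable.
  - by have := integrableZr mI (eta / (C + 1)) iE; apply: eq_integrable => // t _ /=; rewrite EFinM.
  - move=> t tI; rewrite fE -mulrBr normrM ger0_norm ?expR_ge0// ler_wpM2l ?expR_ge0//.
    have := heat x t Dx (window_pos tI) => ->; apply: H1 => //.
rewrite RintegralZr// -/C mulrCA ler_piMr ?(ltW eta0)// ler_pdivrMr ?mul1r ?lerDl//.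
by rewrite ltr_wpDl.
Qed.

Lemma approx_solution_exit_transform : approx_solution k D exit_transform.
Proof.
have [M M0 uM] := extend0_bounded hu.
apply: approx_solution_average => //; first exact: continuous_exit_transform.
move=> K eta cK KD eta0.
have eta2 : 0 < eta / 2 by rewrite divr_gt0.
have tail : \forall n \near \oo, lambda * (M * weight_tail n) <= eta.
  have : lambda * (M * weight_tail n) @[n --> \oo] --> lambda * (M * 0).
    apply: cvgM; first exact: cvg_cst.
    by apply: cvgM; [exact: cvg_cst|exact: weight_tail_cvg].
  rewrite !mulr0 => /cvgrPdist_le/(_ _ eta0); apply: filterS => n.
  by rewrite sub0r normrN => /(le_trans (ler_norm _)).
have decay : \forall n \near \oo, lambda * (expR (- lambda * n.+2%:R) * M) <= eta / 2.
  have : M * n.+1%:R^-1 @[n --> \oo] --> M * 0.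
    by apply: cvgM; [exact: cvg_cst|exact: cvg_harmonic].
  rewrite mulr0 => /cvgrPdist_le/(_ _ eta2); apply: filterS => n.
  rewrite sub0r normrN => /(le_trans (ler_norm _)); apply: le_trans.
  (* It remains that [lambda * expR (- lambda * n.+2%:R) <= n.+1%:R^-1], which follows from
     [1 + x <= expR x]. *)
  rewrite mulrA mulrC ler_wpM2l// mulNr expRN.
  rewrite ler_pdivrMr ?expR_gt0// [leRHS]mulrC ler_pdivlMr//.
  apply: (@le_trans _ _ (lambda * n.+2%:R)); first by rewrite ler_wpM2l ?(ltW lambda0)// ler_nat.
  by rewrite (le_trans _ (expR_ge1Dx _))// lerDr.
have [n [[tn dn] gn]] := filter_ex (filterI (filterI tail decay) (near_initial_defect eta0)).
have l2 : 0 < eta / 2 / lambda by rewrite divr_gt0.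
have [s0 s00 H] := five_point_laplace n cK KD l2.
exists (fun x => 1 - lambda * laplace (time_window n) x), (initial_defect n).
have mI := measurable_window n.
split => //.
- by apply: continuous_affine_laplace => //; exact: windowJ.
- move=> x _; rewrite /exit_transform.
  have -> : forall a b : R, 1 - a - (1 - b) = b - a by move=> *; ring.
  rewrite -mulrBr normrM gtr0_norm//; apply: le_trans tn.
  by rewrite ler_wpM2l ?(ltW lambda0)//; exact: laplace_tail.
- by split; [exact: measurable_initial_defect|exact: initial_defect_ge0].
exists s0 => // s x sp ss0 Kx.
have Dx := KD _ Kx.
have := H s x sp ss0 Kx.
have -> : five_point s (fun x => 1 - lambda * laplace (time_window n) x) x
   = - lambda * five_point s (laplace (time_window n)) x.
  rewrite -five_pointZ /five_point; congr (_ / _); ring.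
set V5 := five_point _ _ _; set V := laplace _ _.
rewrite /initial_defect indicE mem_set// (extend0E _ _ Dx).
have := uM x n.+2%:R (ltr0Sn _ _); rewrite (extend0E _ _ Dx).
set Eb := expR (- lambda * n.+2%:R) in dn *; set Ea := expR (- lambda / _).
set ub := u x n.+2%:R; set ua := u x _ => ubM h.
(* The residual splits into the stencil error, the term at the late end of the window, and the term
   at its early end. The last one is [initial_defect] up to sign, because x lies in [D]. *)
have -> : - lambda * V5 - lambda * (1 - lambda * V)
  = - (lambda * (V5 - lambda * V - (Eb * ub - Ea * ua))) - (lambda * (Eb * ub))
    - lambda * (1%:R - Ea * ua) by ring.
rewrite (le_trans (ler_normB _ _))// [X in _ <= _ + X](_ : _ = `|lambda * (1%:R - Ea * ua)|); last first.
  by rewrite normrM (gtr0_norm lambda0).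
rewrite lerD2r (le_trans (ler_normB _ _))// normrN [leRHS]splitr lerD//.
  by rewrite normrM gtr0_norm// mulrC -ler_pdivlMr.
rewrite normrM gtr0_norm//; apply: le_trans dn; rewrite ler_wpM2l ?(ltW lambda0)//.
by rewrite normrM ger0_norm ?expR_ge0// ler_wpM2l ?expR_ge0.
Qed.

End LaplaceTransform.

(* The library's canonical sigma-finite structure on products is only found for
   subprobabilities, so the planar Lebesgue measure needs its own. *)
Section PlaneSigmaFinite.
Context {R : realType}.

Definition plane_measure : set (plane R) -> \bar R := leb2 R.

HB.instance Definition _ := Measure.copy plane_measure (leb2 R).

Lemma plane_sigma_finite : sigma_finite setT plane_measure.
Proof.
exists (fun n => `[- n%:R, n%:R] `*` `[- n%:R, n%:R]).
  apply/seteqP; split => // -[x y] _.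
  pose r : R := `|x : R| + `|y : R|; exists (Num.truncn r).+1 => //=.
  have h := ltW (truncnS_gt r); rewrite !in_itv /= -!ler_norml.
  by split; apply: le_trans h; [rewrite lerDl|rewrite lerDr].
move=> n; split; first by apply: measurableX; exact: measurable_itv.
rewrite [X in (X < _)%E]product_measure1E//= lebesgue_measure_itv /= lte_fin.
by case: ifP => _; rewrite -?EFinD -?EFinM ?mule0 ltry.
Qed.

HB.instance Definition _ :=
  Measure_isSigmaFinite.Build _ (plane R) R plane_measure plane_sigma_finite.

Lemma integrable_bounded (D : set (R * R)) (g : R * R -> R) (M : R) :
  open D -> (leb2 R D < +oo)%E ->
  measurable_fun (D : set (plane R)) g -> (forall x, D x -> `|g x| <= M) ->
  (leb2 R).-integrable D (EFin \o g).
Proof.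
move=> oD Dfin mg gM; apply: measurable_bounded_integrable => //; first exact: open_measurable_plane.
exists M; split; first exact: num_real.
by move=> N MN x Dx /=; rewrite (le_trans (gM x Dx))// ltW.
Qed.

End PlaneSigmaFinite.

(** * The heat content determines the integral of the exit transform, up to the area *)

Section HeatContentTransform.
Context {R : realType} (D : set (R * R)) (u : R * R -> R -> R) (k : R).
Hypotheses (oD : open D) (D_fin : (leb2 R D < +oo)%E) (hu : heat_solution D u) (k0 : 0 < k).
Local Notation leb := (@lebesgue_measure R).
Local Notation lambda := (k ^+ 2).
Local Notation ubar := (extend0 D u).
Local Notation J := (`]0, +oo[%classic : set (measurableTypeR R)).
Local Notation spacetime := (plane R * measurableTypeR R)%type.

Let lambda0 : 0 < lambda. Proof. by rewrite exprn_gt0. Qed.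

Local Notation m2 := (@plane_measure R).

Let f (z : spacetime) : \bar R :=
  ((fun z : spacetime => expR (- lambda * z.2) * u z.1 z.2) \_ (D `*` J) z)%:E.

Let fE x t : f (x, t) = (((fun t => expR (- lambda * t) * ubar x t) \_ J) t)%:E.
Proof.
rewrite /f !patchE in_setX /=; case: (boolP (x \in D)) => /=.
  by rewrite inE => Dx; rewrite extend0E.
by rewrite notin_setE => nDx; rewrite extend0_out// mulr0 if_same.
Qed.

Let measurable_f : measurable_fun setT f.
Proof.
apply/measurable_EFinP.
have mDJ : measurable (D `*` J : set spacetime).
  by apply: measurableX; [exact: open_measurable_plane|exact: measurable_itv].
apply: (iffLR (measurable_restrictT _ mDJ)).
apply: measurable_funM; last exact: measurable_heat.
apply: measurable_funTS; apply: measurableT_comp; first exact: measurable_expR.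
by apply: measurable_funM => //; exact: measurable_snd.
Qed.

Let inner1 x : (\int[leb]_t f (x, t) = (laplace D u k J x)%:E)%E.
Proof.
under eq_integral do rewrite fE.
rewrite /laplace /Rintegral fineK; last first.
  by apply: integrable_fin_num => //; exact: integrable_laplace.
rewrite [RHS]integral_mkcond; apply: eq_integral => t _.
by rewrite !patchE; case: ifP.
Qed.

Let integrable_f : (m2 \x leb)%E.-integrable setT f.
Proof.
apply/(@integrable12ltyP _ _ (plane R) (measurableTypeR R) R m2 leb f measurable_f).
have [M M0 uM] := extend0_bounded hu.
have mD : measurable (D : set (plane R)) by exact: open_measurable_plane.
have mJ : measurable J by exact: measurable_itv.
have iW := integrable_expR lambda0.
pose W : \bar R := (\int[leb]_(t in J) (expR (- lambda * t))%:E)%E.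
have Wfin : W \is a fin_num by exact: integrable_fin_num.
have W0 : (0 <= W)%E by apply: integral_ge0 => t _; rewrite lee_fin expR_ge0.
have inner_le x : (\int[leb]_t `|f (x, t)| <= (M * \1_D x)%:E * W)%E.
  under eq_integral do rewrite fE.
  rewrite [leLHS](_ : _ = \int[leb]_(t in J) `|(expR (- lambda * t) * ubar x t)%:E|)%E; last first.
    rewrite [RHS]integral_mkcond; apply: eq_integral => t _.
    by rewrite !patchE; case: ifP => //; rewrite abse0.
  have c0 : 0 <= M * \1_D x by rewrite mulr_ge0.
  rewrite /W -ge0_integralZl_EFin//; last exact: measurable_int iW.
  apply: ge0_le_integral => //.
  - apply: measurableT_comp => //.
    exact: measurable_int (integrable_laplace hu k0 x mJ (@subset_refl _ J)).
  - by apply: emeasurable_funM => //; exact: measurable_int iW.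
  - move=> t; rewrite /= in_itv /= andbT => t0; rewrite -EFinM lee_fin.
    rewrite normrM ger0_norm ?expR_ge0// mulrC ler_wpM2r ?expR_ge0//.
    have [Dx|nDx] := pselect (D x); first by rewrite indicE mem_set// mulr1 uM.
    by rewrite extend0_out// normr0.
apply: (@le_lt_trans _ _ (\int[leb2 R]_x ((M * \1_D x)%:E * W))%E).
  apply: ge0_le_integral => //.
  - by move=> x _; apply: integral_ge0 => t _.
  - apply: (measurable_fun_fubini_tonelli_F (m2 := leb) (fun z => `|f z|)%E) => //.
    exact: measurableT_comp.
  - apply: emeasurable_funM => //; apply/measurable_EFinP; apply: measurable_funM => //.
rewrite ge0_integralZr//; [|by apply/measurable_EFinP; exact: measurable_funM|by move=> x _; rewrite lee_fin mulr_ge0].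
under eq_integral do rewrite EFinM.
rewrite ge0_integralZl_EFin//; last by apply/measurable_EFinP; exact: measurable_indic.
rewrite integral_indic// setIT.
by rewrite ltey_eq !fin_numM// ge0_fin_numE.
Qed.

(** Fubini on [D] times the half-line, legitimate because u is bounded, [D] has finite measure and
    the weight is integrable. The integrand is extended by 0 so that the theorem applies on the full
    spaces. *)
Lemma exit_transform_integral (H : R -> R) :
  (forall t, 0 < t -> H t = \int[leb2 R]_(x in D) u x t) ->
  \int[leb2 R]_(x in D) exit_transform D u k x
  = fine (leb2 R D) - lambda * \int[leb]_(t in J) (expR (- lambda * t) * H t).
Proof.
move=> HE.
have mD : measurable (D : set (plane R)) by exact: open_measurable_plane.
have mJ : measurable J by exact: measurable_itv.
have [M M0 uM] := extend0_bounded hu.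
have iL : (leb2 R).-integrable setT (fun x => (laplace D u k J x)%:E).
  have := @integrable_fubini_F _ _ (plane R) (measurableTypeR R) R m2 leb f integrable_f.
  by apply: eq_integrable => // x _; exact: inner1.
have lapT : (\int[leb2 R]_x (laplace D u k J x)%:E
    = \int[leb]_(t in J) (expR (- lambda * t) * H t)%:E)%E.
  transitivity (\int[leb]_t \int[m2]_x f (x, t))%E.
    have := @Fubini _ _ (plane R) (measurableTypeR R) R m2 leb f integrable_f.
    move=> <-; apply: eq_integral => x _; exact/esym/inner1.
  rewrite [RHS]integral_mkcond; apply: eq_integral => t _.
  rewrite patchE; case: ifPn => [|tJ]; last first.
    by apply: integral0_eq => x _; rewrite fE patchE (negbTE tJ).
  rewrite inE => tJ; have t0 : 0 < t by move: tJ; rewrite /= in_itv /= andbT.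
  have iu : (leb2 R).-integrable D (EFin \o (u ^~ t)).
    have iub : (leb2 R).-integrable D (EFin \o (ubar ^~ t)).
      apply: (integrable_bounded (M := M)) => //.
        by apply: measurable_funTS; apply: continuousT_measurable_plane; exact: continuous_extend0.
      by move=> x _; exact: uM.
    by move: iub; apply: eq_integrable => // x; rewrite inE /= => Dx; rewrite extend0E.
  rewrite HE// EFinM [X in (_ * X)%E](_ : _ = \int[leb2 R]_(x in D) (u x t)%:E)%E; last first.
    by rewrite /Rintegral fineK ?integrable_fin_num.
  rewrite -integralZl//.
  rewrite [RHS]integral_mkcond; apply: eq_integral => x _.
  rewrite fE patchE mem_set// [RHS]patchE; case: ifPn.
    by rewrite inE => Dx; rewrite extend0E.
  by rewrite notin_setE => nDx; rewrite extend0_out// mulr0.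
have iLD := integrableS measurableT mD (@subsetT _ _) iL.
rewrite /exit_transform RintegralB//; last 2 first.
- by apply: (integrable_bounded (M := 1)) => // x _; rewrite normr1.
- by have := integrableZl mD lambda iLD; apply: eq_integrable => // x _ /=; rewrite EFinM.
rewrite Rintegral_cst// mul1r; congr (_ - _).
rewrite RintegralZl//.
congr (_ * _); rewrite /Rintegral -lapT; congr fine.
rewrite integral_mkcond; apply: eq_integral => x _; rewrite patchE.
case: ifPn => //; rewrite notin_setE => nDx.
rewrite /laplace; under eq_Rintegral do rewrite extend0_out// mulr0.
by rewrite /Rintegral integral0.
Qed.

End HeatContentTransform.

(** * Triangles and barycentric coordinates *)

Section Barycentric.
Context {R : realType}.
Implicit Types (x p q : R * R).

Definition o0 : 'I_3 := @Ordinal 3 0 isT.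
Definition o1 : 'I_3 := @Ordinal 3 1 isT.
Definition o2 : 'I_3 := @Ordinal 3 2 isT.

Lemma ord3P (P : 'I_3 -> Prop) : P o0 -> P o1 -> P o2 -> forall i, P i.
Proof.
move=> P0 P1 P2 [[|[|[|//]]] Hi]; [move: P0|move: P1|move: P2]; congr P; exact: val_inj.
Qed.

Lemma sum_ord3 (F : 'I_3 -> R) : \sum_i F i = F o0 + F o1 + F o2.
Proof.
rewrite !big_ord_recl big_ord0 addr0 addrA; congr (F _ + F _ + F _); exact: val_inj.
Qed.

Definition distinct3 (m a b : 'I_3) := [&& m != a, m != b & a != b].

Lemma others (m : 'I_3) : exists a b, distinct3 m a b.
Proof.
by elim/ord3P: m; [exists o1, o2|exists o0, o2|exists o0, o1].
Qed.

Lemma third (a b : 'I_3) : a != b -> exists m, distinct3 m a b.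
Proof.
by elim/ord3P: a; elim/ord3P: b => // _; (try by exists o0); (try by exists o1); exists o2.
Qed.

Lemma distinct3_cases (m a b i : 'I_3) : distinct3 m a b -> [\/ i = m, i = a | i = b].
Proof.
by elim/ord3P: m; elim/ord3P: a; elim/ord3P: b => //; elim/ord3P: i => _;
  (try by apply: Or31); (try by apply: Or32); apply: Or33.
Qed.

Lemma sum_distinct3 (F : 'I_3 -> R) m a b : distinct3 m a b -> \sum_i F i = F m + F a + F b.
Proof.
by rewrite sum_ord3; elim/ord3P: m; elim/ord3P: a; elim/ord3P: b => // _; ring.
Qed.

Definition cross p q : R := p.1 * q.2 - p.2 * q.1.

Definition triangle_det (v : 'I_3 -> R * R) : R := cross (v o1 - v o0) (v o2 - v o0).

Definition bary (v : 'I_3 -> R * R) (i : 'I_3) x : R :=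
  match val i with
  | 0%N => cross (v o1 - x) (v o2 - x)
  | 1%N => cross (v o2 - x) (v o0 - x)
  | _ => cross (v o0 - x) (v o1 - x)
  end / triangle_det v.

(** The gradient of [bary v i] is the side opposite to [v i], turned by a right angle and divided by
    the determinant. Gradient norms are therefore proportional to side lengths. *)
Definition bary_grad (v : 'I_3 -> R * R) (i : 'I_3) : R * R :=
  match val i with
  | 0%N => (((v o1).2 - (v o2).2) / triangle_det v, ((v o2).1 - (v o1).1) / triangle_det v)
  | 1%N => (((v o2).2 - (v o0).2) / triangle_det v, ((v o0).1 - (v o2).1) / triangle_det v)
  | _ => (((v o0).2 - (v o1).2) / triangle_det v, ((v o1).1 - (v o0).1) / triangle_det v)
  end.

Variable v : 'I_3 -> R * R.
Hypothesis det0 : triangle_det v != 0.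
Local Notation l := (bary v).
Local Notation g := (bary_grad v).

Lemma bary_affine i x :
  l i x = l i (0, 0) + (g i).1 * x.1 + (g i).2 * x.2.
Proof. by elim/ord3P: i; rewrite /bary /bary_grad /cross /=; field. Qed.

Lemma sum_bary x : \sum_i l i x = 1.
Proof.
rewrite sum_ord3 /bary /= -!mulrDl -[RHS](mulfV det0); congr (_ / _).
by rewrite /triangle_det /cross /=; ring.
Qed.

Lemma bary_vertex i j : l i (v j) = (i == j)%:R.
Proof.
elim/ord3P: i; elim/ord3P: j; rewrite /bary /=; try (by rewrite /cross; field);
rewrite -[RHS](mulfV det0); congr (_ / _); by rewrite /triangle_det /cross /=; ring.
Qed.

Lemma bary_combination x : x = (\sum_i l i x * (v i).1, \sum_i l i x * (v i).2).
Proof.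
have E (p q r d y A B C : R) : d != 0 -> d * y = p * A + q * B + r * C ->
    y = p / d * A + q / d * B + r / d * C.
  by move=> d0 e; apply: (mulfI d0); rewrite e; field.
by apply: injective_projections; rewrite /= sum_ord3 /bary /=; apply: E => //;
  rewrite /triangle_det /cross /=; ring.
Qed.

Lemma bary_of_combination i (r : 'I_3 -> R) : \sum_j r j = 1 ->
  l i (\sum_j r j * (v j).1, \sum_j r j * (v j).2) = \sum_j r j * l i (v j).
Proof.
move=> r1; rewrite bary_affine /=.
have E j : r j * l i (v j) = r j * l i (0, 0) + ((g i).1 * (r j * (v j).1) + (g i).2 * (r j * (v j).2)).
  by rewrite [in LHS]bary_affine; ring.
rewrite [RHS](eq_bigr _ (fun j _ => E j)).
by rewrite !big_split /= -!mulr_sumr -mulr_suml r1 mul1r addrA.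
Qed.

Lemma continuous_bary i : continuous (l i).
Proof.
have -> : l i = fun x => l i (0, 0) + (g i).1 * x.1 + (g i).2 * x.2.
  by apply/funext => x; exact: bary_affine.
move=> x; apply: cvgD; [apply: cvgD; [exact: cvg_cst|]|];
  (apply: cvgM; [exact: cvg_cst|]); [exact: cvg_fst|exact: cvg_snd].
Qed.

Lemma bary_midpoint i j x : l i (midpoint (v j) x) = (l i x + (i == j)%:R) / 2.
Proof.
rewrite -bary_vertex /midpoint bary_affine /= [l i x]bary_affine [l i (v j)]bary_affine.
by field.
Qed.

Lemma sum_grad1 : \sum_i (g i).1 = 0.
Proof. by rewrite sum_ord3 /bary_grad /=; field. Qed.

Lemma sum_grad2 : \sum_i (g i).2 = 0.
Proof. by rewrite sum_ord3 /bary_grad /=; field. Qed.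

Lemma cross_grad i j : i != j -> `|cross (g i) (g j)| = `|triangle_det v|^-1.
Proof.
have F (a b c e d : R) : d != 0 -> a * b - c * e = d -> a / d * (b / d) - c / d * (e / d) = d^-1.
  move=> d0 h; rewrite [LHS](_ : _ = (a * b - c * e) / d / d); last by field.
  by rewrite h mulfV// mul1r.
have E : cross (g o0) (g o1) = (triangle_det v)^-1 /\ cross (g o1) (g o2) = (triangle_det v)^-1
   /\ cross (g o2) (g o0) = (triangle_det v)^-1.
  by split; [|split]; rewrite {1}/cross /bary_grad /=; apply: F => //;
    rewrite /triangle_det /cross /=; ring.
have [E0 [E1 E2]] := E.
have N (p q : R * R) : `|cross p q| = `|cross q p| by rewrite /cross -normrN; congr `|_|; ring.
by elim/ord3P: i; elim/ord3P: j => // _; first [rewrite E0|rewrite E1|rewrite E2|rewrite N E0|rewrite N E1|rewrite N E2]; rewrite normfV.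
Qed.

Definition open_triangle : set (R * R) := [set x | forall i, 0 < l i x].
Definition hull : set (R * R) := [set x | forall i, 0 <= l i x].

Lemma open_open_triangle : open open_triangle.
Proof.
have -> : open_triangle = [set x | 0 < l o0 x] `&` ([set x | 0 < l o1 x] `&` [set x | 0 < l o2 x]).
  apply/seteqP; split => x; first by move=> h; split; [|split]; exact: h.
  by move=> [h0 [h1 h2]]; elim/ord3P.
have opi i : open [set x | 0 < l i x].
  rewrite (_ : [set x | 0 < l i x] = l i @^-1` [set z | 0 < z])//.
  by apply: open_comp; [move=> x _; exact: continuous_bary|exact: open_gt].
by apply: openI => //; exact: openI.
Qed.

Lemma closed_hull : closed hull.
Proof.
have -> : hull = [set x | 0 <= l o0 x] `&` ([set x | 0 <= l o1 x] `&` [set x | 0 <= l o2 x]).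
  apply/seteqP; split => x; first by move=> h; split; [|split]; exact: h.
  by move=> [h0 [h1 h2]]; elim/ord3P.
have opi i : closed [set x | 0 <= l i x].
  rewrite (_ : [set x | 0 <= l i x] = l i @^-1` [set z | 0 <= z])//.
  by apply: preimage_closed; [move=> x _; exact: continuous_bary|exact: closed_ge].
by apply: closedI => //; exact: closedI.
Qed.

Lemma hull_le1 i x : hull x -> l i x <= 1.
Proof.
move=> hx; rewrite -(sum_bary x) (bigD1 i)//= lerDl; apply: sumr_ge0 => j _; exact: hx.
Qed.

Lemma open_triangle_hull : open_triangle `<=` hull.
Proof. by move=> x h i; exact: ltW. Qed.

Lemma compact_hull : compact hull.
Proof.
pose M := \sum_i (`|(v i).1| + `|(v i).2|).
have bnd x : hull x -> `|x.1| <= M /\ `|x.2| <= M.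
  move=> hx; rewrite [x]bary_combination /=; split; rewrite (le_trans (ler_norm_sum _ _ _))//;
  apply: ler_sum => i _; rewrite normrM ger0_norm; try exact: hx.
    by rewrite (le_trans (ler_piMl _ (hull_le1 i hx)))// lerDl.
  by rewrite (le_trans (ler_piMl _ (hull_le1 i hx)))// lerDr.
apply: (@subclosed_compact _ hull (`[- M, M] `*` `[- M, M])); first exact: closed_hull.
  by apply: compact_setX; exact: segment_compact.
by move=> [x1 x2] /bnd[/= h1 h2]; split; rewrite /= in_itv /= -ler_norml.
Qed.

Lemma open_triangle_midpoint j x : open_triangle x -> open_triangle (midpoint (v j) x).
Proof.
by move=> hx i; rewrite bary_midpoint divr_gt0// ltr_wpDr.
Qed.

Lemma hull_boundary x : hull x -> ~ open_triangle x -> exists m, l m x = 0.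
Proof.
move=> hx nx; apply: contrapT => nm; apply: nx => i; rewrite lt_neqAle hx andbT eq_sym.
by apply/negP => /eqP e; apply: nm; exists i.
Qed.

End Barycentric.

(** * Integrals of functions of one barycentric coordinate *)

Section BarycentricIntegrals.
Context {R : realType} (v : 'I_3 -> R * R).
Hypothesis det0 : triangle_det v != 0.
Local Notation l := (bary v).
Local Notation g := (bary_grad v).
Local Notation D := (open_triangle v).
Local Notation leb := (@lebesgue_measure R).
Local Open Scope ereal_scope.

Let simplex : set (R * R) := [set z | (0 < z.1)%R /\ (0 < z.2)%R /\ (z.1 + z.2 < 1)%R].

Let measurable_simplex : measurable (simplex : set (plane R)).
Proof.
apply: open_measurable_plane.
have -> : simplex = [set z | (0 < z.1)%R] `&` ([set z | (0 < z.2)%R] `&` [set z | (z.1 + z.2 < 1)%R]).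
  by apply/seteqP; split => z; [move=> [? [? ?]]; split|move=> [? [? ?]]].
have c1 : continuous (fun z : R * R => z.1) by move=> z; exact: cvg_fst.
have c2 : continuous (fun z : R * R => z.2) by move=> z; exact: cvg_snd.
apply: openI; [|apply: openI].
- rewrite (_ : [set z | _] = (fun z : R * R => z.1) @^-1` [set t | 0 < t]%R)//.
  by apply: open_comp; [move=> z _; exact: c1|exact: open_gt].
- rewrite (_ : [set z | _] = (fun z : R * R => z.2) @^-1` [set t | 0 < t]%R)//.
  by apply: open_comp; [move=> z _; exact: c2|exact: open_gt].
- rewrite (_ : [set z | _] = (fun z : R * R => z.1 + z.2)%R @^-1` [set t | t < 1]%R)//.
  by apply: open_comp; [move=> z _; apply: cvgD; [exact: c1|exact: c2]|exact: open_lt].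
Qed.

Lemma open_triangle_simplex i j x : i != j -> D x <-> simplex (l i x, l j x).
Proof.
move=> ij; have [m mij] := third ij; have := sum_bary det0 x.
rewrite (sum_distinct3 _ mij) => E; split.
  by move=> Dx; split; [exact: Dx|split; [exact: Dx|rewrite /=; have := Dx m; lra]].
by move=> [/= h1 [h2 h3]] n; case: (distinct3_cases n mij) => ->//; lra.
Qed.

(** Two barycentric coordinates map the triangle affinely onto the unit simplex, whose slice at
    first coordinate s has length 1 - s. *)
Lemma integral_bary i (F : R -> R) : continuous F -> (forall s, 0 <= F s)%R ->
  \int[leb2 R]_(x in D) (F (l i x))%:E
  = `|triangle_det v|%:E * \int[leb]_(s in `]0%R, 1%R[) (F s * (1 - s))%:E.
Proof.
move=> cF F0.
have [j ij] : exists j, i != j by have [a [b /and3P[]]] := others i; exists a.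
pose H (z : plane R) : \bar R := (F z.1 * \1_simplex z)%:E.
have mH : measurable_fun setT H.
  apply/measurable_EFinP; apply: measurable_funM; last exact: measurable_indic.
  by apply: measurableT_comp; [exact: continuous_measurable_fun|exact: measurable_fst].
have H0 z : 0 <= H z by rewrite lee_fin mulr_ge0.
transitivity (\int[leb2 R]_x H ((g i).1 * x.1 + (g i).2 * x.2 + l i (0, 0), (g j).1 * x.1 + (g j).2 * x.2 + l j (0, 0))%R).
  rewrite integral_mkcond; apply: eq_integral => x _; rewrite patchE /H.
  have E k : ((g k).1 * x.1 + (g k).2 * x.2 + l k (0, 0))%R = l k x by rewrite (bary_affine det0 k x); ring.
  rewrite !E /=; case: ifPn.
    by rewrite inE => /(open_triangle_simplex _ ij) h; rewrite indicE mem_set ?mulr1.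
  rewrite notin_setE => h; rewrite indicE memNset ?mulr0// => /(open_triangle_simplex _ ij).
  exact: h.
have crossE : ((g i).1 * (g j).2 - (g i).2 * (g j).1)%R = cross (g i) (g j) by [].
rewrite ge0_integral_affine2//; last first.
  by rewrite crossE -normr_eq0 cross_grad// invr_eq0 normr_eq0.
rewrite crossE cross_grad// invrK; congr (_ * _).
rewrite (fubini_tonelli1 H mH H0) [RHS]integral_mkcond; apply: eq_integral => s _.
rewrite /fubini_F patchE.
case: ifPn => [|sI]; last first.
  apply: integral0_eq => t _; rewrite /H indicE memNset ?mulr0//= => -[/= s0 [t0 st]].
  by case/negP: sI; rewrite inE /= in_itv /= s0 /=; lra.
rewrite inE /= in_itv /= => /andP[s0 s1].
transitivity (\int[leb]_t ((F s)%:E * (\1_(`]0%R, (1 - s)%R[ : set (measurableTypeR R)) t)%:E)).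
  apply: eq_integral => t _; rewrite /H -EFinM; congr ((_ * _)%:E).
  rewrite !indicE; congr (_%:R); congr nat_of_bool; apply/idP/idP; rewrite !inE /= in_itv /=.
    by move=> [_ [/= -> st]] /=; rewrite ltrBrDl.
  by rewrite ltrBrDl => /andP[].
rewrite ge0_integralZl_EFin//; last first.
  by apply/measurable_EFinP; apply: measurable_indic; exact: measurable_itv.
rewrite integral_indic//.
rewrite setIT [X in _ * X](lebesgue_measure_itv `]0%R, (1 - s)%R[) /= lte_fin subr_gt0 s1.
by rewrite oppr0 adde0.
Qed.

Lemma measure_open_triangle : leb2 R D = (`|triangle_det v| / 2)%:E.
Proof.
have mD : measurable (D : set (plane R)) by exact: open_measurable_plane (open_open_triangle det0).
have := @integral_bary o0 (fun=> 1%R) (@cst_continuous _ _ _) (fun=> ler01).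
rewrite integral_cst// mul1e => ->; rewrite EFinM; congr (_ * _).
under eq_integral do rewrite mul1r.
rewrite -(@integral_itv_bndoo _ _ _ _ true false); last first.
  by apply/measurable_EFinP; apply: measurable_funB.
have d (s : R) : is_derive s (1%R : R) (fun s : R => s - s ^+ 2 / 2)%R (1 - s)%R.
  by apply: is_derive_eq; rewrite /GRing.scale /=; field.
have cF : continuous (fun s : R => s - s ^+ 2 / 2)%R.
  by move=> s; apply/differentiable_continuous/derivable1_diffP; have [] := d s.
rewrite (@continuous_FTC2 R (fun s => 1 - s)%R (fun s => s - s ^+ 2 / 2)%R)//.
- by rewrite -EFinD; congr (_%:E); field.
- by apply: continuous_subspaceT => s; apply: cvgB; [exact: cvg_cst|exact: cvg_id].
- split; first by move=> s _; have [] := d s.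
  + by apply: cvg_at_right_filter; exact: cF.
  + by apply: cvg_at_left_filter; exact: cF.
- by move=> s _; rewrite derive1E; have [_ ->] := d s.
Qed.

Lemma integral_exp_bary i (c : R) : (0 < c)%R ->
  \int[leb2 R]_(x in D) (expR (- (c * l i x)))%:E
  = (`|triangle_det v| * (c^-1 - c^-1 ^+ 2 + c^-1 ^+ 2 * expR (- c)))%:E.
Proof.
move=> c0; have cN0 : c != 0%R by rewrite gt_eqF.
have cE : continuous (fun s : R => expR (- (c * s))).
  move=> s; apply: (continuous_cvg _ (@continuous_expR R _)).
  by apply: cvgN; apply: cvgM; [exact: cvg_cst|exact: cvg_id].
rewrite (@integral_bary i (fun s => expR (- (c * s))))//.
rewrite EFinM; congr (_ * _).
have cf : continuous (fun s : R => expR (- (c * s)) * (1 - s))%R.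
  move=> s; apply: cvgM; first exact: cE.
  by apply: cvgB; [exact: cvg_cst|exact: cvg_id].
rewrite -(@integral_itv_bndoo _ _ _ _ true false); last first.
  by apply/measurable_EFinP; apply: measurable_funTS; exact: continuous_measurable_fun.
pose Phi (s : R) : R := (expR (- (c * s)) * (c^-1 ^+ 2 - c^-1 + c^-1 * s))%R.
have d (s : R) : is_derive s (1%R : R) Phi (expR (- (c * s)) * (1 - s))%R.
  by rewrite /Phi; apply: is_derive_eq; rewrite /GRing.scale /=; field.
have cF : continuous Phi.
  by move=> s; apply/differentiable_continuous/derivable1_diffP; have [] := d s.
rewrite (@continuous_FTC2 R (fun s => expR (- (c * s)) * (1 - s))%R Phi)//.
- by rewrite -EFinD /Phi; congr (_%:E); rewrite mulr0 oppr0 expR0 !mulr1; ring.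
- exact: continuous_subspaceT.
- split; first by move=> s _; have [] := d s.
  + by apply: cvg_at_right_filter; exact: cF.
  + by apply: cvg_at_left_filter; exact: cF.
- by move=> s _; rewrite derive1E; have [_ ->] := d s.
Qed.

(** The homothety of ratio 1/2 at [v i] maps the triangle onto its part where [l i] exceeds 1/2 and
    divides areas by 4. *)
Lemma integral_midpoint i (f : R * R -> R) : continuous f -> (forall x, D x -> (0 <= f x)%R) ->
  \int[leb2 R]_(x in D) (f (midpoint (v i) x))%:E
  = 4%:E * \int[leb2 R]_(x in D) (f x * \1_[set x | (2^-1 < l i x)%R] x)%:E.
Proof.
move=> cf f0.
have mD : measurable (D : set (plane R)) by exact: open_measurable_plane (open_open_triangle det0).
have mh : measurable ([set x | (2^-1 < l i x)%R] : set (plane R)).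
  apply: open_measurable_plane.
  rewrite (_ : [set x | _] = l i @^-1` [set z | 2^-1 < z]%R)//.
  by apply: open_comp; [move=> x _; exact: continuous_bary|exact: open_gt].
pose G (z : plane R) : \bar R := ((fun x => f x * \1_[set x | (2^-1 < l i x)%R] x)%R \_ D z)%:E.
have mG : measurable_fun setT G.
  apply/measurable_EFinP; apply: (iffLR (measurable_restrictT _ mD)).
  apply: measurable_funM; last exact: measurable_indic.
  by apply: measurable_funTS; exact: continuousT_measurable_plane.
have G0 z : 0 <= G z.
  rewrite lee_fin /G patchE; case: ifPn => //; rewrite inE => Dz; rewrite mulr_ge0//; exact: f0.
have -> : \int[leb2 R]_(x in D) (f x * \1_[set x | (2^-1 < l i x)%R] x)%:E = \int[leb2 R]_x G x.
  by rewrite integral_mkcond; apply: eq_integral => x _; rewrite /G !patchE; case: ifP.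
have a20 : (2^-1 * 2^-1 - 0 * 0 != 0 :> R)%R by rewrite mulr0 subr0 mulf_neq0// invr_neq0.
have := @ge0_integral_affine2 R G 2^-1 0 ((v i).1 / 2)%R 0 2^-1 ((v i).2 / 2)%R a20 mG G0.
have -> : (`|2^-1 * 2^-1 - 0 * 0|^-1 = 4 :> R)%R.
  by rewrite mulr0 subr0 ger0_norm ?mulr_ge0 ?invr_ge0//; field.
move=> <-; rewrite integral_mkcond; apply: eq_integral => x _.
have -> : (2^-1 * x.1 + 0 * x.2 + (v i).1 / 2, 0 * x.1 + 2^-1 * x.2 + (v i).2 / 2)%R = midpoint (v i) x.
  by rewrite /midpoint; congr (_, _); field.
rewrite /G !patchE.
have half : (2^-1 < l i (midpoint (v i) x))%R = (0 < l i x)%R.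
  by rewrite bary_midpoint// eqxx ltr_pdivlMr// mulVf// ltrDr.
case: ifPn.
  rewrite inE => Dx; rewrite mem_set; last exact: open_triangle_midpoint.
  by rewrite indicE mem_set ?mulr1//= half; exact: Dx.
rewrite notin_setE => nDx; case: ifPn => //; rewrite inE => Dm.
rewrite indicE memNset ?mulr0//= half => li0; apply: nDx => k.
have [->//|ki] := eqVneq k i.
by have := Dm k; rewrite bary_midpoint// (negbTE ki) addr0 pmulr_lgt0// invr_gt0.
Qed.

End BarycentricIntegrals.

(** * Corner defects *)

Section TriangleEstimates.
Context {R : realType} (v : 'I_3 -> R * R).
Hypothesis det0 : triangle_det v != 0.
Local Notation l := (bary v).
Local Notation g := (bary_grad v).
Local Notation D := (open_triangle v).
Local Notation T := (hull v).

Definition grad_norm (i : 'I_3) : R := Num.sqrt ((g i).1 ^+ 2 + (g i).2 ^+ 2).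

(** [bary v i] grows from 0 on the opposite side to 1 at [v i], so the inverse of its slope is the
    altitude. *)
Definition height (i : 'I_3) : R := (grad_norm i)^-1.

Lemma sqr_grad_norm i : grad_norm i ^+ 2 = (g i).1 ^+ 2 + (g i).2 ^+ 2.
Proof. by rewrite /grad_norm sqr_sqrtr// addr_ge0// sqr_ge0. Qed.

Lemma grad_norm_gt0 i : 0 < grad_norm i.
Proof.
rewrite lt_neqAle sqrtr_ge0 andbT eq_sym; apply/negP => /eqP e.
have [j [m /and3P[ij _ _]]] := others i.
have := sqr_grad_norm i; rewrite e expr0n /= => /esym/eqP.
rewrite paddr_eq0 ?sqr_ge0// !sqrf_eq0 => /andP[/eqP g1 /eqP g2].
have := cross_grad det0 ij; rewrite /cross g1 g2 !mul0r subrr normr0 => /esym/eqP.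
by rewrite invr_eq0 normr_eq0 (negbTE det0).
Qed.

Lemma height_gt0 i : 0 < height i.
Proof. by rewrite invr_gt0 grad_norm_gt0. Qed.

Lemma grad_opp m a b : distinct3 m a b ->
  (g m).1 = - ((g a).1 + (g b).1) /\ (g m).2 = - ((g a).2 + (g b).2).
Proof.
move=> mab; have := sum_grad1 det0; have := sum_grad2 det0.
by rewrite !(sum_distinct3 _ mab) => h2 h1; split; lra.
Qed.

Lemma exp_bary_affine k (c : 'I_3 -> R) x :
  - (k * \sum_i c i * l i x) = (- (k * \sum_i c i * (g i).1)) * x.1
    + (- (k * \sum_i c i * (g i).2)) * x.2 - k * \sum_i c i * l i (0, 0).
Proof. by rewrite !sum_ord3 !(bary_affine det0 _ x); ring. Qed.

Lemma continuous_exp_bary k (c : 'I_3 -> R) : continuous (fun x => expR (- (k * \sum_i c i * l i x))).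
Proof.
move=> x; apply: (continuous_cvg _ (@continuous_expR R _)).
apply: cvgN; apply: cvgM; first exact: cvg_cst.
rewrite (_ : (fun y => _) = (fun y => c o0 * l o0 y + c o1 * l o1 y + c o2 * l o2 y)); last first.
  by apply/funext => y; rewrite sum_ord3.
rewrite sum_ord3.
by apply: cvgD; [apply: cvgD|]; (apply: cvgM; [exact: cvg_cst|exact: continuous_bary]).
Qed.

Lemma approx_solution_exp_bary k (c : 'I_3 -> R) E :
  (\sum_i c i * (g i).1) ^+ 2 + (\sum_i c i * (g i).2) ^+ 2 = 1 ->
  approx_solution k E (fun x => expR (- (k * \sum_i c i * l i x))).
Proof.
move=> c1; rewrite (_ : (fun x => _) = (fun x => expR ((- (k * \sum_i c i * (g i).1)) * x.1
    + (- (k * \sum_i c i * (g i).2)) * x.2 + - (k * \sum_i c i * l i (0, 0))))); last first.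
  by apply/funext => x; rewrite exp_bary_affine.
by apply: approx_solution_exp; rewrite !sqrrN !exprMn -mulrDr c1 mulr1.
Qed.

Definition edge_layer (k : R) (i : 'I_3) (x : R * R) : R := expR (- (k * (height i * l i x))).

Lemma edge_layer_sum k i : edge_layer k i =
  (fun x => expR (- (k * \sum_j (if j == i then height i else 0) * l j x))).
Proof.
apply/funext => x; rewrite /edge_layer (bigD1 i)//= eqxx big1 ?addr0// => j ji.
by rewrite (negbTE ji) mul0r.
Qed.

Lemma continuous_edge_layer k i : continuous (edge_layer k i).
Proof. by rewrite edge_layer_sum; exact: continuous_exp_bary. Qed.

Lemma approx_solution_edge_layer k i E : approx_solution k E (edge_layer k i).
Proof.
rewrite edge_layer_sum; apply: approx_solution_exp_bary.
have s (F : 'I_3 -> R) : \sum_j (if j == i then height i else 0) * F j = height i * F i.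
  by rewrite (bigD1 i)//= eqxx big1 ?addr0// => j ji; rewrite (negbTE ji) mul0r.
rewrite !s !exprMn -mulrDr -sqr_grad_norm -exprMn mulVf ?expr1n//.
by rewrite gt_eqF// grad_norm_gt0.
Qed.

Lemma edge_layer_gt0 k i x : 0 < edge_layer k i x.
Proof. exact: expR_gt0. Qed.

Lemma edge_layer_le1 k i x : 0 < k -> 0 <= l i x -> edge_layer k i x <= 1.
Proof.
move=> k0 lx; rewrite expR_le1 oppr_le0 mulr_ge0//; first exact: ltW.
by rewrite mulr_ge0// ltW// height_gt0.
Qed.

Lemma edge_layer_eq1 k i x : l i x = 0 -> edge_layer k i x = 1.
Proof. by rewrite /edge_layer => ->; rewrite !mulr0 oppr0 expR0. Qed.

(** The homothety at [v j] preserves the lines of the two sides through [v j], and halving distances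
    compensates the doubling of k. Only the layer of the opposite side, i = j, is pushed away, by
    half the height. *)
Lemma edge_layer_midpoint k i j x : edge_layer (2 * k) i (midpoint (v j) x) =
  expR (- (k * height i)) ^+ (i == j) * edge_layer k i x.
Proof.
rewrite /edge_layer bary_midpoint//; case: eqP => _.
  by rewrite expr1 -expRD /= mulr1n; congr expR; field.
by rewrite expr0 mul1r /= mulr0n; congr expR; field.
Qed.

Variable h : R.
Hypothesis h0 : 0 < h.
Hypothesis hmin : forall i, h <= height i.

(* With [bc = (beta, gamma)] and [beta] at most the height of j, [exp (- k (beta l_j + gamma l_m))] solves the
   equation, dominates the layer of j on the edge [l_m = 0], and is small away from the vertex i. *)
Lemma barrier_coefficients i j m : distinct3 i j m ->
  exists bc : R * R, [/\ h <= bc.1, h <= bc.2, bc.1 <= height j &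
    (bc.1 * (g j).1 + bc.2 * (g m).1) ^+ 2 + (bc.1 * (g j).2 + bc.2 * (g m).2) ^+ 2 = 1].
Proof.
move=> ijm; have [gi1 gi2] := grad_opp ijm.
have ri0 := grad_norm_gt0 i; have rj0 := grad_norm_gt0 j; have rm0 := grad_norm_gt0 m.
have u t : height t * grad_norm t = 1 by rewrite mulVf// gt_eqF// grad_norm_gt0.
have [hij|hji] := leP (height i) (height j).
  (* Since [l j + l m = 1 - l i], this is the half-plane solution decaying from the line through the
     vertex i parallel to the opposite side. *)
  exists (height i, height i); split => //=.
  rewrite -!mulrDr !exprMn -mulrDr.
  have -> : ((g j).1 + (g m).1) ^+ 2 + ((g j).2 + (g m).2) ^+ 2 = grad_norm i ^+ 2.
    by rewrite sqr_grad_norm gi1 gi2 !sqrrN.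
  by rewrite -exprMn u expr1n.
(* The nonzero root gamma of the unit-norm condition when beta is [height j]: the unit normal to the
   side [l_j = 0] is reflected in the line [l_m = 0]. It is at least [height j] because
   [grad_norm i <= grad_norm j] here. *)
pose c := height j * (height m ^+ 2 * (grad_norm j ^+ 2 + grad_norm m ^+ 2 - grad_norm i ^+ 2)).
have rij : grad_norm i <= grad_norm j.
  by rewrite ltW// -[X in X < _]invrK -[X in _ < X]invrK ltf_pV2// posrE invr_gt0.
exists (height j, c); split => //=.
  rewrite (le_trans (hmin j))// /c ler_peMr//; first exact/ltW/height_gt0.
  have -> : 1 = height m ^+ 2 * grad_norm m ^+ 2 by rewrite -exprMn u expr1n.
  rewrite ler_wpM2l ?sqr_ge0// addrAC lerDr subr_ge0.
  by rewrite lerXn2r// nnegrE; exact: ltW.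
have e := sqr_grad_norm m; have ej := sqr_grad_norm j.
have dot : 2 * ((g j).1 * (g m).1 + (g j).2 * (g m).2)
    = - (grad_norm j ^+ 2 + grad_norm m ^+ 2 - grad_norm i ^+ 2).
  by rewrite !sqr_grad_norm gi1 gi2; ring.
set d := (g j).1 * (g m).1 + (g j).2 * (g m).2 in dot.
have cE : c * grad_norm m ^+ 2 = - (height j * (2 * d)).
  rewrite dot /c; set S := _ - _; rewrite !mulrN opprK.
  have -> : height j * (height m ^+ 2 * S) * grad_norm m ^+ 2 = height j * S * (height m * grad_norm m) ^+ 2 by ring.
  by rewrite u expr1n mulr1.
have -> : (height j * (g j).1 + c * (g m).1) ^+ 2 + (height j * (g j).2 + c * (g m).2) ^+ 2
   = (height j * grad_norm j) ^+ 2 + c * (height j * (2 * d) + c * grad_norm m ^+ 2).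
  by rewrite /d exprMn ej e; ring.
by rewrite cE subrr mulr0 addr0 u expr1n.
Qed.

(** On the edge [l_m = 0] the layer of j is concentrated at the vertex i, where j vanishes too;
    hence the decay away from i. The case i = j, served by the zero function, lets barriers be
    summed over all pairs. *)
Lemma corner_barrier k i j : 0 < k -> exists y : R * R -> R,
  [/\ continuous y, approx_solution k D y,
    forall x, T x -> y x <= expR (- (k * (h * (1 - l i x)))),
    forall x, 0 <= y x & forall x m, distinct3 m i j -> T x -> l m x = 0 -> edge_layer k j x <= y x].
Proof.
move=> k0; have [->|ij] := eqVneq i j.
  exists (fun=> 0); split => //.
  - exact: cst_continuous.
  - rewrite (_ : (fun=> 0) = (fun x => 0 * edge_layer k j x)).
      by apply: approx_solutionZ; exact: approx_solution_edge_layer.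
    by apply/funext => x; rewrite mul0r.
  - by move=> x m /and3P[_ _]; rewrite eqxx.
have [m mij] := third ij.
have ijm : distinct3 i j m by move: mij => /and3P[a b c]; apply/and3P; split => //; rewrite eq_sym.
have [[be ga] /= [hb hg bj e1]] := barrier_coefficients ijm.
pose c n : R := if n == j then be else if n == m then ga else 0.
have cs (F : 'I_3 -> R) : \sum_n c n * F n = be * F j + ga * F m.
  rewrite (sum_distinct3 _ ijm) /c; move: ijm => /and3P[a1 a2 a3].
  by rewrite (negbTE a1) (negbTE a2) !eqxx eq_sym (negbTE a3) mul0r add0r.
exists (fun x => expR (- (k * \sum_n c n * l n x))); split.
- exact: continuous_exp_bary.
- by apply: approx_solution_exp_bary; rewrite !cs.
- move=> x hx; rewrite cs ler_expR lerN2 (ler_wpM2l (ltW k0))//.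
  have -> : 1 - l i x = l j x + l m x by rewrite -(sum_bary det0 x) (sum_distinct3 _ ijm); ring.
  by rewrite mulrDr lerD// ler_wpM2r//; exact: hx.
- by move=> x; exact: expR_ge0.
- move=> x m' m'ij hx lx; have mm : m' = m.
    have [//|e|e] := distinct3_cases m' mij; move: m'ij; rewrite e /distinct3 eqxx//.
    by rewrite andbF.
  rewrite cs -mm lx mulr0 addr0 ler_expR lerN2 (ler_wpM2l (ltW k0))// ler_wpM2r//; exact: hx.
Qed.

End TriangleEstimates.

Section CornerDefect.
Context {R : realType} (v : 'I_3 -> R * R).
Hypothesis det0 : triangle_det v != 0.
Local Notation l := (bary v).
Local Notation D := (open_triangle v).
Local Notation T := (hull v).

Variable w : R -> R * R -> R.
Hypothesis cw : forall k, 0 < k -> continuous (w k).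
Hypothesis aw : forall k, 0 < k -> approx_solution k D (w k).
Hypothesis w_out : forall k x, 0 < k -> ~ D x -> w k x = 1.

Variable h : R.
Hypothesis h0 : 0 < h.
Hypothesis hmin : forall i, h <= height v i.

(* Each edge layer is a half-plane solution, so their sum differs from the exit transform only
   near the vertices. *)
Definition corner_defect (k : R) (x : R * R) : R := \sum_i edge_layer v k i x - w k x.

Local Notation Z := corner_defect.
Local Notation p := (edge_layer v).

Let oD : open D := open_open_triangle det0.
Let cT : compact T := compact_hull det0.
Let DT : D `<=` T := @open_triangle_hull _ v.

Let continuous_sum3 (F : 'I_3 -> R * R -> R) : (forall i, continuous (F i)) ->
  continuous (fun x => \sum_i F i x).
Proof.
move=> cF; rewrite (_ : (fun x => _) = (fun x => F o0 x + F o1 x + F o2 x)).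
  by move=> x; apply: cvgD; [apply: cvgD|]; exact: cF.
by apply/funext => x; rewrite sum_ord3.
Qed.

Lemma continuous_corner_defect k : 0 < k -> continuous (Z k).
Proof.
move=> k0 x; apply: cvgB; last exact: cw.
by apply: continuous_sum3 => i; exact: continuous_edge_layer.
Qed.

Lemma approx_solution_corner_defect k : 0 < k -> approx_solution k D (Z k).
Proof.
move=> k0; rewrite (_ : Z k = (fun x => \sum_i p k i x + (-1) * w k x)).
  apply: approx_solutionD.
    by apply: approx_solution_sum => i; exact: approx_solution_edge_layer.
  by apply: approx_solutionZ; exact: aw.
by apply/funext => x; rewrite mulN1r.
Qed.

Let on_edge_out x m : l m x = 0 -> ~ D x.
Proof. by move=> e /(_ m); rewrite e ltxx. Qed.

Lemma corner_defect_edge k x m a b : 0 < k -> distinct3 m a b -> l m x = 0 ->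
  Z k x = p k a x + p k b x.
Proof.
move=> k0 mab lm; rewrite /corner_defect w_out//; last exact: on_edge_out lm.
by rewrite (sum_distinct3 _ mab) (edge_layer_eq1 _ lm); ring.
Qed.

Lemma corner_defect_ge0 k x : 0 < k -> T x -> 0 <= Z k x.
Proof.
move=> k0 hx; rewrite -oppr_le0; move: x hx.
apply: (max_principle k0 (lexx 0) oD cT DT).
- by move=> x; apply: cvgN; exact: continuous_corner_defect.
- rewrite (_ : (fun x => _) = (fun x => (-1) * Z k x)).
    by apply: approx_solutionZ; exact: approx_solution_corner_defect.
  by apply/funext => x; rewrite mulN1r.
- move=> x hx nD; have [m lm] := hull_boundary hx nD; have [a [b mab]] := others m.
  by rewrite (corner_defect_edge k0 mab lm) oppr_le0 addr_ge0// ltW// edge_layer_gt0.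
Qed.

(** The sum of all barriers dominates the defect on the boundary: on the edge opposite to m, the
    layers of a and b lie below [y b a] and [y a b], and the other barriers are nonnegative. The
    factor 3 counts the barriers attached to one vertex. *)
Lemma corner_defect_le k x : 0 < k -> T x ->
  Z k x <= 3 * \sum_i expR (- (k * (h * (1 - l i x)))).
Proof.
move=> k0 hx.
have /choice[y0 y0P] : forall ij : 'I_3 * 'I_3, exists y : R * R -> R,
  [/\ continuous y, approx_solution k D y,
    forall x, T x -> y x <= expR (- (k * (h * (1 - l ij.1 x)))),
    forall x, 0 <= y x &
    forall x m, distinct3 m ij.1 ij.2 -> T x -> l m x = 0 -> p k ij.2 x <= y x].
  by move=> [i j]; exact: corner_barrier.
pose y i j := y0 (i, j).
have yP i j : [/\ continuous (y i j), approx_solution k D (y i j),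
    forall x, T x -> y i j x <= expR (- (k * (h * (1 - l i x)))),
    forall x, 0 <= y i j x &
    forall x m, distinct3 m i j -> T x -> l m x = 0 -> p k j x <= y i j x].
  exact: y0P (i, j).
apply: (@le_trans _ _ (\sum_i \sum_j y i j x)); last first.
  rewrite mulr_sumr; apply: ler_sum => i _; rewrite sum_ord3.
  have Y j : y i j x <= expR (- (k * (h * (1 - l i x)))) by have [_ _ Y _ _] := yP i j; exact: Y.
  by have := Y o0; have := Y o1; have := Y o2; lra.
rewrite -subr_le0; move: x hx.
apply: (max_principle k0 (lexx 0) oD cT DT).
- move=> x; apply: cvgB; first exact: continuous_corner_defect.
  by apply: continuous_sum3 => i; apply: continuous_sum3 => j; have [] := yP i j.
- rewrite (_ : (fun x => _) = (fun x => Z k x + (-1) * \sum_i \sum_j y i j x)).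
    apply: approx_solutionD; first exact: approx_solution_corner_defect.
    apply: approx_solutionZ; apply: approx_solution_sum => i; apply: approx_solution_sum => j.
    by have [] := yP i j.
  by apply/funext => x; rewrite mulN1r.
- move=> x hx nD; have [m lm] := hull_boundary hx nD; have [a [b mab]] := others m.
  have mba : distinct3 m b a by move: mab => /and3P[? ? ?]; apply/and3P; split; rewrite // eq_sym.
  rewrite (corner_defect_edge k0 mab lm) subr_le0 (sum_distinct3 _ mab).
  rewrite !(sum_distinct3 (fun j => y _ j x) mab).
  have y_ge0 i j : 0 <= y i j x by have [_ _ _ Y _] := yP i j; exact: Y.
  have ya : p k a x <= y b a x by have [_ _ _ _ Y] := yP b a; exact: Y mba hx lm.
  have yb : p k b x <= y a b x by have [_ _ _ _ Y] := yP a b; exact: Y mab hx lm.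
  have := y_ge0 m m; have := y_ge0 m a; have := y_ge0 m b; have := y_ge0 a m.
  by have := y_ge0 a a; have := y_ge0 b m; have := y_ge0 b b; lra.
Qed.

(** Each [1 - l i x] is at least 1/2, which the parameter [2 * k] compensates; 9 is the factor 3 of
    the previous bound times three vertices. *)
Lemma corner_defect_le_middle k x : 0 < k -> T x -> (forall i, l i x <= 2^-1) ->
  Z (2 * k) x <= 9 * expR (- (k * h)).
Proof.
move=> k0 hx lx; have k20 : 0 < 2 * k by rewrite mulr_gt0.
have le i : expR (- (2 * k * (h * (1 - l i x)))) <= expR (- (k * h)).
  rewrite ler_expR lerN2.
  rewrite (_ : 2 * k * _ = k * h * (2 * (1 - l i x))); last by ring.
  rewrite ler_peMr//; first by rewrite mulr_ge0// ltW.
  by have := lx i; lra.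
apply: (le_trans (corner_defect_le k20 hx)); rewrite sum_ord3.
by have := le o0; have := le o1; have := le o2; lra.
Qed.

Lemma midpoint_hull i x : T x -> T (midpoint (v i) x).
Proof.
by move=> hx j; rewrite bary_midpoint// divr_ge0// addr_ge0// hx.
Qed.

Let corner_defect_midpoint k x m a b : 0 < k -> distinct3 m a b -> l m x = 0 ->
  Z (2 * k) (midpoint (v a) x) = expR (- (k * height v a)) * p k a x + p k b x.
Proof.
move=> k0 mab lm; have /and3P[ma mb ab] := mab.
have lm2 : l m (midpoint (v a) x) = 0 by rewrite bary_midpoint// lm (negbTE ma) addr0 mul0r.
rewrite (corner_defect_edge _ mab lm2) ?mulr_gt0// !edge_layer_midpoint// eqxx.
by rewrite eq_sym (negbTE ab) /= expr1 expr0 mul1r.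
Qed.

Let approx_solution_doubling k : 0 < k ->
  approx_solution k D (fun x => \sum_i Z (2 * k) (midpoint (v i) x)).
Proof.
move=> k0; apply: approx_solution_sum => i; apply: approx_solution_midpoint.
  by move=> x; exact: open_triangle_midpoint.
by apply: approx_solution_corner_defect; rewrite mulr_gt0.
Qed.

Lemma continuous_corner_defect_midpoint k i : 0 < k ->
  continuous (fun x => Z (2 * k) (midpoint (v i) x)).
Proof.
move=> k0 x; apply: continuous_comp; first exact: continuous_midpoint.
by apply: continuous_corner_defect; rewrite mulr_gt0.
Qed.

(* The defect at scale k near a vertex is almost the defect at scale 2k seen through the
   homothety of ratio 1/2 at that vertex. *)
Lemma corner_defect_doubling_le k x : 0 < k -> T x ->
  Z k x <= \sum_i Z (2 * k) (midpoint (v i) x).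
Proof.
move=> k0 hx; rewrite -subr_le0; move: x hx.
apply: (max_principle k0 (lexx 0) oD cT DT).
- move=> x; apply: cvgB; first exact: continuous_corner_defect.
  by apply: continuous_sum3 => i; exact: continuous_corner_defect_midpoint.
- rewrite (_ : (fun x => _) = (fun x => Z k x + (-1) * \sum_i Z (2 * k) (midpoint (v i) x))).
    apply: approx_solutionD; first exact: approx_solution_corner_defect.
    by apply: approx_solutionZ; exact: approx_solution_doubling.
  by apply/funext => x; rewrite mulN1r.
- move=> x hx nD; have [m lm] := hull_boundary hx nD; have [a [b mab]] := others m.
  have mba : distinct3 m b a by move: mab => /and3P[? ? ?]; apply/and3P; split; rewrite // eq_sym.
  rewrite (corner_defect_edge k0 mab lm) (sum_distinct3 _ mab).
  rewrite (corner_defect_midpoint k0 mab lm) (corner_defect_midpoint k0 mba lm).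
  have k20 : 0 < 2 * k by rewrite mulr_gt0.
  have := corner_defect_ge0 k20 (midpoint_hull m hx).
  have e i : 0 <= expR (- (k * height v i)) * p k i x by rewrite mulr_ge0// expR_ge0.
  by have := e a; have := e b; lra.
Qed.

(** On the edge opposite to m, the homotheties at its ends exceed the defect by one factor
    [expR (- (k * h))] each. The homothety at m lands where no coordinate exceeds 1/2 and adds at
    most 9 more, whence 11. *)
Lemma corner_defect_doubling_ge k x : 0 < k -> T x ->
  \sum_i Z (2 * k) (midpoint (v i) x) <= Z k x + 11 * expR (- (k * h)).
Proof.
move=> k0 hx; rewrite -lerBlDl; move: x hx.
apply: (max_principle k0 _ oD cT DT).
- by rewrite mulr_ge0// expR_ge0.
- move=> x; apply: cvgB; last exact: continuous_corner_defect.
  by apply: continuous_sum3 => i; exact: continuous_corner_defect_midpoint.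
- rewrite (_ : (fun x => _) = (fun x => \sum_i Z (2 * k) (midpoint (v i) x) + (-1) * Z k x)).
    apply: approx_solutionD; first exact: approx_solution_doubling.
    by apply: approx_solutionZ; exact: approx_solution_corner_defect.
  by apply/funext => x; rewrite mulN1r.
- move=> x hx nD; have [m lm] := hull_boundary hx nD; have [a [b mab]] := others m.
  have mba : distinct3 m b a by move: mab => /and3P[? ? ?]; apply/and3P; split; rewrite // eq_sym.
  rewrite (corner_defect_edge k0 mab lm) (sum_distinct3 _ mab).
  rewrite (corner_defect_midpoint k0 mab lm) (corner_defect_midpoint k0 mba lm).
  have e i : expR (- (k * height v i)) * p k i x <= expR (- (k * h)).
    apply: (@le_trans _ _ (expR (- (k * height v i)) * 1)).
      by rewrite ler_wpM2l ?expR_ge0// edge_layer_le1// hx.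
    by rewrite mulr1 ler_expR lerN2 (ler_wpM2l (ltW k0))// hmin.
  have mid i : l i (midpoint (v m) x) <= 2^-1.
    rewrite bary_midpoint//; have [->|im] := eqVneq i m.
      by rewrite lm add0r mul1r.
    by rewrite addr0 -[leRHS]mul1r ler_wpM2r ?invr_ge0// hull_le1.
  have := corner_defect_le_middle k0 (midpoint_hull m hx) mid.
  by have := e a; have := e b; lra.
Qed.

End CornerDefect.

(** * Integrated corner defects and the spectral gap *)

Section TriangleIntegrals.
Context {R : realType} (v : 'I_3 -> R * R).
Hypothesis det0 : triangle_det v != 0.
Local Notation l := (bary v).
Local Notation D := (open_triangle v).
Local Notation J := `|triangle_det v|.

Lemma measurable_open_triangle : measurable (D : set (plane R)).
Proof. exact: open_measurable_plane (open_open_triangle det0). Qed.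

Lemma open_triangle_finite : (leb2 R D < +oo)%E.
Proof. by rewrite measure_open_triangle// ltry. Qed.

Lemma integrable_open_triangle (f q : R * R -> R) : continuous f ->
  measurable_fun (D : set (plane R)) q -> (forall x, D x -> `|q x| <= 1) ->
  (leb2 R).-integrable D (EFin \o (fun x => f x * q x)).
Proof.
move=> cf mq q1.
have [M [_ hM]] := compact_bounded (continuous_compact (continuous_subspaceT cf) (compact_hull det0)).
apply: (@integrable_bounded _ _ _ (M + 1)); [exact: open_open_triangle|exact: open_triangle_finite| |].
  by apply: measurable_funM => //; apply: measurable_funTS; exact: continuousT_measurable_plane.
move=> x Dx; rewrite normrM (le_trans (ler_piMr _ (q1 x Dx)))//.
by apply: (hM (M + 1)); [rewrite ltrDl|exists x => //; exact: open_triangle_hull].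
Qed.

Lemma integrable_continuous (f : R * R -> R) : continuous f ->
  (leb2 R).-integrable D (EFin \o f).
Proof.
move=> cf; rewrite (_ : f = (fun x => f x * 1)); last by apply/funext => x; rewrite mulr1.
by apply: integrable_open_triangle => // x _; rewrite normr1.
Qed.

Lemma Rintegral_sum3 (F : 'I_3 -> R * R -> R) :
  (forall i, (leb2 R).-integrable D (EFin \o F i)) ->
  \int[leb2 R]_(x in D) (\sum_i F i x) = \sum_i \int[leb2 R]_(x in D) F i x.
Proof.
move=> iF; have mD := measurable_open_triangle.
under eq_Rintegral do rewrite sum_ord3.
rewrite RintegralD//; first by rewrite RintegralD// sum_ord3.
exact: (integrableD mD (iF o0) (iF o1)).
Qed.

Definition corner i : set (R * R) := [set x | 2^-1 < l i x].

Lemma measurable_corner i : measurable_fun (D : set (plane R)) (\1_(corner i) : R * R -> R).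
Proof.
apply: measurable_indic; apply: open_measurable_plane.
rewrite (_ : corner i = l i @^-1` [set z | 2^-1 < z])//.
by apply: open_comp; [move=> x _; exact: continuous_bary|exact: open_gt].
Qed.

Let norm_indic_le1 (E : set (R * R)) x : `|\1_E x : R| <= 1.
Proof. by rewrite indicE; case: (_ \in _); rewrite ?normr1 ?normr0. Qed.

Lemma integrable_corner (f : R * R -> R) i : continuous f ->
  (leb2 R).-integrable D (EFin \o (fun x => f x * \1_(corner i) x)).
Proof. by move=> cf; apply: integrable_open_triangle => //; exact: measurable_corner. Qed.

Lemma Rintegral_midpoint i (f : R * R -> R) : continuous f -> (forall x, D x -> 0 <= f x) ->
  \int[leb2 R]_(x in D) f (midpoint (v i) x) = 4 * \int[leb2 R]_(x in D) (f x * \1_(corner i) x).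
Proof.
move=> cf f0; rewrite /Rintegral integral_midpoint// fineM//.
have := integrable_fin_num measurable_open_triangle (integrable_corner i cf).
by apply.
Qed.

Lemma Rintegral_exp_bary i (c : R) : 0 < c ->
  \int[leb2 R]_(x in D) expR (- (c * l i x)) = J * (c^-1 - c^-1 ^+ 2 + c^-1 ^+ 2 * expR (- c)).
Proof. by move=> c0; rewrite /Rintegral integral_exp_bary. Qed.

Lemma sum_corner_le1 x : D x -> \sum_i (\1_(corner i) x : R) <= 1.
Proof.
move=> Dx; have s := sum_bary det0 x.
have D0 := Dx o0; have D1 := Dx o1; have D2 := Dx o2.
rewrite sum_ord3 in s; rewrite sum_ord3 !indicE.
by case: (boolP (x \in corner o0)); case: (boolP (x \in corner o1));
  case: (boolP (x \in corner o2)); rewrite ?inE ?notin_setE /corner /= => c2 c1 c0;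
  rewrite ?mulr1n ?mulr0n; move: s D0 D1 D2 c0 c1 c2; try lra.
Qed.

Lemma sum_corner_eq0 x : D x -> ~ (exists i, corner i x) -> forall i, l i x <= 2^-1.
Proof. by move=> Dx nc i; rewrite leNgt; apply/negP => ci; apply: nc; exists i. Qed.

Variable w : R -> R * R -> R.
Hypothesis cw : forall k, 0 < k -> continuous (w k).
Hypothesis aw : forall k, 0 < k -> approx_solution k D (w k).
Hypothesis w_out : forall k x, 0 < k -> ~ D x -> w k x = 1.

Variable h : R.
Hypothesis h0 : 0 < h.
Hypothesis hmin : forall i, h <= height v i.

Local Notation Z := (corner_defect v w).
Local Notation Int f := (\int[leb2 R]_(x in D) f x).

Let cZ k : 0 < k -> continuous (Z k).
Proof. by move=> k0; exact: continuous_corner_defect. Qed.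

Let Z_ge0 k x : 0 < k -> D x -> 0 <= Z k x.
Proof. by move=> k0 /open_triangle_hull; exact: corner_defect_ge0. Qed.

Let Int_doubling k : 0 < k ->
  Int (fun x => \sum_i Z (2 * k) (midpoint (v i) x))
  = 4 * \int[leb2 R]_(x in D) (\sum_i Z (2 * k) x * \1_(corner i) x).
Proof.
move=> k0; have k20 : 0 < 2 * k by rewrite mulr_gt0.
rewrite Rintegral_sum3; last first.
  by move=> i; apply: integrable_continuous; exact: continuous_corner_defect_midpoint.
rewrite Rintegral_sum3; last by move=> i; apply: integrable_corner; exact: cZ.
rewrite mulr_sumr; apply: eq_bigr => i _; apply: Rintegral_midpoint; first exact: cZ.
by move=> x; exact: Z_ge0.
Qed.

Let integrable_doubling k : 0 < k ->
  (leb2 R).-integrable D (EFin \o (fun x => \sum_i Z (2 * k) (midpoint (v i) x))).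
Proof.
move=> k0; apply: integrable_continuous.
rewrite (_ : (fun x => _) = (fun x => Z (2 * k) (midpoint (v o0) x) + Z (2 * k) (midpoint (v o1) x)
  + Z (2 * k) (midpoint (v o2) x))); last by apply/funext => x; rewrite sum_ord3.
by move=> x; apply: cvgD; [apply: cvgD|]; exact: continuous_corner_defect_midpoint.
Qed.

Let integrable_corners k : 0 < k ->
  (leb2 R).-integrable D (EFin \o (fun x => \sum_i Z k x * \1_(corner i) x)).
Proof.
move=> k0; rewrite (_ : (fun x => _) = (fun x => Z k x * \sum_i (\1_(corner i) x))); last first.
  by apply/funext => x; rewrite mulr_sumr.
apply: integrable_open_triangle; first exact: cZ.
  rewrite (_ : (fun x => _) = (fun x => \1_(corner o0) x + \1_(corner o1) x + \1_(corner o2) x)).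
    by apply: measurable_funD; [apply: measurable_funD|]; exact: measurable_corner.
  by apply/funext => x; rewrite sum_ord3.
move=> x Dx; rewrite ger0_norm ?sum_corner_le1//.
by apply: sumr_ge0 => i _; rewrite indicE.
Qed.

(** Integrating the pointwise comparison turns the three homothetic terms into 4 times the integral
    of the defect at [2 * k] over the corners, which are disjoint. *)
Lemma corner_defect_integral_le k : 0 < k -> Int (Z k) <= 4 * Int (Z (2 * k)).
Proof.
move=> k0; have k20 : 0 < 2 * k by rewrite mulr_gt0.
have mD := measurable_open_triangle.
apply: (@le_trans _ _ (Int (fun x => \sum_i Z (2 * k) (midpoint (v i) x)))).
  apply: le_Rintegral => //.
  - by apply: integrable_continuous; exact: cZ.
  - exact: integrable_doubling.
  - by move=> x /open_triangle_hull; exact: corner_defect_doubling_le.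
rewrite Int_doubling// ler_wpM2l//; apply: le_Rintegral => //.
- exact: integrable_corners.
- by apply: integrable_continuous; exact: cZ.
- by move=> x Dx; rewrite -mulr_sumr ler_piMr ?sum_corner_le1// Z_ge0.
Qed.

(** Outside the corners the defect at [2 * k] is at most [9 * expR (- (k * h))]. With the factor 4
    and the error 11 of the pointwise comparison this makes 47, times the area J / 2. *)
Lemma corner_defect_integral_ge k : 0 < k ->
  4 * Int (Z (2 * k)) <= Int (Z k) + 47 * (J / 2) * expR (- (k * h)).
Proof.
move=> k0; have k20 : 0 < 2 * k by rewrite mulr_gt0.
have mD := measurable_open_triangle.
have icst c : (leb2 R).-integrable D (EFin \o (fun=> c)).
  by apply: integrable_continuous; exact: cst_continuous.
have cstE c : Int (fun=> c) = c * (J / 2).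
  by rewrite Rintegral_cst// [X in fine X](measure_open_triangle det0).
have h1 : Int (Z (2 * k)) <= \int[leb2 R]_(x in D) (\sum_i Z (2 * k) x * \1_(corner i) x)
    + 9 * expR (- (k * h)) * (J / 2).
  rewrite -cstE -RintegralD//; last exact: integrable_corners.
  apply: le_Rintegral => //.
  - by apply: integrable_continuous; exact: cZ.
  - exact: (integrableD mD (integrable_corners k20) (icst _)).
  move=> x Dx; rewrite -mulr_sumr; have hx := open_triangle_hull Dx.
  have [[i ci]|nc] := pselect (exists i, corner i x).
    have s1 : 1 <= \sum_i (\1_(corner i) x : R).
      rewrite (bigD1 i)//= indicE mem_set//= lerDl; apply: sumr_ge0 => j _.
      by rewrite indicE.
    have z0 : Z (2 * k) x <= Z (2 * k) x * \sum_i \1_(corner i) x by rewrite ler_peMr// Z_ge0.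
    by rewrite (le_trans z0)// lerDl mulr_ge0// expR_ge0.
  have z0 : 0 <= Z (2 * k) x * \sum_i \1_(corner i) x.
    by rewrite mulr_ge0 ?Z_ge0//; apply: sumr_ge0 => j _; rewrite indicE.
  suff z1 : Z (2 * k) x <= 9 * expR (- (k * h)) by rewrite (le_trans z1)// lerDr.
  by apply: (corner_defect_le_middle det0 cw aw w_out h0 hmin k0 hx); exact: sum_corner_eq0.
have h2 : 4 * \int[leb2 R]_(x in D) (\sum_i Z (2 * k) x * \1_(corner i) x)
    <= Int (Z k) + 11 * expR (- (k * h)) * (J / 2).
  rewrite -Int_doubling// -cstE -RintegralD//; last by apply: integrable_continuous; exact: cZ.
  apply: le_Rintegral => //.
  - exact: integrable_doubling.
  - exact: (integrableD mD (integrable_continuous (cZ k0)) (icst _)).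
  - by move=> x /open_triangle_hull; exact: corner_defect_doubling_ge.
move: h1 h2; set I1 := Rintegral _ _ _; set I2 := Rintegral _ _ _; set I3 := Rintegral _ _ _.
by move=> h1 h2; lra.
Qed.

Let integral_w k : 0 < k -> Int (w k) =
  \sum_i J * (grad_norm v i / k - (grad_norm v i / k) ^+ 2
    + (grad_norm v i / k) ^+ 2 * expR (- (k * height v i))) - Int (Z k).
Proof.
move=> k0; have mD := measurable_open_triangle.
have ie i : (leb2 R).-integrable D (EFin \o edge_layer v k i).
  by apply: integrable_continuous; exact: continuous_edge_layer.
have iw : (leb2 R).-integrable D (EFin \o w k) by apply: integrable_continuous; exact: cw.
have isum : (leb2 R).-integrable D (EFin \o (fun x => \sum_i edge_layer v k i x)).
  rewrite (_ : (fun x => _) = (fun x => Z k x + w k x)).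
    exact: (integrableD mD (integrable_continuous (cZ k0)) iw).
  by apply/funext => x; rewrite subrK.
have -> : \sum_i J * (grad_norm v i / k - (grad_norm v i / k) ^+ 2
    + (grad_norm v i / k) ^+ 2 * expR (- (k * height v i))) = \sum_i Int (edge_layer v k i).
  apply: eq_bigr => i _; have r0 := grad_norm_gt0 det0 i.
  rewrite -[in LHS](invrK (grad_norm v i)) -/(height v i) -invfM [height v i * k]mulrC.
  rewrite [RHS](_ : _ = Int (fun x => expR (- (k * height v i * l i x)))).
    exact: (esym (Rintegral_exp_bary i (mulr_gt0 k0 (height_gt0 det0 i)))).
  by apply: eq_Rintegral => x _; rewrite /edge_layer mulrA.
by rewrite /corner_defect RintegralB// Rintegral_sum3// opprB addrC subrK.
Qed.

(* Chosen so that the contributions of the perimeter and of the corner angles cancel, up to an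
   exponentially small error, when F is the integral of the exit transform. *)
Definition spectral_gap (F : R -> R) (k : R) : R :=
  k ^+ 2 * F k - 4 * k ^+ 2 * F (2 * k) + k * (J * \sum_i grad_norm v i).

(** In the edge integrals the terms linear in k cancel against the perimeter and the constant ones
    between the two scales. Doubling k squares the exponential, which leaves the difference of
    powers. *)
Lemma spectral_gapE k : 0 < k -> spectral_gap (fun k => Int (w k)) k =
  \sum_i J * grad_norm v i ^+ 2 * (expR (- (k * height v i)) - expR (- (k * height v i)) ^+ 2)
  + k ^+ 2 * (4 * Int (Z (2 * k)) - Int (Z k)).
Proof.
move=> k0; rewrite /spectral_gap !integral_w ?mulr_gt0//.
have -> : 4 * k ^+ 2 * (\sum_i J * (grad_norm v i / (2 * k) - (grad_norm v i / (2 * k)) ^+ 2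
    + (grad_norm v i / (2 * k)) ^+ 2 * expR (- (2 * k * height v i))) - Int (Z (2 * k)))
  = \sum_i J * (2 * k * grad_norm v i - grad_norm v i ^+ 2
      + grad_norm v i ^+ 2 * expR (- (k * height v i)) ^+ 2) - 4 * k ^+ 2 * Int (Z (2 * k)).
  rewrite mulrBr mulr_sumr; congr (_ - _); apply: eq_bigr => i _.
  have -> : expR (- (2 * k * height v i)) = expR (- (k * height v i)) ^+ 2.
    by rewrite expr2 -expRD; congr expR; ring.
  by field; rewrite gt_eqF.
have -> : k ^+ 2 * (\sum_i J * (grad_norm v i / k - (grad_norm v i / k) ^+ 2
    + (grad_norm v i / k) ^+ 2 * expR (- (k * height v i))) - Int (Z k))
  = \sum_i J * (k * grad_norm v i - grad_norm v i ^+ 2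
      + grad_norm v i ^+ 2 * expR (- (k * height v i))) - k ^+ 2 * Int (Z k).
  rewrite mulrBr mulr_sumr; congr (_ - _); apply: eq_bigr => i _.
  by field; rewrite gt_eqF.
by rewrite !sum_ord3; ring.
Qed.

(** All terms of the gap are nonnegative, so one edge term bounds it from below. In the upper bound,
    24 rounds up 47 / 2. *)
Lemma spectral_gap_bounds k m : 0 < k ->
  J * grad_norm v m ^+ 2 * (expR (- (k * height v m)) - expR (- (k * height v m)) ^+ 2)
    <= spectral_gap (fun k => Int (w k)) k <=
  J * (\sum_i grad_norm v i ^+ 2 + 24 * k ^+ 2) * expR (- (k * h)).
Proof.
move=> k0; rewrite spectral_gapE//.
have k2 : 0 <= k ^+ 2 by rewrite sqr_ge0.
have [a [b mab]] := others m.
have e i : 0 <= expR (- (k * height v i)) <= 1.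
  by rewrite expR_ge0 expR_le1 oppr_le0 mulr_ge0 ?(ltW (height_gt0 det0 i))// ltW.
have t0 i : 0 <= J * grad_norm v i ^+ 2 * (expR (- (k * height v i)) - expR (- (k * height v i)) ^+ 2).
  apply: mulr_ge0; first by rewrite mulr_ge0 ?sqr_ge0.
  rewrite subr_ge0 expr2.
  by have /andP[e0 e1] := e i; rewrite ler_piMr.
apply/andP; split.
  rewrite (sum_distinct3 _ mab) -addrA -addrA lerDl !addr_ge0// mulr_ge0// subr_ge0.
  exact: corner_defect_integral_le.
rewrite [leRHS](_ : _ = J * (\sum_i grad_norm v i ^+ 2) * expR (- (k * h))
  + J * (24 * k ^+ 2) * expR (- (k * h))); last by ring.
apply: lerD.
  rewrite mulr_sumr mulr_suml; apply: ler_sum => i _; apply: ler_wpM2l.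
    by rewrite mulr_ge0 ?sqr_ge0.
  have E : expR (- (k * height v i)) <= expR (- (k * h)).
    by rewrite ler_expR lerN2 (ler_wpM2l (ltW k0)).
  by rewrite (le_trans _ E)// lerBlDr lerDl sqr_ge0.
have c := corner_defect_integral_ge k0.
have je : 0 <= J * expR (- (k * h)) by rewrite mulr_ge0// expR_ge0.
rewrite (_ : J * _ * _ = k ^+ 2 * (24 * (J * expR (- (k * h))))); last by ring.
rewrite ler_wpM2l//; move: c je; set I1 := Rintegral _ _ _; set I2 := Rintegral _ _ _.
by set E := expR _ => c je; lra.
Qed.

End TriangleIntegrals.

(** * Reconstruction of the triangle *)

Section CongruentTriangles.
Context {R : realType}.
Implicit Types v w : 'I_3 -> R * R.

Lemma distinct3_inj (f : 'I_3 -> 'I_3) m a b : injective f -> distinct3 m a b ->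
  distinct3 (f m) (f a) (f b).
Proof. by move=> fI /and3P[ma mb ab]; rewrite /distinct3 !(inj_eq fI) ma mb ab. Qed.

Lemma third_inj (f : 'I_3 -> 'I_3) m a b m' a' b' : distinct3 m a b -> distinct3 m' a' b' ->
  f m = m' -> f a = a' -> f b = b' -> injective f.
Proof.
move=> mab m'ab fm fa fb i j; have := m'ab; rewrite -fm -fa -fb => /and3P[n1 n2 n3].
have [->|->|->] := distinct3_cases i mab; have [->|->|->] := distinct3_cases j mab => // e;
  by move: n1 n2 n3; rewrite e eqxx.
Qed.

Lemma side_length v m a b : triangle_det v != 0 -> distinct3 m a b ->
  ((v a).1 - (v b).1) ^+ 2 + ((v a).2 - (v b).2) ^+ 2 = (triangle_det v * grad_norm v m) ^+ 2.
Proof.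
move=> d0; rewrite exprMn sqr_grad_norm.
by elim/ord3P: m; elim/ord3P: a; elim/ord3P: b => // _; rewrite /bary_grad /=; field.
Qed.

(* In general [(t0 + t1 + t2) (t0 |V0|^2 + t1 |V1|^2 + t2 |V2|^2)] is added on the right. *)
Lemma sqr_norm_zero_sum (t0 t1 t2 x0 x1 x2 y0 y1 y2 : R) : t0 + t1 + t2 = 0 ->
  (t0 * x0 + t1 * x1 + t2 * x2) ^+ 2 + (t0 * y0 + t1 * y1 + t2 * y2) ^+ 2 =
  - (t0 * t1 * ((x0 - x1) ^+ 2 + (y0 - y1) ^+ 2) + t0 * t2 * ((x0 - x2) ^+ 2 + (y0 - y2) ^+ 2)
     + t1 * t2 * ((x1 - x2) ^+ 2 + (y1 - y2) ^+ 2)).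
Proof.
move=> t0E; have -> : t2 = - t0 - t1 by lra.
ring.
Qed.

(** [F] is the affine map sending the vertex [f j] of v to the vertex j of w. Differences of
    barycentric coordinates sum to 0, so squared distances are a quadratic form in them whose
    coefficients are the squared sides, and these agree. *)
Lemma isometric_open_triangles v w (f : 'I_3 -> 'I_3) :
  triangle_det v != 0 -> triangle_det w != 0 -> injective f ->
  `|triangle_det v| = `|triangle_det w| ->
  (forall j, grad_norm w j = grad_norm v (f j)) ->
  isometric_domains (open_triangle v) (open_triangle w).
Proof.
move=> v0 w0 fI dE gE.
pose F (x : R * R) : R * R := (\sum_j bary v (f j) x * (w j).1, \sum_j bary v (f j) x * (w j).2).
have sumf (G : 'I_3 -> R) : \sum_j G (f j) = \sum_i G i by rewrite [RHS](reindex_inj fI).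
have baryF j x : bary w j (F x) = bary v (f j) x.
  rewrite bary_of_combination//; last by rewrite (sumf (fun i => bary v i x)) sum_bary.
  rewrite (bigD1 j)//= bary_vertex// eqxx mulr1 big1 ?addr0// => i ij.
  by rewrite bary_vertex// eq_sym (negbTE ij) mulr0.
exists F; split.
  move=> p q; rewrite /euclidean_dist; congr Num.sqrt.
  have side a b : a != b -> ((w a).1 - (w b).1) ^+ 2 + ((w a).2 - (w b).2) ^+ 2
    = ((v (f a)).1 - (v (f b)).1) ^+ 2 + ((v (f a)).2 - (v (f b)).2) ^+ 2.
    move=> ab; have [m mab] := third ab.
    rewrite (side_length w0 mab) (side_length v0 (distinct3_inj fI mab)) gE !exprMn.
    by rewrite -(real_normK (num_real (triangle_det w))) -dE real_normK// num_real.
  have E1 : p.1 - q.1 = \sum_j (bary v (f j) p - bary v (f j) q) * (v (f j)).1.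
    rewrite (sumf (fun i => (bary v i p - bary v i q) * (v i).1)).
    under eq_bigr do rewrite mulrBl.
    by rewrite sumrB {1}(bary_combination v0 p) {1}(bary_combination v0 q).
  have E2 : p.2 - q.2 = \sum_j (bary v (f j) p - bary v (f j) q) * (v (f j)).2.
    rewrite (sumf (fun i => (bary v i p - bary v i q) * (v i).2)).
    under eq_bigr do rewrite mulrBl.
    by rewrite sumrB {1}(bary_combination v0 p) {1}(bary_combination v0 q).
  have E3 : (F p).1 - (F q).1 = \sum_j (bary v (f j) p - bary v (f j) q) * (w j).1.
    by rewrite /F /= -sumrB; apply: eq_bigr => j _; rewrite mulrBl.
  have E4 : (F p).2 - (F q).2 = \sum_j (bary v (f j) p - bary v (f j) q) * (w j).2.
    by rewrite /F /= -sumrB; apply: eq_bigr => j _; rewrite mulrBl.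
  have t0 : \sum_j (bary v (f j) p - bary v (f j) q) = 0.
    by rewrite (sumf (fun i => bary v i p - bary v i q)) sumrB !sum_bary// subrr.
  rewrite E1 E2 E3 E4; move: t0; rewrite !sum_ord3 => t0.
  by rewrite !sqr_norm_zero_sum// !side.
apply/seteqP; split => [y [x Dx <-] j|y Dy]; first by rewrite baryF; exact: Dx.
(* The preimage of y is the point of the first triangle with the barycentric coordinates of y,
   relabelled by the inverse of f. *)
pose r i := bary w (invF fI i) y.
pose x : R * R := (\sum_i r i * (v i).1, \sum_i r i * (v i).2).
have r1 : \sum_i r i = 1.
  by rewrite -(sum_bary w0 y) -sumf; apply: eq_bigr => j _; rewrite /r invF_f.
have rE i : bary v i x = r i.
  rewrite bary_of_combination// (bigD1 i)//= bary_vertex// eqxx mulr1 big1 ?addr0// => j ij.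
  by rewrite bary_vertex// eq_sym (negbTE ij) mulr0.
exists x; first by move=> i; rewrite rE; exact: Dy.
rewrite [RHS](bary_combination w0) /F.
by congr (_, _); apply: eq_bigr => j _; rewrite rE /r invF_f.
Qed.

(** The gradients sum to 0, so they are the sides of a triangle of area half of
    [|triangle_det v|^-1]. This is Heron's formula for that triangle, with the perimeter in place of
    its half. *)
Lemma heron v m a b : triangle_det v != 0 -> distinct3 m a b ->
  let S := \sum_i grad_norm v i in
  S * (S - 2 * grad_norm v m) * (S - 2 * grad_norm v a) * (S - 2 * grad_norm v b)
  = 4 / triangle_det v ^+ 2.
Proof.
move=> v0 mab S; have /and3P[_ _ ab] := mab.
have -> : 4 / triangle_det v ^+ 2 = 4 * cross (bary_grad v a) (bary_grad v b) ^+ 2.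
  rewrite -(real_normK (num_real (cross (bary_grad v a) (bary_grad v b)))) cross_grad// exprVn.
  by rewrite real_normK// num_real.
have [g1 g2] := grad_opp v0 mab.
have ea := sqr_grad_norm v a; have eb := sqr_grad_norm v b; have em := sqr_grad_norm v m.
have -> : S * (S - 2 * grad_norm v m) * (S - 2 * grad_norm v a) * (S - 2 * grad_norm v b)
  = 4 * grad_norm v a ^+ 2 * grad_norm v b ^+ 2
    - (grad_norm v m ^+ 2 - grad_norm v a ^+ 2 - grad_norm v b ^+ 2) ^+ 2.
  by rewrite /S (sum_distinct3 _ mab); ring.
by rewrite ea eb em g1 g2 /cross; ring.
Qed.

(** Once one gradient norm is matched, the sum S fixes the sum of the other two, and Heron's formula
    fixes the product of [S - 2 * x] and [S - 2 * y]. The pair is thus determined up to order. *)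
Lemma matching_heights v w m m' :
  triangle_det v != 0 -> triangle_det w != 0 ->
  `|triangle_det v| = `|triangle_det w| -> \sum_i grad_norm v i = \sum_i grad_norm w i ->
  grad_norm v m = grad_norm w m' ->
  exists f : 'I_3 -> 'I_3, injective f /\ forall j, grad_norm w j = grad_norm v (f j).
Proof.
move=> v0 w0 dE sE mE.
have [a [b mab]] := others m; have [a' [b' mab']] := others m'.
have mba : distinct3 m b a by move: mab => /and3P[? ? ?]; apply/and3P; split; rewrite // eq_sym.
have d2 : triangle_det v ^+ 2 = triangle_det w ^+ 2.
  by rewrite -(real_normK (num_real (triangle_det v))) dE real_normK// num_real.
have := heron v0 mab; have := heron w0 mab' => /=; rewrite -sE d2 -mE => hw hv.
have c0 : 4 / triangle_det w ^+ 2 != 0 by rewrite mulf_neq0// invr_eq0 sqrf_eq0.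
set S := \sum_i grad_norm v i in sE hv hw.
have := sum_distinct3 (grad_norm v) mab; rewrite -/S => Sv.
have := sum_distinct3 (grad_norm w) mab'; rewrite -sE -mE => Sw.
set x := grad_norm v a in Sv hv; set y := grad_norm v b in Sv hv.
set x' := grad_norm w a' in Sw hw; set y' := grad_norm w b' in Sw hw.
(* The factor to be cancelled is nonzero because the right-hand side of Heron's formula is. *)
have K0 : S * (S - 2 * grad_norm v m) != 0.
  by apply/eqP => e; move: hv c0; rewrite e !mul0r => <-; rewrite eqxx.
have : (S - 2 * x) * (S - 2 * y) = (S - 2 * x') * (S - 2 * y').
  by apply: (mulfI K0); rewrite !mulrA hv hw.
have y'E : y' = x + y - x' by lra.
rewrite y'E => e; have : (x' - x) * (x' - y) = 0 by lra.
move=> /eqP; rewrite mulf_eq0 !subr_eq0.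
have build (a0 b0 : 'I_3) : distinct3 m a0 b0 -> x' = grad_norm v a0 -> y' = grad_norm v b0 ->
    exists f : 'I_3 -> 'I_3, injective f /\ forall j, grad_norm w j = grad_norm v (f j).
  move=> mab0 xE yE.
  pose f j := if j == m' then m else if j == a' then a0 else b0.
  have /and3P[n1 n2 n3] := mab'.
  have fm : f m' = m by rewrite /f eqxx.
  have fa : f a' = a0 by rewrite /f eq_sym (negbTE n1) eqxx.
  have fb : f b' = b0 by rewrite /f eq_sym (negbTE n2) eq_sym (negbTE n3).
  exists f; split; first exact: third_inj mab' mab0 fm fa fb.
  by move=> j; have [->|->|->] := distinct3_cases j mab'; rewrite ?fm ?fa ?fb.
move=> /orP[/eqP xE|/eqP xE]; [apply: (build a b)|apply: (build b a)] => //.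
  by rewrite y'E xE addrC addKr.
by rewrite y'E xE addrK.
Qed.

(** Where [bary v i] vanishes, a small step away from the vertex i makes it negative, so the point
    is not interior. *)
Lemma interior_hull v : triangle_det v != 0 -> (hull v)° = open_triangle v.
Proof.
move=> v0; apply/seteqP; split; last first.
  by rewrite -open_subsetE; [exact: open_triangle_hull|exact: open_open_triangle].
move=> x xI i; have hx : hull v x := interior_subset xI.
rewrite lt_neqAle hx andbT eq_sym; apply/negP => /eqP lx.
have [e e0 eP] := nbhs_box xI.
pose M := `|x.1 - (v i).1| + `|x.2 - (v i).2| + 1.
have M0 : 0 < M by rewrite ltr_wpDl// addr_ge0.
pose s := e / 2 / M.
have s0 : 0 < s by rewrite !divr_gt0.
have small c : `|c| <= M -> `|s * c| < e.
  move=> cM; rewrite normrM (gtr0_norm s0) (@le_lt_trans _ _ (s * M))//.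
    by rewrite ler_wpM2l// ltW.
  by rewrite /s divfK ?gt_eqF//; lra.
have /(_ i) : hull v (x.1 + s * (x.1 - (v i).1), x.2 + s * (x.2 - (v i).2)).
  apply: eP => /=; rewrite addrAC subrr add0r; apply: small; rewrite /M.
    by rewrite -addrA lerDl addr_ge0.
  by rewrite addrAC lerDr addr_ge0.
rewrite bary_affine//=.
have -> : bary v i (0, 0) + (bary_grad v i).1 * (x.1 + s * (x.1 - (v i).1))
    + (bary_grad v i).2 * (x.2 + s * (x.2 - (v i).2)) = (1 + s) * bary v i x - s * bary v i (v i).
  by rewrite (bary_affine v0 i x) (bary_affine v0 i (v i)); ring.
by rewrite lx bary_vertex// eqxx mulr0 mulr1 sub0r oppr_ge0 leNgt s0.
Qed.

Lemma triangular_domainP (D : set (R * R)) : triangular_domain D ->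
  exists2 v, triangle_det v != 0 & D = open_triangle v.
Proof.
move=> [a [b [c [nc ->]]]].
pose v (i : 'I_3) : R * R := match val i with 0%N => a | 1%N => b | _ => c end.
have v0 : triangle_det v != 0.
  apply/eqP => e; apply: nc; rewrite /collinear.
  by apply/eqP; rewrite -subr_eq0; apply/eqP; rewrite -[RHS]e.
exists v => //; rewrite -interior_hull//; congr interior.
apply/seteqP; split => x.
  move=> [r [s [t [r0 s0 t0 rst ->]]]] i.
  pose q (i : 'I_3) : R := match val i with 0%N => r | 1%N => s | _ => t end.
  have q1 : \sum_i q i = 1 by rewrite sum_ord3.
  have -> : r *: a + s *: b + t *: c = (\sum_i q i * (v i).1, \sum_i q i * (v i).2).
    by rewrite !sum_ord3; apply: injective_projections.
  rewrite bary_of_combination//; apply: sumr_ge0 => j _; rewrite bary_vertex// mulr_ge0//.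
  by elim/ord3P: j.
move=> hx; exists (bary v o0 x), (bary v o1 x), (bary v o2 x); split => //.
  by rewrite -(sum_bary v0 x) sum_ord3.
by rewrite {1}(bary_combination v0 x) !sum_ord3; apply: injective_projections.
Qed.

End CongruentTriangles.

(** * Area, perimeter and least height from the heat content *)

Section HeatContentTriangle.
Context {R : realType}.
Implicit Types v w : 'I_3 -> R * R.

Lemma eq0_decay (x C : R) : (forall k, 1 <= k -> `|x| * k <= C) -> x = 0.
Proof.
move=> hx; apply/eqP; rewrite -normr_eq0; apply/negPn/negP => x0.
have xp : 0 < `|x| by rewrite lt_neqAle eq_sym x0 /=.
have k1 : 1 <= 1 + `|C| / `|x| by rewrite lerDl divr_ge0.
have := hx _ k1; rewrite mulrDr mulr1 mulrC divfK//.
by have := ler_norm C; lra.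
Qed.

(** Subtracting the values at k and k + 1 isolates the slope, which then decays and must vanish; the
    constant follows. *)
Lemma affine_eq0_decay (a b C : R) : (forall k, 1 <= k -> `|a * k + b| * k <= C) -> a = 0 /\ b = 0.
Proof.
move=> hab; have a0 : a = 0.
  apply: (@eq0_decay _ (2 * C)) => k k1.
  have h1 := hab _ k1; have k11 : 1 <= k + 1 by lra.
  have h2 := hab _ k11.
  have E : `|a| <= `|a * (k + 1) + b| + `|a * k + b|.
    by rewrite -[in leLHS](_ : (a * (k + 1) + b) - (a * k + b) = a) ?ler_normB//; ring.
  have h3 : `|a * (k + 1) + b| * k <= `|a * (k + 1) + b| * (k + 1) by rewrite ler_wpM2l// lerDl.
  have := ler_wpM2r (_ : 0 <= k) E; rewrite mulrDl => /(_ _); lra.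
split => //; apply: (@eq0_decay _ C) => k k1.
by have := hab _ k1; rewrite a0 mul0r add0r.
Qed.

Lemma expR_cubic_decay (h k : R) : 0 < h -> 0 < k -> k ^+ 3 * expR (- (k * h)) <= 6 / h ^+ 3.
Proof.
move=> h0 k0; have kh : 0 < k * h by rewrite mulr_gt0.
have := expR_ge1Dxn 2 (ltW kh); rewrite (_ : (3`!)%:R = 6 :> R)// => E.
rewrite ler_pdivlMr ?exprn_gt0// mulrAC -exprMn expRN ler_pdivrMr ?expR_gt0//.
by lra.
Qed.

(** The cubic bound serves the factor [k ^+ 2] of the upper estimate of the gap and the extra k used
    to show that quantities vanish; 6 is 3!, from the exponential series. *)
Lemma sqr_expR_decay (h k a b : R) : 0 < h -> 1 <= k -> 0 <= a -> 0 <= b ->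
  (a + b * k ^+ 2) * expR (- (k * h)) * k <= (a + b) * (6 / h ^+ 3).
Proof.
move=> h0 k1 a0 b0; have k0 : 0 < k by rewrite (lt_le_trans ltr01).
have k2 : 1 <= k ^+ 2 by rewrite expr2 mulr_ege1.
apply: (@le_trans _ _ ((a + b) * (k ^+ 3 * expR (- (k * h))))); last first.
  by rewrite ler_wpM2l ?addr_ge0// expR_cubic_decay.
rewrite (_ : (a + b) * _ = (a * k ^+ 2 + b * k ^+ 2) * expR (- (k * h)) * k); last by ring.
rewrite !ler_wpM2r// ?(ltW k0)// ?expR_ge0// lerD2r.
by rewrite ler_peMr.
Qed.

Definition laplace_content (H : R -> R) (k : R) : R :=
  k ^+ 2 * \int[lebesgue_measure]_(t in (`]0, +oo[%classic : set (measurableTypeR R)))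
    (expR (- k ^+ 2 * t) * H t).

(** The integral of the exit transform is replaced by its expression through H, so the triangle
    enters only through the absolute value of its determinant and the sum of its gradient norms. *)
Definition content_gap v (H : R -> R) (k : R) : R :=
  spectral_gap v (fun k => `|triangle_det v| / 2 - laplace_content H k) k.

Lemma lowest_height v : exists m, forall i, height v m <= height v i.
Proof.
have [h01|h10] := leP (height v o0) (height v o1); last first.
  have [h12|h21] := leP (height v o1) (height v o2).
    by exists o1; elim/ord3P => //; exact: ltW.
  by exists o2; elim/ord3P => //; [exact: ltW (lt_trans h21 h10)|exact: ltW].
have [h02|h20] := leP (height v o0) (height v o2).
  by exists o0; elim/ord3P.
exists o2; elim/ord3P => //; first exact: ltW.
exact: le_trans (ltW h20) h01.
Qed.

Lemma content_gap_bounds v H m k : triangle_det v != 0 ->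
  is_heat_content (open_triangle v) H -> (forall i, height v m <= height v i) -> 0 < k ->
  `|triangle_det v| * grad_norm v m ^+ 2
      * (expR (- (k * height v m)) - expR (- (k * height v m)) ^+ 2)
    <= content_gap v H k <=
  `|triangle_det v| * (\sum_i grad_norm v i ^+ 2 + 24 * k ^+ 2) * expR (- (k * height v m)).
Proof.
move=> v0 [u [uH HE]] hm k0.
have oD := open_open_triangle v0; have fD := open_triangle_finite v0.
have intE j : 0 < j -> \int[leb2 R]_(x in open_triangle v) exit_transform (open_triangle v) u j x
    = `|triangle_det v| / 2 - laplace_content H j.
  by move=> j0; rewrite (exit_transform_integral oD fD uH j0 HE) [X in fine X](measure_open_triangle v0).
have -> : content_gap v H k = spectral_gap v (fun j =>
    \int[leb2 R]_(x in open_triangle v) exit_transform (open_triangle v) u j x) k.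
  by rewrite /content_gap /spectral_gap !intE// mulr_gt0.
apply: spectral_gap_bounds => //; last exact: height_gt0.
- by move=> j j0; exact: continuous_exit_transform.
- by move=> j j0; exact: approx_solution_exit_transform.
- by move=> j x _; exact: exit_transform_out.
Qed.

Lemma content_gap_decay v H : triangle_det v != 0 -> is_heat_content (open_triangle v) H ->
  exists C, forall k, 1 <= k -> `|content_gap v H k| * k <= C.
Proof.
move=> v0 hH; have [m hm] := lowest_height v.
exists ((`|triangle_det v| * \sum_i grad_norm v i ^+ 2 + `|triangle_det v| * 24) * (6 / height v m ^+ 3)).
move=> k k1; have k0 : 0 < k by rewrite (lt_le_trans ltr01).
have /andP[lo up] := content_gap_bounds v0 hH hm k0.
rewrite ger0_norm; last first.
  apply: le_trans lo; apply: mulr_ge0; first by rewrite mulr_ge0 ?sqr_ge0.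
  rewrite subr_ge0 expr2 ler_piMr ?expR_ge0//.
  by rewrite expR_le1 oppr_le0 mulr_ge0// ltW// height_gt0.
apply: (@le_trans _ _ ((`|triangle_det v| * \sum_i grad_norm v i ^+ 2
  + `|triangle_det v| * 24 * k ^+ 2) * expR (- (k * height v m)) * k)).
  by rewrite ler_wpM2r ?(ltW k0)// (le_trans up)// mulrDr mulrA.
apply: sqr_expR_decay => //; first exact: height_gt0.
by rewrite mulr_ge0// sumr_ge0// => i _; exact: sqr_ge0.
Qed.

Lemma laplace_content_eq (H1 H2 : R -> R) k : (forall t, 0 < t -> H1 t = H2 t) ->
  laplace_content H1 k = laplace_content H2 k.
Proof.
move=> H12; rewrite /laplace_content; congr (_ * _); apply: eq_Rintegral => t.
by rewrite inE /= in_itv /= andbT => t0; rewrite H12.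
Qed.

(** In the difference of the gaps the transform of the heat content cancels. The coefficient - 3 / 2
    is 1 - 4 times the factor 1/2 relating area to determinant. Decay of both gaps kills the
    quadratic and the linear coefficient, and equality of determinants turns equal perimeters into
    equal sums of gradient norms. *)
Lemma content_gap_eq v w H1 H2 : triangle_det v != 0 -> triangle_det w != 0 ->
  is_heat_content (open_triangle v) H1 -> is_heat_content (open_triangle w) H2 ->
  (forall t, 0 < t -> H1 t = H2 t) ->
  [/\ `|triangle_det v| = `|triangle_det w|, \sum_i grad_norm v i = \sum_i grad_norm w i
    & forall k, content_gap v H1 k = content_gap w H2 k].
Proof.
move=> v0 w0 hv hw H12.
have [C1 hC1] := content_gap_decay v0 hv; have [C2 hC2] := content_gap_decay w0 hw.
set Jv := `|triangle_det v|; set Jw := `|triangle_det w|.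
pose Pv := Jv * \sum_i grad_norm v i; pose Pw := Jw * \sum_i grad_norm w i.
have E k : content_gap v H1 k - content_gap w H2 k
    = ((- (3 / 2) * (Jv - Jw)) * k + (Pv - Pw)) * k.
  rewrite /content_gap /spectral_gap !(laplace_content_eq _ H12) -/Jv -/Jw -/Pv -/Pw.
  by move: (laplace_content _ _) (laplace_content _ _) => p q; field.
have [a0 b0] : - (3 / 2) * (Jv - Jw) = 0 /\ Pv - Pw = 0.
  apply: (@affine_eq0_decay _ _ (C1 + C2)) => k k1.
  have k0 : 0 < k by rewrite (lt_le_trans ltr01).
  rewrite -[X in _ * X](gtr0_norm k0) -normrM -E.
  have n1 := hC1 _ k1; have n2 := hC2 _ k1.
  have n3 := ler_normB (content_gap v H1 k) (content_gap w H2 k).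
  have n4 t : 0 <= t -> t <= t * k by move=> t0; rewrite ler_peMr.
  have := n4 _ (normr_ge0 (content_gap v H1 k)); have := n4 _ (normr_ge0 (content_gap w H2 k)).
  by lra.
have JE : Jv = Jw by lra.
have Jw0 : Jw != 0 by rewrite normr_eq0.
split => //.
  by apply: (mulfI Jw0); rewrite -/Pw -[in LHS]JE -/Pv; lra.
by move=> k; apply/eqP; rewrite -subr_eq0 E a0 b0 mul0r addr0 mul0r.
Qed.

(** If the lowest height of w were larger, the common gap would be bounded below by a positive
    multiple of [expR (- (k * h))] and above by a quadratic polynomial in k times
    [expR (- (k * h'))], which is impossible for large k. *)
Lemma lowest_height_le v w H1 H2 m m' : triangle_det v != 0 -> triangle_det w != 0 ->
  is_heat_content (open_triangle v) H1 -> is_heat_content (open_triangle w) H2 ->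
  (forall t, 0 < t -> H1 t = H2 t) ->
  (forall i, height v m <= height v i) -> (forall i, height w m' <= height w i) ->
  height w m' <= height v m.
Proof.
move=> v0 w0 hv hw H12 hm hm'; rewrite leNgt; apply/negP => lt.
have [_ _ gE] := content_gap_eq v0 w0 hv hw H12.
set h := height v m in lt hm *; set h' := height w m' in lt hm' *.
have h0 : 0 < h := height_gt0 v0 m; have d0 : 0 < h' - h by rewrite subr_gt0.
pose Jv := `|triangle_det v|; pose Jw := `|triangle_det w|.
(* For k at least 1, [1 - expR (- h)] bounds [1 - expR (- (k * h))] from below, so c does not depend
   on k. *)
pose c := Jv * grad_norm v m ^+ 2 * (1 - expR (- h)).
have c0 : c = 0.
  apply: (@eq0_decay _ ((Jw * \sum_i grad_norm w i ^+ 2 + Jw * 24) * (6 / (h' - h) ^+ 3))) => k k1.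
  have k0 : 0 < k by rewrite (lt_le_trans ltr01).
  have /andP[lo _] := content_gap_bounds v0 hv hm k0.
  have /andP[_ up] := content_gap_bounds w0 hw hm' k0.
  rewrite gE -/h -/Jv in lo; rewrite -/h' -/Jw in up; have lu := le_trans lo up.
  have S0 : 0 <= \sum_i grad_norm w i ^+ 2 by rewrite sumr_ge0// => i _; exact: sqr_ge0.
  apply: (@le_trans _ _ ((Jw * \sum_i grad_norm w i ^+ 2 + Jw * 24 * k ^+ 2)
      * expR (- (k * (h' - h))) * k)); last first.
    have J0 : 0 <= Jw := normr_ge0 _.
    by apply: sqr_expR_decay => //; apply: mulr_ge0.
  rewrite ler_wpM2r ?(ltW k0)//.
  have G0 : 0 <= Jv * grad_norm v m ^+ 2 by rewrite mulr_ge0 ?sqr_ge0 ?normr_ge0.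
  rewrite ger0_norm; last first.
    by rewrite mulr_ge0// subr_ge0 expR_le1 oppr_le0 ltW.
  have e0 := expR_gt0 (- (k * h)).
  rewrite -(ler_pM2r e0) -[leRHS]mulrA -expRD.
  rewrite (_ : - (k * (h' - h)) + - (k * h) = - (k * h')); last by ring.
  rewrite (_ : Jw * _ + _ = Jw * (\sum_i grad_norm w i ^+ 2 + 24 * k ^+ 2)); last by ring.
  apply: le_trans lu; rewrite /c -[leLHS]mulrA; apply: (ler_wpM2l G0).
  rewrite mulrBl mul1r expr2 lerD2l lerN2 ler_wpM2r ?(ltW e0)//.
  by rewrite ler_expR lerN2 ler_peMl// ltW.
suff : c != 0 by rewrite c0 eqxx.
apply: mulf_neq0; last by rewrite gt_eqF// subr_gt0 expR_lt1 oppr_lt0.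
by rewrite mulf_neq0 ?normr_eq0// expf_neq0// gt_eqF// grad_norm_gt0.
Qed.

End HeatContentTriangle.

Local Close Scope classical_set_scope.

Theorem theorem1p1 (R : realType) (D1 D2 : set (R * R)) (H1 H2 : R -> R)
  (hD1 : triangular_domain D1) (hD2 : triangular_domain D2)
  (hH1 : is_heat_content D1 H1) (hH2 : is_heat_content D2 H2)
  (hH : forall t : R, 0 < t -> H1 t = H2 t) :
  isometric_domains D1 D2.
Proof.
have [v v0 Dv] := triangular_domainP hD1; have [w w0 Dw] := triangular_domainP hD2.
rewrite Dv in hH1 *; rewrite Dw in hH2 *.
have [JE SE _] := content_gap_eq v0 w0 hH1 hH2 hH.
have [m hm] := lowest_height v; have [m' hm'] := lowest_height w.
have hE : height v m = height w m'.
  apply: le_anti; apply/andP; split; last exact: lowest_height_le hH1 hH2 hH hm hm'.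
  by apply: lowest_height_le hH2 hH1 _ hm' hm => // t t0; rewrite hH.
have [|f [fI fE]] := matching_heights v0 w0 JE SE (m := m) (m' := m').
  by rewrite -[LHS]invrK -[RHS]invrK; congr (_^-1).
exact: isometric_open_triangles fI JE fE.
Qed.
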